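(* Let $R>0$, $\sigma>0$, $\delta>0$, let $d>0$ be sufficiently small, and let $\mathcal R=\{z\in\mathbb C:\ \Re z\in(\delta,+\infty),\ \Im z\in(-d,d)\}$. For $k\in\mathcal R$ let $R(k):=(\Delta^2-k^2-\mathrm ik\sigma)^{-1}$ on $\mathbb R^3$. Then for each $k\in\mathcal R$ and $\rho\in C_0^\infty(B_R)$ the resolvent operator $R(k)$ is analytic (in $k$) and satisfies the estimate $$\|\rho R(k)\rho\|_{L^2(B_R)\to H^j(B_R)}\lesssim|k|^{\frac j2}e^{2R(\sigma+1)|k|^{\frac12}},\quad j=0,1,2,3,4.$$
   Context: $B_R=\{x\in\mathbb R^3:|x|<R\}$ (the number $R$ in $B_R$ and in the exponent is the radius; $R(k)$ is the resolvent operator). The operator $R(k)$ maps $f$ to the solution of $\Delta^2u-\kappa^4u=f$ with $\kappa=(k^2+\mathrm ik\sigma)^{1/4}$, $\Re\kappa>0$, $\Im\kappa>0$, namely $$(R(k)f)(x)=\frac1{2\kappa^2}\int_{\mathbb R^3}\Big(\frac{e^{\mathrm i\kappa|x-y|}}{4\pi|x-y|}-\frac{e^{-\kappa|x-y|}}{4\pi|x-y|}\Big)f(y)\,\mathrm dy$$ for compactly supported $f\in L^2$. The notation $a\lesssim b$ means $a\le Cb$ with a generic constant $C>0$, independent of $k$ and $\sigma$ (it may depend on $\rho$, $R$, $\delta$, $d$). The smallness required of $d$ may depend on $\sigma$ and $\delta$. *)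

(* Defs.v *)
From HB Require Import structures.
From mathcomp Require Import all_boot all_order all_algebra.
From mathcomp.real_closed Require Import complex.
From mathcomp Require Import all_classical all_reals all_analysis.
Import Order.TTheory GRing.Theory Num.Theory.
Import numFieldNormedType.Exports.

Set Implicit Arguments.
Unset Strict Implicit.
Unset Printing Implicit Defensive.

Local Open Scope classical_set_scope.
Local Open Scope complex_scope.
Local Open Scope ring_scope.

Section Space.
Variable R : realType.

(* The topology on R3 comes from the sup norm of the product; the Euclidean
   norm enters through [enorm]. *)
Definition R3 : Type :=
  (measurableTypeR R * measurableTypeR R * measurableTypeR R)%type.

HB.instance Definition _ := Measurable.on R3.
HB.instance Definition _ := NormedModule.on R3.

Definition mu3 : {measure set R3 -> \bar R} :=
  ((@lebesgue_measure R \x @lebesgue_measure R) \x @lebesgue_measure R)%E.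

Definition enorm (x : R3) : R :=
  Num.sqrt (x.1.1 ^+ 2 + x.1.2 ^+ 2 + x.2 ^+ 2).

Definition eball (r : R) : set R3 := [set x | enorm x < r].

Definition basis3 (i : 'I_3) : R3 :=
  ((((i : nat) == 0)%:R, ((i : nat) == 1)%:R), ((i : nat) == 2)%:R).

End Space.

Section Smooth.
Variable R : realType.
Implicit Types (f : R3 R -> R) (D : set (R3 R)).

Definition partials (s : seq 'I_3) f : R3 R -> R :=
  foldr (fun i g => 'D_(basis3 R i) g) f s.

(* Frechet differentiability of every iterated partial derivative (in any
   order) is equivalent to being C^oo. *)
Definition smooth f : Prop := forall s x, differentiable (partials s f) x.

(* C_0^oo(D), real-valued. *)
Definition Cc_infty D f : Prop :=
  [/\ smooth f, compact (closure [set x | f x != 0])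
    & closure [set x | f x != 0] `<=` D].

(* C_0^oo(D), complex-valued. *)
Definition Cc_inftyC D (f : R3 R -> R[i]) : Prop :=
  Cc_infty D (fun x => complex.Re (f x)) /\
  Cc_infty D (fun x => complex.Im (f x)).

End Smooth.

Section Sobolev.
Variable R : realType.
Implicit Types (f g u : R3 R -> R[i]) (D : set (R3 R)).

Definition Cintegral D f : R[i] :=
  (\int[@mu3 R]_(x in D) complex.Re (f x))
  +i* (\int[@mu3 R]_(x in D) complex.Im (f x)).

Definition measurableC D f : Prop :=
  measurable_fun D (fun x => complex.Re (f x)) /\
  measurable_fun D (fun x => complex.Im (f x)).

Definition L2sq D f : \bar R :=
  (\int[@mu3 R]_(x in D) ((Normc.normc (f x)) ^+ 2)%:E)%E.

Definition L2norm D f : \bar R := sqrte (L2sq D f).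

Definition inL2 D f : Prop := measurableC D f /\ (L2norm D f < +oo)%E.

(* Multi-indices of order at most j are the a : {ffun 'I_3 -> 'I_j.+1} with
   [mindex_order a <= j]. *)
Definition mindex_order j (a : {ffun 'I_3 -> 'I_j.+1}) : nat :=
  (\sum_(i < 3) a i)%N.

Definition mindex_partial j (a : {ffun 'I_3 -> 'I_j.+1}) (phi : R3 R -> R) :
    R3 R -> R :=
  partials (flatten [seq nseq (a i) i | i <- enum 'I_3]) phi.

Definition weak_derivative D j (a : {ffun 'I_3 -> 'I_j.+1}) u g : Prop :=
  forall phi : R3 R -> R, Cc_infty D phi ->
    Cintegral D (fun x => u x * (mindex_partial a phi x)%:C) =
    (-1) ^+ mindex_order a * Cintegral D (fun x => g x * (phi x)%:C).

Definition weak_derivatives D j u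
    (g : {ffun 'I_3 -> 'I_j.+1} -> R3 R -> R[i]) : Prop :=
  inL2 D u /\
  forall a, (mindex_order a <= j)%N ->
    inL2 D (g a) /\ weak_derivative D a u (g a).

(* The H^j(D) norm. The weak derivatives of u are unique up to null sets, so the
   infimum is over a single value when u is in H^j(D), and over the empty set
   (hence +oo) otherwise. *)
Definition Hnorm D j u : \bar R :=
  ereal_inf [set sqrte (\sum_(a : {ffun 'I_3 -> 'I_j.+1}
                              | (mindex_order a <= j)%N) L2sq D (g a))%E
            | g in weak_derivatives D u].

End Sobolev.

Section Operators.
Variable R : realType.
Implicit Types (f g : R3 R -> R[i]) (D : set (R3 R)).

(* Bounded linear operators L^2(D) -> H^j(D), acting on representatives. *)
Definition bounded_linear_op D j (A : (R3 R -> R[i]) -> (R3 R -> R[i])) : Prop :=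
  (forall (c : R[i]) f g, inL2 D f -> inL2 D g ->
     {ae @mu3 R, forall x, D x ->
        A (fun y => c * f y + g y) x = c * A f x + A g x}) /\
  (exists M : R, forall f, inL2 D f -> (Hnorm D j (A f) <= M%:E * L2norm D f)%E).

(* Holomorphy on U of an operator-valued function: complex differentiability in
   the operator norm of the bounded operators L^2(D) -> H^j(D). *)
Definition analytic_op D j
    (T : R[i] -> (R3 R -> R[i]) -> (R3 R -> R[i])) (U : set R[i]) : Prop :=
  forall k, U k ->
    bounded_linear_op D j (T k) /\
    exists2 A, bounded_linear_op D j A &
      forall eps : R, 0 < eps -> exists2 eta : R, 0 < eta &
        forall h : R[i], h != 0 -> Normc.normc h < eta ->
        forall f, inL2 D f ->
          (Hnorm D j (fun x => h^-1 * (T (k + h) f x - T k f x) - A f x)%R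
             <= eps%:E * L2norm D f)%E.

End Operators.

Section Resolvent.
Variable R : realType.

Definition cexp (z : R[i]) : R[i] :=
  (expR (complex.Re z))%:C * (cos (complex.Im z) +i* sin (complex.Im z)).

(* (k^2 + i k sigma)^(1/4) in the open first quadrant; there is exactly one such
   root as soon as Im (k^2 + i k sigma) > 0. *)
Definition kappa (sigma : R) (k : R[i]) : R[i] :=
  xget 0 [set z | [/\ z ^+ 4 = k ^+ 2 + 'i%C * k * sigma%:C,
                      0 < complex.Re z & 0 < complex.Im z]].

(* (Delta^2 - k^2 - i k sigma)^-1 on R^3, for compactly supported f in L^2. *)
Definition resolvent (sigma : R) (k : R[i]) (f : R3 R -> R[i]) : R3 R -> R[i] :=
  let kap := kappa sigma k in
  fun x => (2%:R * kap ^+ 2)^-1 *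
    Cintegral setT (fun y : R3 R =>
      (cexp ('i%C * kap * (enorm (x - y))%:C) / (4 * pi * enorm (x - y))%:C
       - cexp (- kap * (enorm (x - y))%:C) / (4 * pi * enorm (x - y))%:C) * f y).

Definition cut_resolvent (rho : R3 R -> R[i]) (sigma : R) (k : R[i])
    (f : R3 R -> R[i]) : R3 R -> R[i] :=
  fun x => rho x * resolvent sigma k (fun y => rho y * f y) x.

Definition half_strip (delta d : R) : set R[i] :=
  [set z | [/\ delta < complex.Re z, - d < complex.Im z & complex.Im z < d]].

End Resolvent.

(* Main.v *)
(** With [z] for the fourth root [kappa], the kernel of the resolvent is
    [(e^(izs) - e^(-zs)) / (8 pi z^2 s)] with [s = |x - y|]. Its Taylor expansion in
    [s] is [c1 - s/(8 pi) + c3 s^2 + c5 s^4 + Psi(s)/s]: the terms [s^-1] and [s^3]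
    cancel, and the only term that is not C^4 in [x], the biharmonic fundamental
    solution [-s/(8 pi)], does not depend on [k]. The rest is C^4 on bounded sets with norm
    polynomial in [|z|], because [|e^(izs)|, |e^(-zs)| <= 1]; it is bounded from
    L^2 to H^4 directly, and [e^(2R(sigma+1)|k|^(1/2))] dominates all polynomials in
    [|k|] and [sigma].

    For the term linear in [s], replace [|x|] by [(|x|^2 + e^2)^(1/2)] cut off at
    infinity. Its bilaplacian [-15 e^4 (|x|^2 + e^2)^(-7/2)] is dominated by a product
    of three Poisson kernels, so Schur's test bounds the bilaplacian of the
    convolution with [f] in L^2, uniformly in [e], and integration by parts turns
    this into a bound of all fourth derivatives. Weak compactness then gives the
    weak derivatives in the limit [e -> 0].

    Differentiating the exponentials in [k] and applying the same bounds to the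
    second-order remainder of the kernel gives analyticity. *)
Require Import Defs.
From HB Require Import structures.
From mathcomp Require Import all_boot all_order all_algebra.
From mathcomp.real_closed Require Import complex.
From mathcomp Require Import all_classical all_reals all_analysis.
From mathcomp Require Import measurable_realfun ring lra zify.
Import Order.TTheory GRing.Theory Num.Theory.
Import numFieldNormedType.Exports.

Set Implicit Arguments.
Unset Strict Implicit.
Unset Printing Implicit Defensive.

Local Open Scope classical_set_scope.
Local Open Scope complex_scope.
Local Open Scope ring_scope.

(** All estimates are made once, for kernels [N(s)/s] with an abstract numerator [N]. A bound [M] on
    the Taylor coefficients of [N] below order six and on its sixth derivative, together with
    [N(0) = N''''(0) = 0], gives a bound from L^2 to H^4 that is linear in [M]. The resolvent, its
    derivative in [k] and the remainder of its difference quotient all have this form, so growth and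
    analyticity become pointwise statements on [N]. Six derivatives of [e^(izs)] cost [|z|^6], hence
    at most [(|k| + sigma)^3]. The obstacle is the kernel [s] itself: its fourth derivatives have
    size [s^-3], which is not integrable at the origin of R^3, so no single one of them can be
    estimated by absolute values. After regularisation only the combination in the bilaplacian is
    bounded in L^1 uniformly in [e]; the other derivatives come from the energy identity, and the
    cut-off removes boundary terms from it. Limits are taken as late as possible: sums and cut-offs
    act on regularised functions, which converge uniformly on the ball with a common Sobolev
    bound. *)

Section DerivativeRules.
Variables (R : realType) (V : normedModType R).
Implicit Types (f g : V -> R) (x v : V) (a b : R).

Lemma der_eq f x v a b : is_derive x v f a -> a = b -> is_derive x v f b.
Proof. by move=> df <-. Qed.

Lemma derC c x v : is_derive x v (fun=> c : R) 0.
Proof. exact: is_derive_cst. Qed.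

Lemma derD f g x v a b : is_derive x v f a -> is_derive x v g b ->
  is_derive x v (fun y => f y + g y) (a + b).
Proof. by move=> df dg; apply: (is_deriveD df dg). Qed.

Lemma derB f g x v a b : is_derive x v f a -> is_derive x v g b ->
  is_derive x v (fun y => f y - g y) (a - b).
Proof. by move=> df dg; apply: (is_deriveB df dg). Qed.

Lemma derM f g x v a b : is_derive x v f a -> is_derive x v g b ->
  is_derive x v (fun y => f y * g y) (a * g x + f x * b).
Proof.
move=> df dg; apply: der_eq (is_deriveM df dg) _.
by rewrite /GRing.scale /= addrC mulrC.
Qed.

Lemma derZ c f x v a : is_derive x v f a -> is_derive x v (fun y => c * f y) (c * a).
Proof. by move=> df; apply: der_eq (derM (derC c x v) df) _; rewrite mul0r add0r. Qed.

(** A directional derivative sees the function along a line only. This reduces the chain rule on R3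
    to one variable, and lets coordinates that are fixed along a basis direction be treated as
    constants. *)
Lemma is_derive_line f x v a :
  is_derive x v f a <-> is_derive (0 : R) (1 : R) (fun h => f (h *: v + x)) a.
Proof.
have e : (fun h : R => h^-1 *: (f (h *: v + x) - f x)) =
  (fun h : R => h^-1 *: ((fun h => f (h *: v + x)) (h *: (1 : R) + 0) -
     (fun h => f (h *: v + x)) 0)).
  by apply/funext => h; rewrite [h *: 1]mulr1 addr0 scale0r add0r.
split; move=> [df <-].
  by split; [move: df; rewrite /derivable e|rewrite /derive e].
by split; [move: df; rewrite /derivable e|rewrite /derive e].
Qed.

Lemma der1_comp (f g : R -> R) (x a b : R) : is_derive (g x) (1 : R) f a ->
  is_derive x (1 : R) g b -> is_derive x (1 : R) (fun y => f (g y)) (a * b).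
Proof. by move=> df dg; apply: is_derive1_comp. Qed.

Lemma der_comp (F : R -> R) f x v a b : is_derive (f x) (1 : R) F a ->
  is_derive x v f b -> is_derive x v (fun y => F (f y)) (a * b).
Proof.
move=> dF /is_derive_line df; apply/is_derive_line.
by apply: (@der1_comp F (fun h => f (h *: v + x))) => //; rewrite scale0r add0r.
Qed.

Lemma derX n f x v a : is_derive x v f a ->
  is_derive x v (fun y => f y ^+ n) (n%:R * f x ^+ n.-1 * a).
Proof.
move=> df; have -> : (fun y => f y ^+ n) = f ^+ n by apply/funext => y; rewrite exprfctE.
exact: is_deriveX.
Qed.

Lemma derV f x v a : f x != 0 -> is_derive x v f a ->
  is_derive x v (fun y => (f y)^-1) (- a / f x ^+ 2).
Proof.
move=> f0 df; have [d e] := df.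
split; first exact: derivableV.
by rewrite deriveV// e /GRing.scale /= mulNr mulrC mulNr.
Qed.

Lemma der_id (y : R) : is_derive y (1 : R) id 1.
Proof. exact: is_derive_id. Qed.

End DerivativeRules.

(** * Square-integrable functions *)

Section SquareIntegrable.
Context d (T : measurableType d) (R : realType) (mu : {measure set T -> \bar R}).
Implicit Types (D : set T) (f g h : T -> R).

(** The L^2 theory is real-valued: the pairings [inner] are then plain real numbers, and complex
    functions enter later through their real and imaginary parts. *)
Definition l2 D f :=
  measurable_fun D f /\ mu.-integrable D (fun x => (f x ^+ 2)%:E).

Definition inner D f g : R := \int[mu]_(x in D) (f x * g x).

Lemma integrableE D f g : measurable D -> (forall x, D x -> f x = g x) ->
  mu.-integrable D (EFin \o f) -> mu.-integrable D (EFin \o g).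
Proof.
move=> mD fg; apply: eq_integrable => // x /set_mem Dx /=.
by rewrite fg.
Qed.

Lemma integrable_dominated D f g : measurable D -> measurable_fun D f ->
  (forall x, D x -> `|f x| <= g x) ->
  mu.-integrable D (EFin \o g) -> mu.-integrable D (EFin \o f).
Proof.
move=> mD mf fg; apply: le_integrable => //; first exact/measurable_EFinP.
by move=> x Dx /=; rewrite lee_fin (le_trans (fg _ Dx))// ler_norm.
Qed.

Lemma integrableRD D f g : measurable D -> mu.-integrable D (EFin \o f) ->
  mu.-integrable D (EFin \o g) ->
  mu.-integrable D (EFin \o (fun x => f x + g x)).
Proof. by move=> mD fi gi; apply: (integrableD mD fi gi). Qed.

Lemma integrableRB D f g : measurable D -> mu.-integrable D (EFin \o f) ->
  mu.-integrable D (EFin \o g) ->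
  mu.-integrable D (EFin \o (fun x => f x - g x)).
Proof. by move=> mD fi gi; apply: (integrableB mD fi gi). Qed.

Lemma integrableRZ D c f : measurable D -> mu.-integrable D (EFin \o f) ->
  mu.-integrable D (EFin \o (fun x => c * f x)).
Proof. by move=> mD fi; exact: (integrableZl mD c fi). Qed.

Lemma integrable_const D (c : R) : measurable D -> (mu D < +oo)%E ->
  mu.-integrable D (EFin \o cst c).
Proof.
move=> mD muD; apply/integrableP; split; first exact/measurable_EFinP.
by rewrite /= integral_cst// lte_mul_pinfty.
Qed.

Lemma l2M D f g : measurable D -> l2 D f -> l2 D g ->
  mu.-integrable D (EFin \o (fun x => f x * g x)).
Proof.
move=> mD [mf f2] [mg g2].
apply: (@integrable_dominated _ _ (fun x => f x ^+ 2 + g x ^+ 2)) => //.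
- exact: measurable_funM.
- move=> x _ /=; rewrite ler_norml; apply/andP; split; nra.
- exact: integrableRD.
Qed.

Lemma l2D D f g : measurable D -> l2 D f -> l2 D g -> l2 D (fun x => f x + g x).
Proof.
move=> mD l2f l2g; have [mf f2] := l2f; have [mg g2] := l2g; split.
  exact: measurable_funD.
apply: (@integrable_dominated _ _ (fun x => 2 * (f x ^+ 2 + g x ^+ 2))) => //.
- by apply: measurable_funX; exact: measurable_funD.
- by move=> x _ /=; rewrite ger0_norm ?sqr_ge0//; have := sqr_ge0 (f x - g x); nra.
- by apply: integrableRZ => //; exact: integrableRD.
Qed.

Lemma l2Z D c f : measurable D -> l2 D f -> l2 D (fun x => c * f x).
Proof.
move=> mD [mf f2]; split; first exact: measurable_funM.
apply: (@integrableE _ (fun x => c ^+ 2 * f x ^+ 2)) => //.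
  by move=> x _; rewrite exprMn.
exact: integrableRZ.
Qed.

Lemma l2B D f g : measurable D -> l2 D f -> l2 D g -> l2 D (fun x => f x - g x).
Proof.
move=> mD l2f l2g.
have -> : (fun x => f x - g x) = (fun x => f x + (-1) * g x).
  by apply/funext => x; rewrite mulN1r.
by apply: l2D => //; exact: l2Z.
Qed.

Lemma l2_bounded D f (M : R) : measurable D -> (mu D < +oo)%E ->
  measurable_fun D f -> (forall x, D x -> `|f x| <= M) -> l2 D f.
Proof.
move=> mD muD mf fM; split => //.
apply: (@integrable_dominated _ _ (cst (M ^+ 2))) => //.
- exact: measurable_funX.
- move=> x Dx /=; rewrite ger0_norm ?sqr_ge0// -real_normK ?num_real//.
  by rewrite ler_sqr ?nnegrE ?(le_trans _ (fM _ Dx)) ?fM.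
- exact: integrable_const.
Qed.

Lemma innerC D f g : inner D f g = inner D g f.
Proof. by apply: eq_Rintegral => x _; rewrite mulrC. Qed.

Lemma innerDl D f g h : measurable D -> l2 D f -> l2 D g -> l2 D h ->
  inner D (fun x => f x + g x) h = inner D f h + inner D g h.
Proof.
move=> mD lf lg lh; rewrite /inner -RintegralD//; [|exact: l2M..].
by apply: eq_Rintegral => x _; rewrite mulrDl.
Qed.

Lemma innerZl D c f h : measurable D -> l2 D f -> l2 D h ->
  inner D (fun x => c * f x) h = c * inner D f h.
Proof.
move=> mD lf lh; rewrite /inner -RintegralZl//; last exact: l2M.
by apply: eq_Rintegral => x _; rewrite mulrA.
Qed.

Lemma innerBl D f g h : measurable D -> l2 D f -> l2 D g -> l2 D h ->
  inner D (fun x => f x - g x) h = inner D f h - inner D g h.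
Proof.
move=> mD lf lg lh; rewrite /inner -RintegralB//; [|exact: l2M..].
by apply: eq_Rintegral => x _; rewrite mulrBl.
Qed.

Lemma innerDr D f g h : measurable D -> l2 D f -> l2 D g -> l2 D h ->
  inner D f (fun x => g x + h x) = inner D f g + inner D f h.
Proof. by move=> *; rewrite innerC innerDl// innerC (innerC _ h). Qed.

Lemma innerZr D c f h : measurable D -> l2 D f -> l2 D h ->
  inner D f (fun x => c * h x) = c * inner D f h.
Proof. by move=> *; rewrite innerC innerZl// innerC. Qed.

Lemma innerBr D f g h : measurable D -> l2 D f -> l2 D g -> l2 D h ->
  inner D f (fun x => g x - h x) = inner D f g - inner D f h.
Proof. by move=> *; rewrite innerC innerBl// innerC (innerC _ h). Qed.

Lemma inner_ge0 D f : 0 <= inner D f f.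
Proof. by apply: Rintegral_ge0 => x _; rewrite -expr2 sqr_ge0. Qed.

Lemma inner_young D f g : measurable D -> l2 D f -> l2 D g ->
  2 * `|inner D f g| <= inner D f f + inner D g g.
Proof.
move=> mD lf lg.
have := inner_ge0 D (fun x => f x - g x).
rewrite innerBl ?innerBr//; [|exact: l2B..].
have := inner_ge0 D (fun x => f x + g x).
rewrite innerDl ?innerDr//; [|exact: l2D..].
rewrite (innerC D g f); case: (ler0P (inner D f g)); lra.
Qed.

(** The quadratic polynomial [t -> |f - t g|^2] is nonnegative; it is evaluated at its minimum
    [t = (f,g)/(g,g)]. *)
Lemma inner_cauchy_schwarz D f g : measurable D -> l2 D f -> l2 D g ->
  inner D f g ^+ 2 <= inner D f f * inner D g g.
Proof.
move=> mD lf lg.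
have H t : 0 <= inner D f f - 2 * t * inner D f g + t ^+ 2 * inner D g g.
  have := inner_ge0 D (fun x => f x - t * g x).
  have ltg : l2 D (fun x => t * g x) by exact: l2Z.
  rewrite innerBl ?innerBr//; [|exact: l2B..].
  by rewrite !innerZr// !innerZl// (innerC D g f); lra.
have := inner_ge0 D g; rewrite le_eqVlt => /predU1P[g0|g0].
  rewrite -g0 mulr0; have [->|fg0] := eqVneq (inner D f g) 0; first by rewrite expr0n.
  (* For [(g,g) = 0] the polynomial is affine in [t], and at this [t] it would equal -1. *)
  have := H ((inner D f f + 1) / (2 * inner D f g)).
  rewrite -g0; set a := inner D f f; set b := inner D f g in fg0 *.
  have -> : a - 2 * ((a + 1) / (2 * b)) * b + ((a + 1) / (2 * b)) ^+ 2 * 0 = -1.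
    by field.
  by rewrite ler0N1.
have := H (inner D f g / inner D g g).
set a := inner D f f; set b := inner D f g; set c := inner D g g in g0 *.
have -> : a - 2 * (b / c) * b + (b / c) ^+ 2 * c = (a * c - b ^+ 2) / c.
  by field; rewrite gt_eqF.
by rewrite pmulr_lge0 ?invr_gt0// subr_ge0.
Qed.

Lemma inner_ereal D f : measurable D -> l2 D f ->
  (\int[mu]_(x in D) (f x ^+ 2)%:E)%E = (inner D f f)%:E.
Proof.
move=> mD lf; rewrite /inner /Rintegral.
under [X in fine X]eq_integral do rewrite -expr2.
by rewrite fineK//; apply: integrable_fin_num => //; case: lf.
Qed.

(** Fatou's lemma and Schur's test deliver bounds on extended-real integrals; this turns such a
    bound into membership in L^2 with a real estimate. *)
Lemma l2_of_le D f (Q : R) : measurable D -> measurable_fun D f ->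
  (\int[mu]_(x in D) (f x ^+ 2)%:E <= Q%:E)%E -> l2 D f /\ inner D f f <= Q.
Proof.
move=> mD mf fQ.
have lf : l2 D f.
  split => //; apply/integrableP; split.
    by apply/measurable_EFinP; exact: measurable_funX.
  apply: le_lt_trans (ltry Q); rewrite (le_trans _ fQ)//.
  by rewrite le_eqVlt; apply/orP; left; apply/eqP; apply: eq_integral => x _ /=;
     rewrite ger0_norm// sqr_ge0.
by split => //; rewrite -lee_fin -inner_ereal.
Qed.

End SquareIntegrable.

(** * Weak compactness in L^2 *)

Section WeakLimit.
Context d (T : measurableType d) (R : realType) (mu : {measure set T -> \bar R}).
Variable D : set T.
Hypotheses (mD : measurable D) (muD : (mu D < +oo)%E).
Implicit Types (f g : T -> R) (h : nat -> T -> R).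

(** The increments are summable in L^1, so the sum of their absolute values is integrable, hence
    finite almost everywhere, and there the telescoping series converges absolutely. *)
Lemma ae_cvg_of_summable h (c : R) : 0 <= c ->
  (forall k, measurable_fun D (h k)) ->
  (forall k, (\int[mu]_(x in D) (`|h k.+1 x - h k x|)%:E
                <= (c / (2 ^ k.+1)%:R)%:E)%E) ->
  {ae mu, forall x, D x -> cvgn (fun k => h k x)}.
Proof.
move=> c0 mh hc.
pose u k x := (`|h k.+1 x - h k x|)%:E : \bar R.
have mu_u k : measurable_fun D (u k).
  by apply/measurable_EFinP; apply: measurableT_comp => //; exact: measurable_funB.
have u0 k x : D x -> (0 <= u k x)%E by rewrite lee_fin normr_ge0.
pose G x := (\sum_(k <oo) u k x)%E.
have G0 x : (0 <= G x)%E by apply: nneseries_ge0 => k _ _; rewrite lee_fin normr_ge0.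
have mG : measurable_fun D G.
  by apply: ge0_emeasurable_sum => // k x Dx _; exact: u0.
have iG : mu.-integrable D G.
  apply/integrableP; split => //.
  rewrite (eq_integral G); last by move=> x _; rewrite gee0_abs.
  rewrite integral_nneseries//.
  apply: (@le_lt_trans _ _ (\sum_(k <oo) (c / (2 ^ k.+1)%:R)%:E)%E).
    apply: lee_nneseries => [k _ _|k _]; last exact: hc.
    by apply: integral_ge0 => x Dx; exact: u0.
  by apply: le_lt_trans (epsilon_trick0 xpredT c0) _; rewrite ltry.
have := integrable_ae mD iG; apply: filterS => x Gfin Dx.
have {}Gfin := Gfin Dx.
have : cvgn (series (telescope (fun k => h k x))).
  apply: normed_cvg; apply: nondecreasing_is_cvgn.
    apply/nondecreasing_seqP => n.
    rewrite -[leRHS]/(series (fun k => `|telescope (h ^~ x) k|) n.+1).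
    rewrite -[leLHS]/(series (fun k => `|telescope (h ^~ x) k|) n).
    by rewrite seriesSr lerDl normr_ge0.
  exists (fine (G x)) => _ [n _ <-]; rewrite -lee_fin fineK//.
  rewrite /series/= -sumEFin.
  by apply: nneseries_lim_ge => k _ _; exact: u0.
rewrite telescopeK => /cvg_ex[l hl]; apply/cvg_ex; exists (l + h 0%N x).
have -> : (fun k => h k x) = (fun k => (h k x - h 0%N x) + h 0%N x).
  by apply/funext => k; rewrite subrK.
by apply: cvgD => //; exact: cvg_cst.
Qed.

Lemma fatou_le f g h (B : R) : measurable_fun D f -> measurable_fun D g ->
  (forall k, measurable_fun D (h k)) ->
  {ae mu, forall x, D x -> (fun k => h k x) @ \oo --> g x} ->
  (\forall k \near \oo, (\int[mu]_(x in D) ((f x - h k x) ^+ 2)%:E <= B%:E)%E) ->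
  (\int[mu]_(x in D) ((f x - g x) ^+ 2)%:E <= B%:E)%E.
Proof.
move=> mf mg mh hg hB.
pose v k x := ((f x - h k x) ^+ 2)%:E : \bar R.
have mv k : measurable_fun D (v k).
  by apply/measurable_EFinP; apply: measurable_funX; exact: measurable_funB.
have v0 k x : D x -> (0 <= v k x)%E by rewrite lee_fin sqr_ge0.
have := fatou mu mD mv v0.
have -> : (\int[mu]_(x in D) limn_einf (v ^~ x) =
           \int[mu]_(x in D) ((f x - g x) ^+ 2)%:E)%E.
  apply: ae_eq_integral => //.
  - under eq_fun do rewrite limn_einf_lim.
    apply: (emeasurable_fun_cvg (fun n x => einfs (v ^~ x) n)) => //.
      by move=> n; exact: measurable_fun_einfs.
    move=> x Dx; exact: is_cvg_einfs.
  - by apply/measurable_EFinP; apply: measurable_funX; exact: measurable_funB.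
  - move: hg; apply: filterS => x hx Dx.
    have : v ^~ x @ \oo --> (((f x - g x) ^+ 2)%:E : \bar R).
      apply: cvg_EFin; first exact: nearW.
      by apply: cvgM; (apply: cvgB; [exact: cvg_cst|exact: hx]).
    by move/cvg_limn_einf_sup => -[-> _].
move/le_trans; apply.
rewrite limn_einf_lim; apply: lime_le; first exact: is_cvg_einfs.
case: hB => N _ hN.
near=> m; apply: (@le_trans _ _ (\int[mu]_(x in D) v m x)%E).
  by apply: ereal_inf_lbound; exists m => /=.
by apply: hN => /=; near: m; exact: nbhs_infty_ge.
Unshelve. all: by end_near. Qed.

Local Notation l2 := (l2 mu D).
Local Notation inner := (inner mu D).

(** Completeness of L^2 for sequences with a prescribed rate. The limit [g] is the pointwise upper
    limit, made real everywhere by [fine]; it is described by the distance bounds that it inherits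
    from the sequence, since this is what Fatou's lemma gives. *)
Lemma l2_complete h (c : R) : 0 <= c -> (forall k, l2 (h k)) ->
  (forall k m, (k <= m)%N ->
     inner (fun x => h k x - h m x) (fun x => h k x - h m x) <= c / 8 ^+ k) ->
  exists2 g : T -> R, measurable_fun D g &
    forall f (B : R), measurable_fun D f ->
      (\forall k \near \oo,
         inner (fun x => f x - h k x) (fun x => f x - h k x) <= B) ->
      l2 f -> (\int[mu]_(x in D) ((f x - g x) ^+ 2)%:E <= B%:E)%E.
Proof.
move=> c0 lh hc.
have mh k : measurable_fun D (h k) by case: (lh k).
have aeh : {ae mu, forall x, D x -> cvgn (fun k => h k x)}.
  apply: (@ae_cvg_of_summable h (2 * (c + fine (mu D)))) => //.
    by rewrite mulr_ge0// addr_ge0// fine_ge0.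
  have muDf : mu D \is a fin_num by rewrite ge0_fin_numE.
  move=> k.
  have l2d : l2 (fun x => h k x - h k.+1 x) by exact: l2B.
  (* Young's inequality [|a| <= t a^2 + 1/t] with [t = 2^k]: the first term integrates to at most
     [2^k c/8^k], the second to [mu(D)/2^k], and both are summable. Here the finiteness of [mu(D)]
     enters. *)
  apply: (@le_trans _ _ (\int[mu]_(x in D)
      (2 ^+ k * (h k x - h k.+1 x) ^+ 2 + (2 ^+ k)^-1)%:E)%E).
    apply: ge0_le_integral => //.
    - apply/measurable_EFinP; apply: measurableT_comp => //.
      exact: measurable_funB.
    - apply/measurable_EFinP; apply: measurable_funD => //.
      by apply: measurable_funM => //; apply: measurable_funX; exact: measurable_funB.
    - move=> x Dx; rewrite lee_fin distrC.
      set a := h k x - h k.+1 x; set t := 2 ^+ k.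
      have t0 : 0 < t by rewrite exprn_gt0.
      have : 0 <= (t * `|a| - 1) ^+ 2 / t by rewrite divr_ge0 ?sqr_ge0 ?ltW.
      have -> : (t * `|a| - 1) ^+ 2 / t = t * `|a| ^+ 2 - 2 * `|a| + t^-1.
        by field; rewrite gt_eqF.
      have := normr_ge0 a; rewrite real_normK ?num_real//; lra.
  have i1 : mu.-integrable D (EFin \o (fun x => 2 ^+ k * (h k x - h k.+1 x) ^+ 2)).
    by apply: integrableRZ => //; case: l2d.
  have i2 : mu.-integrable D (EFin \o cst ((2 ^+ k)^-1 : R)).
    exact: integrable_const.
  rewrite (integralD_EFin mD i1 i2) /= integral_cst//.
  under eq_integral do rewrite EFinM.
  rewrite integralZl//; last by case: l2d.
  rewrite (inner_ereal mD l2d) -(fineK muDf) -!EFinM -EFinD lee_fin.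
  have := hc k k.+1 (leqnSn k).
  have -> : 8 ^+ k = 2 ^+ k * (2 ^+ k * 2 ^+ k) :> R.
    by rewrite -!exprMn; congr (_ ^+ _); ring.
  have t1 : (1 : R) <= 2 ^+ k by rewrite exprn_ege1// ler1n.
  rewrite natrX exprS; set t := 2 ^+ k in t1 *.
  set q := inner _ _ => hq.
  have t0 : 0 < t by lra.
  have -> : 2 * (c + fine (mu D)) / (2 * t) = c / t + t^-1 * fine (mu D).
    by field; rewrite gt_eqF.
  rewrite lerD2r; apply: (@le_trans _ _ (t * (c / (t * (t * t))))).
    by rewrite ler_pM2l.
  have -> : t * (c / (t * (t * t))) = (c / t) / t by field; rewrite gt_eqF.
  by rewrite ler_pdivrMr// ler_peMr// divr_ge0// ltW.
pose g x := fine (limn_esup (fun k => (h k x)%:E)).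
have mg : measurable_fun D g.
  apply: (@measurableT_comp _ _ _ _ _ _ (@fine R)) => //.
  by apply: measurable_fun_limn_esup => k; exact/measurable_EFinP.
exists g => // f B mf hB lf.
apply: (@fatou_le f g h B) => //.
- move: aeh; apply: filterS => x hx Dx.
  have {}hx := hx Dx.
  have : (fun k => (h k x)%:E) @ \oo --> ((limn (fun k => h k x))%:E : \bar R).
    by apply: cvg_EFin; [exact: nearW|exact: hx].
  by move/cvg_limn_einf_sup => [_ e]; rewrite /g e.
- move: hB; apply: filterS => k.
  have lfk : l2 (fun x => f x - h k x) by exact: l2B.
  by rewrite (inner_ereal mD lfk) lee_fin.
Qed.

(** The parallelogram law, arranged so that a lower bound on the norm of the midpoint makes [f - g]
    small. *)
Lemma midpoint_identity f g : l2 f -> l2 g ->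
  inner (fun x => f x - g x) (fun x => f x - g x) =
  2 * inner f f + 2 * inner g g -
  4 * inner (fun x => 2^-1 * (f x + g x)) (fun x => 2^-1 * (f x + g x)).
Proof.
move=> lf lg; have ld := l2B mD lf lg; have ls := l2D mD lf lg.
rewrite innerZl//; last exact: l2Z.
rewrite innerZr// innerBl// !innerBr// innerDl// !innerDr// (innerC _ _ g f).
by field.
Qed.

(** The infimum of the squared norm over [P n] increases with [n] and stays below [Q], so it
    converges to some [s]. Elements of [P (N k)] whose squared norm is below [s + 8^-k] are Cauchy
    by the parallelogram law, because their midpoints are again in the set. The limit need not lie
    in any [P n], so the conclusion keeps the approximants [h k]. *)
Lemma nested_convex_limit (P : nat -> (T -> R) -> Prop) (Q : R) :
  (forall n f, P n.+1 f -> P n f) ->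
  (forall n f g, P n f -> P n g -> P n (fun x => 2^-1 * (f x + g x))) ->
  (forall n f, P n f -> l2 f) ->
  (forall n, exists2 f, P n f & inner f f <= Q) ->
  exists2 g, l2 g /\ inner g g <= Q &
    exists2 h, (forall k, P k (h k)) &
      forall k, inner (fun x => h k x - g x) (fun x => h k x - g x) <= 8 / 8 ^+ k.
Proof.
move=> Pdec Pmid Pl2 Pne.
have {}Pdec m n f : (m <= n)%N -> P n f -> P m f.
  move=> /subnK <-; elim: (n - m)%N => //= i IH Pf; apply: IH; apply: Pdec.
  by rewrite -addSn.
pose E n := [set q | exists2 f, P n f & q = inner f f].
pose dd n := inf (E n).
have E0 n : lbound (E n) 0 by move=> _ [f _ ->]; exact: inner_ge0.
have Elb n : has_lbound (E n) by exists 0; exact: E0.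
have Ene n : E n !=set0 by have [f Pf _] := Pne n; exists (inner f f); exists f.
have dQ n : dd n <= Q.
  have [f Pf fQ] := Pne n; apply: le_trans fQ; apply: ge_inf => //.
  by exists f.
have dmono m n : (m <= n)%N -> dd m <= dd n.
  move=> mn; apply: lb_le_inf => // _ [f Pf ->].
  by apply: ge_inf => //; exists f => //; exact: Pdec Pf.
pose s := sup (range dd).
have dub : has_ubound (range dd) by exists Q => _ [n _ <-].
have ds n : dd n <= s by apply: ub_le_sup => //; exists n.
have sQ : s <= Q by apply: ge_sup; [exists (dd 0%N); exists 0%N|move=> _ [n _ <-]].
pose e k : R := (8 ^+ k)^-1.
have e0 k : 0 < e k by rewrite invr_gt0 exprn_gt0.
have emono k m : (k <= m)%N -> e m <= e k.
  move=> km; rewrite lef_pV2 ?posrE ?exprn_gt0//.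
  by apply: ler_weXn2l => //; rewrite ler1n.
have /choice[N0 hN0] : forall k, exists n, s - e k < dd n.
  move=> k; have [||_ [n _ <-] hn] := @sup_adherent _ (range dd) (e k) => //.
    by split => //; exists (dd 0%N); exists 0%N.
  by exists n.
(* The index is made monotone and at least [k], so that the later of two approximants also lies in
   the set of the earlier one. *)
pose N k := (\max_(i < k.+1) (N0 i + i))%N.
have NN k : (N0 k + k <= N k)%N by exact: (@leq_bigmax _ (fun i : 'I_k.+1 => (N0 i + i)%N) ord_max).
have Nk k : (k <= N k)%N by apply: leq_trans (NN k); exact: leq_addl.
have Nmono k m : (k <= m)%N -> (N k <= N m)%N.
  move=> km; apply/bigmax_leqP => i _.
  have im : (i < m.+1)%N by apply: leq_trans (ltn_ord i) _.
  exact: (@leq_bigmax _ (fun i : 'I_m.+1 => (N0 i + i)%N) (Ordinal im)).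
have dN k : s - e k < dd (N k).
  by apply: lt_le_trans (hN0 k) _; apply: dmono; apply: leq_trans (NN k); exact: leq_addr.
have /choice[h hh] : forall k, exists f, P (N k) f /\ inner f f < s + e k.
  move=> k; have [|_ [f Pf ->] hf] := @inf_adherent _ (E (N k)) (e k) (e0 k).
    by split.
  exists f; split => //; apply: lt_le_trans hf _.
  by rewrite lerD2r; exact: ds.
have lh k : l2 (h k) by apply: Pl2; case: (hh k) => + _; exact.
have hcauchy k m : (k <= m)%N ->
    inner (fun x => h k x - h m x) (fun x => h k x - h m x) <= 8 / 8 ^+ k.
  move=> km; rewrite midpoint_identity//.
  have [Pk hk] := hh k; have [Pm hm] := hh m.
  have Pkm : P (N k) (fun x => 2^-1 * (h k x + h m x)).
    by apply: Pmid => //; apply: Pdec Pm; exact: Nmono.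
  have : dd (N k) <= inner (fun x => 2^-1 * (h k x + h m x))
                          (fun x => 2^-1 * (h k x + h m x)).
    by apply: ge_inf => //; exists (fun x => 2^-1 * (h k x + h m x)).
  have := dN k; have := emono _ _ km; rewrite -/(e k); lra.
have [|g mg hg] := @l2_complete h 8 _ lh hcauchy; first by [].
have hkg k : (\int[mu]_(x in D) ((h k x - g x) ^+ 2)%:E <= (8 / 8 ^+ k)%:E)%E.
  apply: hg => //; first by case: (lh k).
  by exists k => // m /= km; exact: hcauchy.
have ldk k := l2_of_le mD (measurable_funB (proj1 (lh k)) mg) (hkg k).
have lg : l2 g.
  have -> : g = (fun x => h 0%N x - (h 0%N x - g x)) by apply/funext => x; ring.
  by apply: l2B => //; case: (ldk 0%N).
exists g; last first.
  exists h; last by move=> k; case: (ldk k).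
  by move=> k; have [Pk _] := hh k; apply: Pdec Pk; exact: Nk.
split => //; apply/ler_addgt0Pr => eps eps0.
have l20 : l2 (fun=> 0) by apply: (@l2_bounded _ _ _ _ _ _ 0) => // x _; rewrite normr0.
(* The norm of [g] is its distance to 0, so the distance bound of [l2_complete] applies to it. *)
have : (\int[mu]_(x in D) ((0 - g x) ^+ 2)%:E <= (Q + eps)%:E)%E.
  apply: (hg (fun=> 0)) => //.
  near=> k.
  have -> : inner (fun x => 0 - h k x) (fun x => 0 - h k x) = inner (h k) (h k).
    by apply: eq_Rintegral => x _; rewrite !sub0r mulrNN.
  have [_ hk] := hh k; apply: ltW; apply: lt_le_trans hk _; apply: lerD => //.
  apply: ltW; near: k.
  have : e @ \oo --> 0.
    have -> : e = (fun k => (8^-1) ^+ k) by apply/funext => k; rewrite /e exprVn.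
    by apply: cvg_expr; rewrite ger0_norm ?invr_ge0// invf_lt1// ltr1n.
  move=> /cvgrPdist_lt /(_ _ eps0); apply: filterS => k.
  by rewrite sub0r normrN ger0_norm// ltW.
under eq_integral do rewrite sub0r sqrrN.
by rewrite (inner_ereal mD lg) lee_fin.
Unshelve. all: by end_near. Qed.

(** Mazur's argument: the sets [P n] below replace the closed convex hulls of the tails of [w], and
    the norm-convergent elements [h k] of these sets carry the limits of the pairings over to [g].
    As all pairings are assumed to converge, no subsequence is extracted and the index type [I] may
    be uncountable. *)
Lemma weak_compactness (I : Type) (phi : I -> T -> R) (L : I -> R) (w : nat -> T -> R)
    (Q : R) :
  (forall i, l2 (phi i)) -> (forall n, l2 (w n)) -> (forall n, inner (w n) (w n) <= Q) ->
  (forall i, (fun n => inner (w n) (phi i)) @ \oo --> L i) ->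
  exists2 g, l2 g /\ inner g g <= Q & forall i, inner g (phi i) = L i.
Proof.
move=> lphi lw wQ wL.
(* [f] is as close to each limit [L i] as the whole tail of [w] from [n] on is known to be. This
   condition is stable under midpoints and holds for [w n]. *)
pose P n f := l2 f /\ forall i eps,
  (forall m, (n <= m)%N -> `|inner (w m) (phi i) - L i| <= eps) ->
  `|inner f (phi i) - L i| <= eps.
have [| | | |g [lg gQ] [h Ph hg]] := @nested_convex_limit P Q.
- move=> n f [lf hf]; split => // i eps heps; apply: hf => m nm.
  by apply: heps; exact: ltnW.
- move=> n f g [lf hf] [lg hg]; split; first by apply: l2Z => //; exact: l2D.
  move=> i eps heps; have := hf _ _ heps; have := hg _ _ heps.
  rewrite innerZl//; last exact: l2D.
  rewrite innerDl// !ler_norml; set a := inner _ _; set b := inner _ _.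
  by move=> /andP[? ?] /andP[? ?]; apply/andP; split; lra.
- by move=> n f [].
- move=> n; exists (w n) => //; split => // i eps; exact.
exists g => // i.
have h1 : (fun k => inner (h k) (phi i)) @ \oo --> L i.
  apply/cvgrPdist_le => eps eps0.
  have /cvgrPdist_le/(_ _ eps0)[N _ hN] := wL i.
  exists N => // k /= Nk; rewrite distrC; apply: (proj2 (Ph k)) => m km.
  by rewrite distrC; apply: hN => /=; exact: leq_trans km.
have h2 : (fun k => inner (h k) (phi i)) @ \oo --> inner g (phi i).
  have lhk k : l2 (h k) by case: (Ph k).
  set b := inner (phi i) (phi i).
  have b0 : 0 <= b by exact: inner_ge0.
  apply/cvgrPdist_le => eps eps0.
  have : (fun k => (8^-1 : R) ^+ k) @ \oo --> 0.
    by apply: cvg_expr; rewrite ger0_norm ?invr_ge0// invf_lt1// ltr1n.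
  have c0 : 0 < eps ^+ 2 / (8 * (b + 1)).
    by rewrite divr_gt0// ?exprn_gt0// mulr_gt0// ltr_wpDl.
  move=> /cvgrPdist_le/(_ _ c0); apply: filterS => k.
  rewrite sub0r normrN ger0_norm ?exprn_ge0 ?invr_ge0// => hk.
  rewrite distrC -innerBl//.
  rewrite -(@ler_pXn2r _ 2) ?nnegrE ?normr_ge0 ?(ltW eps0)// real_normK ?num_real//.
  apply: le_trans (inner_cauchy_schwarz mD (l2B mD (lhk k) lg) (lphi i)) _.
  apply: (@le_trans _ _ (8 / 8 ^+ k * b)); first by rewrite ler_wpM2r.
  rewrite -exprVn; apply: (@le_trans _ _ (8 * (eps ^+ 2 / (8 * (b + 1))) * b)).
    by rewrite ler_wpM2r// ler_wpM2l.
  have -> : 8 * (eps ^+ 2 / (8 * (b + 1))) * b = eps ^+ 2 * (b / (b + 1)).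
    by field; rewrite gt_eqF// ltr_wpDl.
  by rewrite ler_piMr ?sqr_ge0// ler_pdivrMr ?ltr_wpDl// mul1r lerDl.
exact: (cvg_unique _ h2 h1).
Qed.

End WeakLimit.

(** * Lebesgue measure on R^3 *)

Section Space3.
Variable R : realType.
Notation mu := (@mu3 R).
Notation leb := (@lebesgue_measure R).
Implicit Types (f g : R3 R -> R) (x y : R3 R).

Definition proj3 (i : 'I_3) x : R :=
  if (i : nat) == 0%N then x.1.1 else if (i : nat) == 1%N then x.1.2 else x.2.

Lemma proj3_cases i : [\/ proj3 i = (fun x => x.1.1), proj3 i = (fun x => x.1.2)
  | proj3 i = (fun x => x.2)].
Proof.
by case: i => [[|[|[|//]]] hi]; [apply: Or31|apply: Or32|apply: Or33].
Qed.

Lemma continuous_proj3 i : continuous (proj3 i).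
Proof.
move=> x; have [->|->|->] := proj3_cases i.
- by apply: (@cvg_comp _ _ _ fst fst); exact: cvg_fst.
- by apply: (@cvg_comp _ _ _ fst snd); [exact: cvg_fst|exact: cvg_snd].
- exact: cvg_snd.
Qed.

Lemma measurable_proj3 i : measurable_fun setT (proj3 i).
Proof.
have [->|->|->] := proj3_cases i.
- by apply: measurableT_comp.
- by apply: measurableT_comp.
- exact: measurable_snd.
Qed.

Lemma cvg_floor_grid (t : R) :
  (fun n => (Num.floor (t * n.+1%:R))%:~R / n.+1%:R : R) @ \oo --> t.
Proof.
apply: (@squeeze_cvgr _ _ _ _ (fun n => t - n.+1%:R^-1) (cst t)).
- near=> n; have n0 : (0 : R) < n.+1%:R by rewrite ltr0n.
  rewrite /cst ler_pdivlMr// ler_pdivrMr// floor_le andbT.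
  have := floorD1_gt (t * n.+1%:R); rewrite intrD mulrBl mulVf ?gt_eqF//; lra.
- rewrite -[X in _ --> X]subr0; apply: cvgB; first exact: cvg_cst.
  exact: cvg_harmonic.
- exact: cvg_cst.
Unshelve. all: by end_near. Qed.

(** Measurability refers to the product sigma-algebra. A continuous function is the pointwise limit
    of its values at the corners of a grid of mesh [1/(n+1)], and each such step function is
    constant on countably many half-open boxes. *)
Lemma continuous_measurable f : continuous f -> measurable_fun setT f.
Proof.
move=> cf.
pose p n (t : R) : R := (Num.floor (t * n.+1%:R))%:~R / n.+1%:R.
pose h n x : R := f (p n x.1.1, p n x.1.2, p n x.2).
apply: (@measurable_fun_cvg _ _ _ _ h); last first.
  move=> [[a b] c] _.
  apply: (@cvg_comp _ _ _ (fun n => ((p n a, p n b), p n c) : R3 R) f _ _ _ _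
    (cf (a, b, c))).
  have h1 : (fun n => (p n a, p n b)) @ \oo --> ((a, b) : R * R).
    apply: (@cvg_pair _ _ _ _ (nbhs (a : R)) (nbhs (b : R))); exact: cvg_floor_grid.
  apply: (@cvg_pair _ _ _ _ (nbhs ((a, b) : R * R)) (nbhs (c : R)));
    [exact: h1|exact: cvg_floor_grid].
move=> n _ Y mY; rewrite setTI.
have n0 : (0 : R) < n.+1%:R by rewrite ltr0n.
pose J (a : int) := `[a%:~R / n.+1%:R, (a + 1)%:~R / n.+1%:R[%classic : set R.
have JP (a : int) (t : R) : J a t -> a = Num.floor (t * n.+1%:R).
  rewrite /J /= in_itv/= ler_pdivrMr// ltr_pdivlMr// => ht.
  by apply/esym/floor_def.
have JP' (t : R) : J (Num.floor (t * n.+1%:R)) t.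
  by rewrite /J /= in_itv/= ler_pdivrMr// ltr_pdivlMr// floor_itv.
pose F (q : int * int * int) : set (R3 R) :=
  if f (q.1.1%:~R / n.+1%:R, q.1.2%:~R / n.+1%:R, q.2%:~R / n.+1%:R) \in Y
  then (J q.1.1 `*` J q.1.2) `*` J q.2 else set0.
have -> : h n @^-1` Y = \bigcup_q F q.
  apply/seteqP; split.
    move=> [[a b] c] /= hY.
    exists (Num.floor (a * n.+1%:R), Num.floor (b * n.+1%:R), Num.floor (c * n.+1%:R)) => //.
    by rewrite /F /= mem_set.
  move=> [[a b] c] [[[q1 q2] q3] _]; rewrite /F /=; case: ifPn => // /set_mem hY.
  move=> [[/= /JP e1 /JP e2] /JP e3]; rewrite /h /p /=.
  by rewrite -e1 -e2 -e3.
apply: countable_bigcupT_measurable => // q; rewrite /F; case: ifP => // _.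
by apply: measurableX; [apply: measurableX|]; exact: measurable_itv.
Qed.

(** Supports are confined to cubes rather than balls: a product of intervals is at once measurable,
    compact and of explicit volume. *)
Definition cube (A : R) : set (R3 R) :=
  (`[- A, A] `*` `[- A, A]) `*` `[- A, A].

Lemma measurable_cube A : measurable (cube A).
Proof. by apply: measurableX; [apply: measurableX|]; exact: measurable_itv. Qed.

Lemma cubeP A x : cube A x <-> forall i, `|proj3 i x| <= A.
Proof.
rewrite /cube /=; split.
  move=> [[]] /=; rewrite !in_itv/= -!ler_norml => h1 h2 h3 i.
  by rewrite /proj3; case: ifP => // _; case: ifP.
move=> h; have := h ord0; have := h (@Ordinal 3 1 isT); have := h ord_max.
rewrite /proj3 /= => h3 h2 h1; split; [split|] => /=; by rewrite in_itv/= -ler_norml.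
Qed.

Lemma mu3_cube A : (mu (cube A) < +oo)%E.
Proof.
set I := `[- A, A]%classic.
have mI : measurable (I : set (measurableTypeR R)) by exact: measurable_itv.
have h2 : (leb \x leb)%E (I `*` I) = (leb I * leb I)%E.
  exact: product_measure1E.
have : ((leb \x leb) \x leb)%E ((I `*` I) `*` I) = (leb I * leb I * leb I)%E.
  rewrite -h2; apply: product_measure1E => //; exact: measurableX.
rewrite /cube /mu3 /= => ->; rewrite lebesgue_measure_itv/=.
by case: ifP => _; rewrite ?mul0e ?mule0 ?ltry// -!EFinD -!EFinM ltry.
Qed.

Lemma compact_cube A : compact (cube A).
Proof.
by apply: compact_setX; [apply: compact_setX|]; exact: segment_compact.
Qed.

Lemma bounded_on_cube f A : continuous f -> exists M, 0 <= M /\ forall x, cube A x -> `|f x| <= M.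
Proof.
move=> cf; have : compact (f @` cube A).
  apply: continuous_compact; last exact: compact_cube.
  exact: continuous_subspaceT.
move=> /compact_bounded[M [Mreal hM]]; exists (`|M| + 1); split.
  by rewrite addr_ge0.
move=> x Ax; apply: (hM (`|M| + 1)); last by exists x.
by rewrite (le_lt_trans (ler_norm _))// ltrDl.
Qed.

End Space3.

Section SigmaFinite.
Variable R : realType.
Notation leb := (@lebesgue_measure R).

(** A name for the product measure, to which sigma-finiteness is attached. Fubini's theorem on R3
    and on pairs of points of R3 goes through [leb2] and [leb3]; the latter is [mu3] by
    conversion. *)
Definition leb2 : set (measurableTypeR R * measurableTypeR R)%type -> \bar R :=
  (leb \x leb)%E.
HB.instance Definition _ := Measure.on leb2.

Lemma leb2_square (A : R) : (leb2 (`[- A, A] `*` `[- A, A])%R < +oo)%E.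
Proof.
set I := `[_, _]%classic.
have mI : measurable (I : set (measurableTypeR R)) by exact: measurable_itv.
rewrite /leb2 product_measure1E//= lebesgue_measure_itv/=.
by case: ifP => _; rewrite ?mul0e ?mule0 ?ltry// -!EFinD -!EFinM ltry.
Qed.

Let leb2_sigma_finite : sigma_finite setT leb2.
Proof.
exists (fun n : nat => `[- n%:R, n%:R] `*` `[- n%:R, n%:R]).
  apply/seteqP; split => // -[a b] _.
  exists (Num.bound (Num.max `|a| `|b|)) => //=.
  have := archi_boundP (normr_ge0 (Num.max `|a| `|b|)).
  rewrite [X in Num.bound X]ger0_norm ?le_max ?normr_ge0// ger0_norm ?le_max ?normr_ge0//.
  rewrite gt_max => /andP[ha hb]; split => /=; rewrite in_itv/= -ler_norml ltW//.
move=> n; set I := `[_, _]%classic.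
have mI : measurable (I : set (measurableTypeR R)) by exact: measurable_itv.
by split; [exact: measurableX|exact: leb2_square].
Qed.

HB.instance Definition _ := Measure_isSigmaFinite.Build _ _ _ leb2
  leb2_sigma_finite.

Definition leb3 : set (R3 R) -> \bar R := (leb2 \x leb)%E.
HB.instance Definition _ := Measure.on leb3.

Let leb3_sigma_finite : sigma_finite setT leb3.
Proof.
exists (fun n : nat => cube n%:R).
  apply/seteqP; split => // x _.
  exists (Num.bound (\sum_i `|proj3 i x|)) => //=; apply/cubeP => i.
  have h0 : 0 <= \sum_i `|proj3 i x| by apply: sumr_ge0.
  have := archi_boundP h0; move/ltW; apply: le_trans.
  by rewrite (bigD1 i)//= lerDl sumr_ge0.
by move=> n; split; [exact: measurable_cube|exact: mu3_cube].
Qed.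

HB.instance Definition _ := Measure_isSigmaFinite.Build _ _ _ leb3
  leb3_sigma_finite.

End SigmaFinite.

(** * Integration by parts on R3 *)

Section Parts.
Variable R : realType.
Notation mu := (@mu3 R).
Notation leb := (@lebesgue_measure R).
Implicit Types (f g : R3 R -> R) (x y : R3 R).

Lemma integral_derivative_line (f g : R -> R) (A : R) :
  (forall t, is_derive t (1 : R) f (g t)) -> continuous g ->
  (forall t, A < `|t| -> f t = 0) -> (forall t, A < `|t| -> g t = 0) ->
  (\int[leb]_t (g t)%:E = 0)%E.
Proof.
(* [A] may be negative, hence the absolute value; [f] vanishes at [-B] and [B]. *)
move=> df cg f0 g0; pose B := `|A| + 1.
have B0 : 0 < B by rewrite ltr_wpDl.
have AB : A < B by rewrite (le_lt_trans (ler_norm A))// ltrDl.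
have -> : (\int[leb]_t (g t)%:E = \int[leb]_(t in `[(- B)%R, B]) (g t)%:E)%E.
  rewrite [RHS]integral_mkcond; apply: eq_integral => t _.
  rewrite patchE; case: ifPn => // /negP tB; rewrite g0//.
  rewrite ltNge; apply/negP => tA; apply: tB; rewrite inE/= in_itv/= -ler_norml.
  by rewrite (le_trans tA)// ltW.
have cf : continuous f.
  by move=> t; apply/differentiable_continuous/derivable1_diffP; case: (df t).
rewrite (@continuous_FTC2 _ g f).
- by rewrite !f0 ?normrN ?gtr0_norm// -EFinB subrr.
- by rewrite (lt_trans _ B0)// oppr_lt0.
- exact: continuous_subspaceT.
- split; [by move=> t _; case: (df t)|exact/cvg_at_right_filter/cf|
          exact/cvg_at_left_filter/cf].
- by move=> t _; rewrite derive1E; case: (df t).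
Qed.

Definition vanish_off (A : R) f := forall x, ~ cube A x -> f x = 0.

Lemma vanish_off_derivative f (df : R) A v x : closed (cube A) -> vanish_off A f ->
  ~ cube A x -> is_derive x v f df -> df = 0.
Proof.
move=> cA fA xA dfx.
have : is_derive x v (cst 0 : R3 R -> R) df.
  apply: near_eq_is_derive dfx.
  have : nbhs x (~` cube A) by apply: open_nbhs_nbhs; split => //; exact: closed_openC.
  by apply: filterS => y yA; rewrite fA.
by case=> _ <-; rewrite derive_cst.
Qed.

Lemma closed_cube (A : R) : closed (cube A).
Proof.
apply: compact_closed; last exact: compact_cube.
exact: norm_hausdorff.
Qed.

Lemma integrable_cont_vanish f A : continuous f -> vanish_off A f ->
  mu.-integrable setT (EFin \o f).
Proof.
move=> cf fA; have [M [M0 hM]] := bounded_on_cube A cf.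
have mf := continuous_measurable cf.
have iM : mu.-integrable setT (EFin \o (fun x => M * \1_(cube A) x)).
  apply: integrableRZ => //.
  apply/integrableP; split.
    by apply/measurable_EFinP; apply: measurable_indic; exact: measurable_cube.
  under eq_integral do rewrite /= ger0_norm//.
  by rewrite integral_indic ?setIT//; [exact: mu3_cube|exact: measurable_cube].
apply: (integrable_dominated _ _ _ iM) => // x _ /=.
rewrite indicE; have [/set_mem xA|/negP xA] := boolP (x \in cube A).
  by rewrite mulr1 hM.
by rewrite mulr0 fA ?normr0// => /mem_set.
Qed.

Definition set_coord (i : 'I_3) x (t : R) : R3 R :=
  if (i : nat) == 0%N then ((t, x.1.2), x.2)
  else if (i : nat) == 1%N then ((x.1.1, t), x.2) else (x.1, t).

Lemma set_coordD (i : 'I_3) x t h :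
  set_coord i x (h *: (1 : R) + t) = h *: basis3 R i + set_coord i x t.
Proof.
case: x => -[a b] c; rewrite /set_coord /basis3.
by case: i => [[|[|[|//]]] hi] /=; congr ((_, _), _);
  rewrite /= /GRing.scale /= ?mulr1 ?mulr0 ?add0r.
Qed.

Lemma proj3_set_coord i x t : proj3 i (set_coord i x t) = t.
Proof. by rewrite /proj3 /set_coord; case: i => [[|[|[|//]]] hi]. Qed.

Lemma is_derive_set_coord f g i x t :
  is_derive (set_coord i x t) (basis3 R i) f (g (set_coord i x t)) ->
  is_derive t (1 : R) (fun s => f (set_coord i x s)) (g (set_coord i x t)).
Proof.
move=> [df <-].
have e : (fun h => h^-1 *: ((fun s => f (set_coord i x s)) (h *: (1 : R) + t) -
            (fun s => f (set_coord i x s)) t)) =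
   (fun h => h^-1 *: (f (h *: basis3 R i + set_coord i x t) - f (set_coord i x t))).
  by apply/funext => h /=; rewrite set_coordD.
by split; [rewrite /derivable e|rewrite /derive e].
Qed.

Lemma continuous_set_coord i x : continuous (set_coord i x).
Proof.
case: x => -[a b] c t; rewrite /set_coord.
case: i => [[|[|[|//]]] hi] /=.
- have h1 : (fun s : R => (s, b)) @ t --> ((t, b) : R * R).
    by apply: (@cvg_pair _ _ _ _ (nbhs (t : R)) (nbhs (b : R))); [exact: cvg_id|exact: cvg_cst].
  by apply: (@cvg_pair _ _ _ _ (nbhs ((t, b) : R * R)) (nbhs (c : R))); [exact: h1|exact: cvg_cst].
- have h1 : (fun s : R => (a, s)) @ t --> ((a, t) : R * R).
    by apply: (@cvg_pair _ _ _ _ (nbhs (a : R)) (nbhs (t : R)));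
    [exact: cvg_cst|exact: cvg_id].
  by apply: (@cvg_pair _ _ _ _ (nbhs ((a, t) : R * R)) (nbhs (c : R))); [exact: h1|exact: cvg_cst].
- by apply: (@cvg_pair _ _ _ _ (nbhs ((a, b) : R * R)) (nbhs (t : R)));
    [exact: cvg_cst|exact: cvg_id].
Qed.

Lemma integral_line_derivative f g i A x :
  (forall x, is_derive x (basis3 R i) f (g x)) -> continuous g ->
  vanish_off A f -> (\int[leb]_t (g (set_coord i x t))%:E = 0)%E.
Proof.
move=> df cg fA.
have out t : A < `|t| -> ~ cube A (set_coord i x t).
  by move=> tA /cubeP/(_ i); rewrite proj3_set_coord leNgt tA.
apply: (@integral_derivative_line (fun t => f (set_coord i x t)) _ A).
- by move=> t; apply: is_derive_set_coord.
- move=> t; apply: continuous_comp; [exact: continuous_set_coord|exact: cg].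
- by move=> t /out /fA.
- move=> t /out tA; apply: vanish_off_derivative tA (df _) => //; exact: closed_cube.
Qed.

(** For the second application of Fubini's theorem, inside a plane: integrability on R3 by itself
    controls almost every slice, not each one. *)
Lemma integrable_slice f A (c : R) : continuous f -> vanish_off A f ->
  (@leb2 R).-integrable setT (fun p => (f (p, c))%:E).
Proof.
move=> cf fA; have [M [M0 hM]] := bounded_on_cube A cf.
have mf := continuous_measurable cf.
pose Q : set (measurableTypeR R * measurableTypeR R)%type :=
  `[- A, A]%classic `*` `[- A, A]%classic.
have mI : measurable (`[- A, A]%classic : set (measurableTypeR R)) by exact: measurable_itv.
have mQ : measurable (Q : set (measurableTypeR R * measurableTypeR R)%type).
  exact: measurableX.
have iM : (@leb2 R).-integrable setT (EFin \o (fun p => M * \1_Q p)).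
  apply: integrableRZ => //.
  apply/integrableP; split.
    by apply/measurable_EFinP; exact: measurable_indic.
  under eq_integral do rewrite /= ger0_norm//.
  rewrite integral_indic ?setIT//.
  exact: leb2_square.
apply: (integrable_dominated _ _ _ iM) => //.
  by apply: (measurableT_comp mf); exact: measurable_fun_pair.
move=> [a b] _ /=; rewrite indicE.
have [/set_mem xA|/negP xA] := boolP ((a, b) \in Q).
  rewrite mulr1; have [cA|cA] := pselect (cube A ((a, b), c)); first exact: hM.
  by rewrite fA ?normr0.
by rewrite mulr0 fA ?normr0// => -[abA _]; apply: xA; rewrite mem_set.
Qed.

(** Fubini's theorem with the i-th coordinate innermost, where the integral over each line is a
    difference of two vanishing boundary values. *)
Lemma integral_derivative f g i A :
  (forall x, is_derive x (basis3 R i) f (g x)) -> continuous g ->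
  vanish_off A f -> (\int[mu]_x (g x)%:E = 0)%E.
Proof.
move=> df cg fA.
have gA : vanish_off A g.
  move=> x xA; apply: vanish_off_derivative xA (df x) => //; exact: closed_cube.
have ig := integrable_cont_vanish cg gA.
have hl x := integral_line_derivative x df cg fA.
have i1 : (@leb2 R \x leb)%E.-integrable setT (EFin \o g) by exact: ig.
case: i df hl => [[|[|[|//]]] hi] df hl.
- apply: (etrans (esym (integral21_prod_meas1 i1))); apply: integral0_eq => c _.
  have islice : (leb \x leb)%E.-integrable setT (fun p => (g (p, c))%:E).
    exact: integrable_slice gA.
  apply: (etrans (esym (integral21_prod_meas1 islice))); apply: integral0_eq => b _.
  exact: (hl ((0, b), c)).
- apply: (etrans (esym (integral21_prod_meas1 i1))); apply: integral0_eq => c _.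
  have islice : (leb \x leb)%E.-integrable setT (fun p => (g (p, c))%:E).
    exact: integrable_slice gA.
  apply: (etrans (esym (integral12_prod_meas1 islice))); apply: integral0_eq => a _.
  exact: (hl ((a, 0), c)).
- apply: (etrans (esym (integral12_prod_meas1 i1))); apply: integral0_eq => p _.
  rewrite /fubini_F /=.
  exact: (hl (p, 0)).
Qed.

End Parts.

(** * Convolutions *)

Section Convolution.
Variable R : realType.
Notation mu := (@mu3 R).
Implicit Types (f g F K k psi : R3 R -> R) (x y : R3 R).

Definition convol K F x : R := \int[mu]_y (K (x - y) * F y).

Lemma measurable_sub3 :
  measurable_fun setT (fun z : (R3 R * R3 R)%type => z.1 - z.2 : R3 R).
Proof.
have h (p q : R3 R -> R) : measurable_fun setT p -> measurable_fun setT q ->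
    measurable_fun setT (fun z : (R3 R * R3 R)%type => p z.1 - q z.2).
  move=> mp mq; apply: measurable_funB.
    exact: (measurableT_comp mp measurable_fst).
  exact: (measurableT_comp mq measurable_snd).
have m0 := measurable_proj3 (R := R) (@Ordinal 3 0 isT).
have m1 := measurable_proj3 (R := R) (@Ordinal 3 1 isT).
have m2 := measurable_proj3 (R := R) (@Ordinal 3 2 isT).
apply: measurable_fun_pair; last exact: (h _ _ m2 m2).
by apply: measurable_fun_pair; [exact: (h _ _ m0 m0)|exact: (h _ _ m1 m1)].
Qed.

Lemma measurable_translate K x : measurable_fun setT K ->
  measurable_fun setT (fun y => K (x - y)).
Proof.
move=> mK; apply: (measurableT_comp mK).
have h : measurable_fun setT (fun y => (x, y)) by exact: measurable_fun_pair.
exact: (measurableT_comp measurable_sub3 h).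
Qed.

Lemma integrable_kernel K F x (C : R) : measurable_fun setT K ->
  mu.-integrable setT (EFin \o F) -> (forall y, F y != 0 -> `|K (x - y)| <= C) ->
  mu.-integrable setT (EFin \o (fun y => K (x - y) * F y)).
Proof.
move=> mK iF hC.
have mF : measurable_fun setT F by apply/measurable_EFinP; case/integrableP: iF.
apply: (@integrable_dominated _ _ _ _ _ _ (fun y => C * `|F y|)) => //.
- by apply: measurable_funM => //; exact: measurable_translate.
- move=> y _ /=; rewrite normrM; have [->|Fy] := eqVneq (F y) 0.
    by rewrite normr0 !mulr0.
  by rewrite ler_wpM2r// hC.
- by apply: integrableRZ => //; exact: integrable_norm.
Qed.

Lemma conv_bound K F x (C : R) : 0 <= C -> measurable_fun setT K ->
  mu.-integrable setT (EFin \o F) -> (forall y, F y != 0 -> `|K (x - y)| <= C) ->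
  `|convol K F x| <= C * \int[mu]_y `|F y|.
Proof.
move=> C0 mK iF hC; have iK := integrable_kernel mK iF hC.
apply: le_trans (le_normr_Rintegral _ iK) _ => //.
rewrite -RintegralZl//; last exact: integrable_norm.
apply: le_Rintegral => //; first exact: integrable_norm.
  by apply: integrableRZ => //; exact: integrable_norm.
move=> y _ /=; rewrite normrM; have [->|Fy] := eqVneq (F y) 0.
  by rewrite normr0 !mulr0.
by rewrite ler_wpM2r// hC.
Qed.

(** Restricting the bound on [K] to differences of points of the two supports admits kernels that
    are bounded on bounded sets only; Tonelli's theorem then gives integrability on the product. *)
Lemma integrable_tensor K F psi (C : R) : 0 <= C -> measurable_fun setT K ->
  mu.-integrable setT (EFin \o F) -> mu.-integrable setT (EFin \o psi) ->
  (forall x y, psi x != 0 -> F y != 0 -> `|K (x - y)| <= C) ->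
  (@leb3 R \x @leb3 R)%E.-integrable setT
    (fun z => (K (z.1 - z.2) * F z.2 * psi z.1)%:E).
Proof.
move=> C0 mK iF ipsi hC.
have mF : measurable_fun setT F by apply/measurable_EFinP; case/integrableP: iF.
have mpsi : measurable_fun setT psi.
  by apply/measurable_EFinP; case/integrableP: ipsi.
have mH : measurable_fun setT
    (fun z : (R3 R * R3 R)%type => K (z.1 - z.2) * F z.2 * psi z.1).
  apply: measurable_funM; last exact: (measurableT_comp mpsi measurable_fst).
  apply: measurable_funM; last exact: (measurableT_comp mF measurable_snd).
  exact: (measurableT_comp mK measurable_sub3).
apply/integrable12ltyP; first exact/measurable_EFinP.
have iF' := integrable_norm iF.
have ipsi' := integrable_norm ipsi.
pose cF := C * \int[mu]_y `|F y|.
apply: (@le_lt_trans _ _ (\int[@leb3 R]_x (cF * `|psi x|)%:E)%E).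
  apply: ge0_le_integral => //.
  - by move=> x _; exact: integral_ge0.
  - have mH' : measurable_fun setT (fun z : (R3 R * R3 R)%type =>
        `|(K (z.1 - z.2) * F z.2 * psi z.1)%:E|%E).
      by apply: measurableT_comp => //; exact/measurable_EFinP.
    have h := @measurable_fun_fubini_tonelli_F _ _ _ _ R (@leb3 R) _ mH' (fun=> abse_ge0 _).
    exact h.
  - apply/measurable_EFinP; apply: measurable_funM => //.
    exact: measurableT_comp.
  move=> x _ /=.
  apply: (@le_trans _ _ (\int[@leb3 R]_y ((C * `|psi x|)%:E * (`|F y|)%:E))%E).
    apply: ge0_le_integral => //.
    - apply/measurable_EFinP; apply: measurableT_comp => //.
      apply: measurable_funM => //; apply: measurable_funM => //.
      exact: measurable_translate.
    - apply/measurable_EFinP; apply: measurable_funM => //.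
      exact: measurableT_comp.
    - move=> y _ /=; rewrite -EFinM lee_fin !normrM mulrAC.
      have [->|Fy] := eqVneq (F y) 0; first by rewrite normr0 !mulr0.
      have [->|px] := eqVneq (psi x) 0; first by rewrite normr0 !mulr0 mul0r.
      by rewrite ler_wpM2r// ler_wpM2r// hC.
  rewrite (@integralZl _ _ _ (@leb3 R) _ measurableT _ iF').
  have -> : (\int[@leb3 R]_y `|F y|%:E = (\int[mu]_y `|F y|)%:E)%E.
    by rewrite /Rintegral fineK//; exact: (integrable_fin_num measurableT iF').
  by rewrite -EFinM lee_fin /cF mulrAC.
have iZ := integrableRZ cF measurableT ipsi'.
exact: (integrable_lty measurableT iZ).
Qed.

(** Besides the exchange of the integrals, the integrability of both outer integrands is recorded,
    since measurability of convolutions and the passage of signs through integrals are drawn from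
    it. *)
Lemma conv_swap K F psi (C : R) : 0 <= C -> measurable_fun setT K ->
  mu.-integrable setT (EFin \o F) -> mu.-integrable setT (EFin \o psi) ->
  (forall x y, psi x != 0 -> F y != 0 -> `|K (x - y)| <= C) ->
  [/\ mu.-integrable setT (EFin \o (fun x => convol K F x * psi x)),
   mu.-integrable setT (EFin \o (fun y => F y * \int[mu]_x (K (x - y) * psi x))) &
  \int[mu]_x (convol K F x * psi x) =
  \int[mu]_y (F y * \int[mu]_x (K (x - y) * psi x))].
Proof.
move=> C0 mK iF ipsi hC.
have iH := integrable_tensor C0 mK iF ipsi hC.
have mF : measurable_fun setT F by apply/measurable_EFinP; case/integrableP: iF.
have mpsi : measurable_fun setT psi.
  by apply/measurable_EFinP; case/integrableP: ipsi.
have e1 x : (\int[@leb3 R]_y (K (x - y) * F y * psi x)%:E = (convol K F x * psi x)%:E)%E.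
  have [->|px] := eqVneq (psi x) 0.
    by rewrite mulr0; apply: integral0_eq => y _; rewrite mulr0.
  have iK : mu.-integrable setT (EFin \o (fun y => K (x - y) * F y)).
    by apply: (@integrable_kernel _ _ _ C) => // y Fy; exact: hC.
  under eq_integral do rewrite EFinM.
  rewrite (@integralZr _ _ _ (@leb3 R) _ measurableT _ iK) EFinM; congr (_ * _)%E.
  by rewrite /convol /Rintegral fineK//; exact: (integrable_fin_num measurableT iK).
have iKx y : F y != 0 -> mu.-integrable setT (EFin \o (fun x => K (x - y) * psi x)).
  move=> Fy; apply: (@integrable_dominated _ _ _ _ _ _ (fun x => C * `|psi x|)) => //.
  - apply: measurable_funM => //.
    have h : measurable_fun setT (fun x => (x, y)) by exact: measurable_fun_pair.
    exact: (measurableT_comp mK (measurableT_comp measurable_sub3 h)).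
  - move=> x _ /=; rewrite normrM; have [->|px] := eqVneq (psi x) 0.
      by rewrite normr0 !mulr0.
    by rewrite ler_wpM2r// hC.
  - by apply: integrableRZ => //; exact: integrable_norm.
have e2 y : (\int[@leb3 R]_x (K (x - y) * F y * psi x)%:E =
             (F y * \int[mu]_x (K (x - y) * psi x))%:E)%E.
  have [->|Fy] := eqVneq (F y) 0.
    by rewrite mul0r; apply: integral0_eq => x _; rewrite mulr0 mul0r.
  under eq_integral do rewrite mulrAC mulrC EFinM.
  rewrite (@integralZl _ _ _ (@leb3 R) _ measurableT _ (iKx _ Fy)) EFinM.
  congr (_ * _)%E; rewrite /Rintegral fineK//.
  exact: (integrable_fin_num measurableT (iKx _ Fy)).
split.
  have := integrable_fubini_F iH; apply: eq_integrable => // x _.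
  by rewrite /fubini_F /= e1.
  apply: (@integrable_dominated _ _ _ _ _ _
    (fun y => (C * \int[mu]_x `|psi x|) * `|F y|)) => //.
  - apply/measurable_EFinP; have := measurable_fubini_G iH.
    by apply: eq_measurable_fun => y _; rewrite /fubini_G /= e2.
  - move=> y _ /=; have [->|Fy] := eqVneq (F y) 0.
      by rewrite mul0r normr0 mulr0.
    rewrite normrM mulrC ler_wpM2r//.
    apply: le_trans (le_normr_Rintegral _ (iKx _ Fy)) _ => //.
    rewrite -RintegralZl//; last exact: integrable_norm.
    apply: le_Rintegral => //; first exact: (integrable_norm (iKx _ Fy)).
      by apply: integrableRZ => //; exact: integrable_norm.
    move=> x _ /=; rewrite normrM; have [->|px] := eqVneq (psi x) 0.
      by rewrite normr0 !mulr0.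
    by rewrite ler_wpM2r// hC.
  - by apply: integrableRZ => //; exact: integrable_norm.
rewrite /Rintegral; congr fine.
have := Fubini iH; rewrite /=.
by under eq_integral do rewrite e1; under [in RHS]eq_integral do rewrite e2.
Qed.

(** Fubini's theorem, applied with the indicator of [X] as test function, contains the measurability
    of the partial integral. *)
Lemma measurable_conv K F X (C : R) : 0 <= C -> measurable_fun setT K ->
  mu.-integrable setT (EFin \o F) -> measurable X -> (mu X < +oo)%E ->
  (forall x y, X x -> F y != 0 -> `|K (x - y)| <= C) ->
  measurable_fun X (convol K F).
Proof.
move=> C0 mK iF mX muX hC.
have iX : mu.-integrable setT (EFin \o (\1_X : R3 R -> R)).
  apply/integrableP; split; first by apply/measurable_EFinP; exact: measurable_indic.
  under eq_integral do rewrite /= ger0_norm//.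
  by rewrite integral_indic// setIT.
have [|/integrableP[/measurable_EFinP m _] _ _] := conv_swap C0 mK iF iX.
  move=> x y; rewrite indicE; case: (boolP (x \in X)) => [/set_mem Xx _|_ /eqP//].
  exact: hC.
have : measurable_fun X (fun x => convol K F x * \1_X x).
  by apply: measurable_funTS.
apply: eq_measurable_fun => x xX.
by rewrite indicE xX mulr1.
Qed.

Lemma is_derive_translate K (k : R) x y v :
  is_derive (x - y) v K k -> is_derive x v (fun z => K (z - y)) k.
Proof.
move=> [dK <-].
have e : (fun h => h^-1 *: ((fun z => K (z - y)) (h *: v + x) -
            (fun z => K (z - y)) x)) =
   (fun h => h^-1 *: (K (h *: v + (x - y)) - K (x - y))).
  by apply/funext => h /=; rewrite addrA.
by split; [rewrite /derivable e|rewrite /derive e].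
Qed.

Lemma cubeB A B x y : cube A x -> cube B y -> cube (A + B) (x - y).
Proof.
move=> /cubeP hx /cubeP hy; apply/cubeP => i.
have -> : proj3 i (x - y) = proj3 i x - proj3 i y.
  by case: (proj3_cases R i) => ->.
by rewrite (le_trans (ler_normB _ _))// lerD.
Qed.

(** The derivative never falls on [F]: the integrals are exchanged, the integration by parts takes
    place in [x] for fixed [y], between the translated kernel and [psi], and the integrals are
    exchanged back. *)
Lemma conv_weak_derivative K Ki psi psii F i (A B : R) :
  continuous K -> continuous Ki ->
  (forall x, is_derive x (basis3 R i) K (Ki x)) ->
  continuous psi -> continuous psii ->
  (forall x, is_derive x (basis3 R i) psi (psii x)) -> vanish_off A psi ->
  mu.-integrable setT (EFin \o F) -> vanish_off B F ->
  \int[mu]_x (convol K F x * psii x) = - \int[mu]_x (convol Ki F x * psi x).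
Proof.
move=> cK cKi dK cp cpi dp pA iF FB.
have piA : vanish_off A psii.
  by move=> x xA; apply: vanish_off_derivative xA (dp x) => //; exact: closed_cube.
have supp f (E : R) : vanish_off E f -> forall x, f x != 0 -> cube E x.
  by move=> fE x; apply: contraNP => /fE ->.
have [C [C0 hC]] := bounded_on_cube (A + B) cK.
have [Ci [Ci0 hCi]] := bounded_on_cube (A + B) cKi.
have h1 x y : psii x != 0 -> F y != 0 -> `|K (x - y)| <= C.
  by move=> /(supp _ _ piA) ? /(supp _ _ FB) ?; apply: hC; exact: cubeB.
have h2 x y : psi x != 0 -> F y != 0 -> `|Ki (x - y)| <= Ci.
  by move=> /(supp _ _ pA) ? /(supp _ _ FB) ?; apply: hCi; exact: cubeB.
have ip := integrable_cont_vanish cp pA.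
have ipi := integrable_cont_vanish cpi piA.
have [_ _ ->] := conv_swap C0 (continuous_measurable cK) iF ipi h1.
have [_ i2 ->] := conv_swap Ci0 (continuous_measurable cKi) iF ip h2.
have ct (f : R3 R -> R) y : continuous f -> continuous (fun x => f (x - y)).
  move=> cf x; apply: (@continuous_comp _ _ _ (fun x => x - y)); last exact: cf.
  by apply: cvgB; [exact: cvg_id|exact: cvg_cst].
have e y : \int[mu]_x (K (x - y) * psii x) = - \int[mu]_x (Ki (x - y) * psi x).
  have c1 : continuous (fun x => K (x - y) * psii x).
    by move=> x; apply: cvgM; [exact: ct|exact: cpi].
  have c2 : continuous (fun x => Ki (x - y) * psi x).
    by move=> x; apply: cvgM; [exact: ct|exact: cp].
  have i1' : mu.-integrable setT (EFin \o (fun x => K (x - y) * psii x)).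
    by apply: (integrable_cont_vanish (A := A)) => // x /piA ->; rewrite mulr0.
  have i2' : mu.-integrable setT (EFin \o (fun x => Ki (x - y) * psi x)).
    by apply: (integrable_cont_vanish (A := A)) => // x /pA ->; rewrite mulr0.
  apply/eqP; rewrite -addr_eq0 -RintegralD//; apply/eqP.
  rewrite /Rintegral; have -> // : (\int[mu]_x (K (x - y) * psii x + Ki (x - y) * psi x)%:E = 0)%E.
  apply: (@integral_derivative _ (fun x => K (x - y) * psi x) _ i A).
  - move=> x; have d1 := is_derive_translate (dK (x - y)).
    have := is_deriveM d1 (dp x); rewrite /GRing.scale /= => h.
    by apply: is_derive_eq h _; rewrite [psi x * _]mulrC.
  - by move=> x; apply: cvgD; [exact: c1|exact: c2].
  - by move=> x /pA ->; rewrite mulr0.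
have -> : (fun y => F y * \int[mu]_x (K (x - y) * psii x)) =
          (fun y => -1 * (F y * \int[mu]_x (Ki (x - y) * psi x))).
  by apply/funext => y; rewrite e mulN1r mulrN.
by rewrite RintegralZl ?mulN1r.
Qed.

End Convolution.

(** * Schur's test and the Poisson kernel *)

Section Schur.
Variable R : realType.
Notation mu := (@mu3 R).
Notation leb := (@lebesgue_measure R).
Implicit Types (f g F K k : R3 R -> R) (x y : R3 R).

(** Cauchy-Schwarz for the factorisation [k |F| = sqrt k (sqrt k |F|)]; the first factor has squared
    norm at most [A]. *)
Lemma schur_pointwise K k F x (A : R) : 0 < A ->
  measurable_fun setT K -> measurable_fun setT k -> (forall z, 0 <= k z) ->
  measurable_fun setT F ->
  (forall y, F y != 0 -> `|K (x - y)| <= k (x - y)) ->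
  (\int[mu]_y (k (x - y))%:E <= A%:E)%E ->
  ((convol K F x ^+ 2)%:E <= A%:E * \int[mu]_y (k (x - y) * F y ^+ 2)%:E)%E.
Proof.
move=> A0 mK mk k0 mF Kk kA.
have mkx := measurable_translate x mk.
have mKx := measurable_translate x mK.
have J0 : (0 <= \int[mu]_y (k (x - y) * F y ^+ 2)%:E)%E.
  by apply: integral_ge0 => y _; rewrite lee_fin mulr_ge0 ?sqr_ge0.
have [Joo|] := eqVneq (\int[mu]_y (k (x - y) * F y ^+ 2)%:E)%E +oo%E.
  by rewrite Joo gt0_muley ?leey// lte_fin.
rewrite -ltey => Jfin.
pose p y := Num.sqrt (k (x - y)); pose q y := p y * `|F y|.
have mp : measurable_fun setT p.
  apply: (@measurableT_comp _ _ _ _ _ _ (@Num.sqrt R)) => //.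
  by apply: continuous_measurable_fun; exact: sqrt_continuous.
have mq : measurable_fun setT q by apply: measurable_funM => //; exact: measurableT_comp.
have p2 y : p y ^+ 2 = k (x - y) by rewrite sqr_sqrtr.
have q2 y : q y ^+ 2 = k (x - y) * F y ^+ 2.
  by rewrite exprMn p2 real_normK ?num_real.
have [lp pA] : l2 mu setT p /\ inner mu setT p p <= A.
  by apply: l2_of_le => //; under eq_integral do rewrite p2.
have lq : l2 mu setT q.
  split => //; apply/integrableP; split.
    by apply/measurable_EFinP; exact: measurable_funX.
  under eq_integral do rewrite /= ger0_norm ?sqr_ge0// q2.
  exact: Jfin.
have -> : (\int[mu]_y (k (x - y) * F y ^+ 2)%:E = (inner mu setT q q)%:E)%E.
  by rewrite -inner_ereal//; apply: eq_integral => y _; rewrite q2.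
rewrite -EFinM lee_fin.
have ipq := l2M measurableT lp lq.
have le1 : `|convol K F x| <= inner mu setT p q.
  have pqE y : p y * q y = k (x - y) * `|F y| by rewrite /q mulrA -expr2 p2.
  have iK : mu.-integrable setT (EFin \o (fun y => K (x - y) * F y)).
    apply: (integrable_dominated _ _ _ ipq) => //; first exact: measurable_funM.
    move=> y _; rewrite pqE normrM; have [->|Fy] := eqVneq (F y) 0.
      by rewrite normr0 !mulr0.
    by rewrite ler_wpM2r// Kk.
  apply: le_trans (le_normr_Rintegral _ iK) _ => //.
  apply: le_Rintegral => //; first exact: (integrable_norm iK).
  move=> y _; rewrite pqE normrM; have [->|Fy] := eqVneq (F y) 0.
    by rewrite normr0 !mulr0.
  by rewrite ler_wpM2r// Kk.
rewrite -real_normK ?num_real//.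
apply: (@le_trans _ _ (inner mu setT p q ^+ 2)).
  by rewrite ler_sqr ?nnegrE// (le_trans _ le1).
apply: le_trans (inner_cauchy_schwarz measurableT lp lq) _.
by rewrite ler_wpM2r// inner_ge0.
Qed.

(** Integrating the pointwise bound over [x] and exchanging the integrals leaves the mass of [k] in
    the other variable, which gives the second factor [A]. *)
Lemma schur K k F X (A : R) : 0 < A ->
  measurable_fun setT K -> measurable_fun setT k -> (forall z, 0 <= k z) ->
  l2 mu setT F -> measurable X -> measurable_fun X (convol K F) ->
  (forall x y, X x -> F y != 0 -> `|K (x - y)| <= k (x - y)) ->
  (forall x, \int[mu]_y (k (x - y))%:E <= A%:E)%E ->
  (forall y, \int[mu]_x (k (x - y))%:E <= A%:E)%E ->
  (\int[mu]_(x in X) (convol K F x ^+ 2)%:E <= (A ^+ 2 * inner mu setT F F)%:E)%E.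
Proof.
move=> A0 mK mk k0 lF mX mc Kk k1 k2; have [mF _] := lF.
pose H (z : (R3 R * R3 R)%type) := (k (z.1 - z.2) * F z.2 ^+ 2)%:E.
have mH : measurable_fun setT H.
  apply/measurable_EFinP; apply: measurable_funM.
    exact: (measurableT_comp mk (@measurable_sub3 R)).
  by apply: measurable_funX; exact: (measurableT_comp mF measurable_snd).
have H0 z : (0 <= H z)%E by rewrite lee_fin mulr_ge0 ?sqr_ge0.
have mJ := @measurable_fun_fubini_tonelli_F _ _ _ _ R (@leb3 R) _ mH H0.
have mJ' : measurable_fun setT (fun x => \int[mu]_y (k (x - y) * F y ^+ 2)%:E)%E.
  exact mJ.
have J0 x : (0 <= \int[mu]_y (k (x - y) * F y ^+ 2)%:E)%E.
  by apply: integral_ge0 => y _; rewrite lee_fin mulr_ge0 ?sqr_ge0.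
apply: (@le_trans _ _ (\int[mu]_(x in X)
    (A%:E * \int[mu]_y (k (x - y) * F y ^+ 2)%:E))%E).
  apply: ge0_le_integral => //.
  - by move=> x _; rewrite lee_fin sqr_ge0.
  - by apply/measurable_EFinP; exact: measurable_funX.
  - by apply: measurable_funeM; exact: measurable_funTS.
  - by move=> x Xx; apply: schur_pointwise => // y Fy; exact: Kk.
rewrite ge0_integralZl//; [|exact: measurable_funTS|by rewrite lee_fin ltW].
apply: (@le_trans _ _ (A%:E * \int[mu]_x \int[mu]_y (k (x - y) * F y ^+ 2)%:E)%E).
  rewrite lee_wpmul2l ?lee_fin ?(ltW A0)//.
  by apply: ge0_subset_integral => //; exact: subsetT.
rewrite expr2 -mulrA EFinM lee_wpmul2l ?lee_fin ?(ltW A0)//.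
have -> : (\int[mu]_x \int[mu]_y (k (x - y) * F y ^+ 2)%:E =
           \int[mu]_y \int[mu]_x (k (x - y) * F y ^+ 2)%:E)%E.
  have e := @fubini_tonelli _ _ _ _ R (@leb3 R) (@leb3 R) H mH H0.
  exact e.
rewrite EFinM -inner_ereal// -ge0_integralZl//; last 3 first.
- by apply/measurable_EFinP; exact: measurable_funX.
- by move=> y _; rewrite lee_fin sqr_ge0.
- by rewrite lee_fin ltW.
have mk2 y : measurable_fun setT (fun x => k (x - y)).
  have h : measurable_fun setT (fun x => (x, y)) by exact: measurable_fun_pair.
  exact: (measurableT_comp mk (measurableT_comp (@measurable_sub3 R) h)).
apply: ge0_le_integral.
- exact: measurableT.
- by move=> y _; apply: integral_ge0 => x _; rewrite lee_fin mulr_ge0 ?sqr_ge0.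
- have m := @measurable_fun_fubini_tonelli_G _ _ _ _ R (@leb3 R) _ mH H0.
  exact m.
- by apply: measurable_funeM; apply/measurable_EFinP; exact: measurable_funX.
move=> y _; under eq_integral do rewrite EFinM.
rewrite ge0_integralZr//; last 3 first.
- exact/measurable_EFinP.
- by move=> x _; rewrite lee_fin.
- by rewrite lee_fin sqr_ge0.
by rewrite lee_wpmul2r ?lee_fin ?sqr_ge0.
Qed.

(** Each factor is the Poisson kernel of the half-plane, up to the constant [1/pi]. Its mass does
    not depend on [e], and the product form makes the integral over R3 a product of three line
    integrals. *)
Definition poisson (e : R) x : R :=
  e / (x.1.1 ^+ 2 + e ^+ 2) * (e / (x.1.2 ^+ 2 + e ^+ 2)) * (e / (x.2 ^+ 2 + e ^+ 2)).

Lemma integral_cauchy_kernel (e a : R) : 0 < e ->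
  (\int[leb]_t (e / ((a - t) ^+ 2 + e ^+ 2))%:E <= pi%:E)%E.
Proof.
move=> e0; pose f t := e / ((a - t) ^+ 2 + e ^+ 2).
have den0 t : 0 < (a - t) ^+ 2 + e ^+ 2 by rewrite ltr_wpDl ?sqr_ge0 ?exprn_gt0.
have f0 t : 0 <= f t by rewrite divr_ge0 ?ltW.
have cf : continuous f.
  move=> t; apply: cvgM; first exact: cvg_cst.
  apply: cvgV; first by rewrite gt_eqF.
  apply: cvgD; last exact: cvg_cst.
  have ct : (fun s => a - s) @ t --> a - t by apply: cvgB; [exact: cvg_cst|exact: cvg_id].
  by apply: cvgM; exact: ct.
have mf : measurable_fun setT f by exact: continuous_measurable_fun.
(* An antiderivative that increases by at most [pi], for all [a] and [e]. *)
pose G t := atan ((t - a) / e).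
have dG t : is_derive t (1 : R) G (f t).
  have d1 : is_derive t (1 : R) (fun s => (s - a) / e) ((1 - 0) * e^-1 + (t - a) * 0).
    exact: (derM (derB (der_id t) (derC a t (1 : R))) (derC e^-1 t (1 : R))).
  have d2 := @der1_comp R atan (fun s => (s - a) / e) t _ _ (is_derive1_atan _) d1.
  apply: der_eq d2 _.
  have := den0 t; rewrite /f => /lt0r_neq0 h.
  have e1 : e != 0 by rewrite gt_eqF.
  by rewrite subr0 mulr0 addr0 mul1r; field; rewrite h e1.
have bnd n : (\int[leb]_(t in `[(- n%:R)%R, n%:R]) (f t)%:E <= pi%:E)%E.
  have [->|n0] := eqVneq n 0%N.
    by rewrite oppr0 set_itv1 integral_set1 lee_fin pi_ge0.
  have cG : continuous G.
    by move=> t; apply/differentiable_continuous/derivable1_diffP; case: (dG t).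
  rewrite (@continuous_FTC2 _ f G).
  - rewrite -EFinB lee_fin /G lerBlDr.
    have := atan_ltpi2 ((n%:R - a) / e); have := atan_gtNpi2 ((- n%:R - a) / e); lra.
  - have h : (0 : R) < n%:R by rewrite ltr0n lt0n.
    by rewrite (lt_trans _ h)// oppr_lt0.
  - exact: continuous_subspaceT.
  - split; [by move=> t _; case: (dG t)|exact/cvg_at_right_filter/cG|
            exact/cvg_at_left_filter/cG].
  - by move=> t _; rewrite derive1E; case: (dG t).
pose I n : set (measurableTypeR R) := `[- n%:R, n%:R]%classic.
have -> : [set: measurableTypeR R] = \bigcup_n I n.
  by rewrite -(bigcup_itvT true false).
have mI n : measurable (I n) by exact: measurable_itv.
have ndI : nondecreasing_seq I.
  apply/nondecreasing_seqP => n; apply/subsetPset => t.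
  rewrite /I /= !in_itv/= => /andP[h1 h2].
  have : (n%:R <= n.+1%:R :> R) by rewrite ler_nat.
  by move=> h3; apply/andP; split; lra.
have mfI n : measurable_fun (I n) (EFin \o f).
  by apply/measurable_EFinP; exact: measurable_funTS.
have f0I n t : I n t -> (0 <= (EFin \o f) t)%E by rewrite lee_fin.
have hc := ge0_nondecreasing_set_cvg_integral (mu := leb) ndI mI mfI f0I.
by apply: (cvge_le _ hc); apply: nearW => n; exact: bnd.
Qed.

Lemma continuous_poisson e : 0 < e -> continuous (poisson e).
Proof.
move=> e0.
have h i : continuous (fun x : R3 R => e / (proj3 i x ^+ 2 + e ^+ 2)).
  move=> x; apply: cvgM; first exact: cvg_cst.
  apply: cvgV; first by rewrite gt_eqF// ltr_wpDl ?sqr_ge0 ?exprn_gt0.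
  apply: cvgD; last exact: cvg_cst.
  by apply: cvgM; exact: continuous_proj3.
move=> x; apply: cvgM; last exact: (h (@Ordinal 3 2 isT)).
by apply: cvgM; [exact: (h (@Ordinal 3 0 isT))|exact: (h (@Ordinal 3 1 isT))].
Qed.

Lemma poisson_ge0 e x : 0 < e -> 0 <= poisson e x.
Proof.
move=> e0; have h (t : R) : 0 <= e / (t ^+ 2 + e ^+ 2).
  by rewrite divr_ge0 ?addr_ge0 ?sqr_ge0 ?ltW.
exact: (mulr_ge0 (mulr_ge0 (h _) (h _)) (h _)).
Qed.

Lemma poissonB e x y : poisson e (x - y) = poisson e (y - x).
Proof.
have h (s t : R) : (s - t) ^+ 2 = (t - s) ^+ 2 by rewrite -sqrrN opprB.
by rewrite /poisson /= (h x.1.1) (h x.1.2) (h x.2).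
Qed.

Lemma integral_poisson e x : 0 < e ->
  (\int[mu]_y (poisson e (x - y))%:E <= (pi ^+ 3)%:E)%E.
Proof.
move=> e0; have mp := continuous_measurable (continuous_poisson e0).
pose c (a t : R) := e / ((a - t) ^+ 2 + e ^+ 2).
have c0 a t : 0 <= c a t by rewrite divr_ge0 ?addr_ge0 ?sqr_ge0 ?ltW.
have mc a : measurable_fun setT (EFin \o c a).
  apply/measurable_EFinP; apply: measurable_funM => //.
  apply: continuous_measurable_fun => t; apply: cvgV.
    by rewrite gt_eqF// ltr_wpDl ?sqr_ge0 ?exprn_gt0.
  apply: cvgD; last exact: cvg_cst.
  have ct : (fun s => a - s) @ t --> a - t by apply: cvgB; [exact: cvg_cst|exact: cvg_id].
  by apply: cvgM; exact: ct.
have int_c a : (\int[leb]_t (c a t)%:E <= pi%:E)%E by exact: integral_cauchy_kernel.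
have int0 a : (0 <= \int[leb]_t (c a t)%:E)%E.
  by apply: integral_ge0 => t _; rewrite lee_fin.
have mP := measurable_translate x mp.
have P0 y : (0 <= (poisson e (x - y))%:E)%E by rewrite lee_fin poisson_ge0.
have e1 := @fubini_tonelli1 _ _ _ _ R (@leb2 R) leb
  (fun y : R3 R => (poisson e (x - y))%:E) ((measurable_EFinP _ _).2 mP) P0.
apply: (le_trans (y := \int[@leb2 R]_p \int[leb]_t
    (poisson e (x - (p, t) : R3 R))%:E)%E).
  by rewrite le_eqVlt; apply/orP; left; apply/eqP; exact: e1.
have e2 p : (\int[leb]_t (poisson e (x - (p, t) : R3 R))%:E =
   (c x.1.1 p.1 * c x.1.2 p.2)%:E * \int[leb]_t (c x.2 t)%:E)%E.
  rewrite -ge0_integralZl//; first exact: mc.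
  - by move=> t _; rewrite lee_fin.
  - by rewrite lee_fin mulr_ge0.
under eq_integral do rewrite e2.
have mcc : measurable_fun setT (fun p : (measurableTypeR R * measurableTypeR R)%type =>
    (c x.1.1 p.1 * c x.1.2 p.2)%:E).
  apply/measurable_EFinP; apply: measurable_funM.
    have m1 := (measurable_EFinP _ _).1 (mc x.1.1).
    exact: (measurableT_comp m1 measurable_fst).
  have m2 := (measurable_EFinP _ _).1 (mc x.1.2).
  exact: (measurableT_comp m2 measurable_snd).
rewrite ge0_integralZr//; last by move=> p _; rewrite lee_fin mulr_ge0.
have -> : (\int[@leb2 R]_p (c x.1.1 p.1 * c x.1.2 p.2)%:E =
  \int[leb]_s (c x.1.1 s)%:E * \int[leb]_t (c x.1.2 t)%:E)%E.
  have cc0 p : (0 <= (c x.1.1 p.1 * c x.1.2 p.2)%:E)%E by rewrite lee_fin mulr_ge0.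
  have e3 := @fubini_tonelli1 _ _ _ _ R leb leb _ mcc cc0.
  apply: (etrans e3); rewrite -ge0_integralZr//; last 2 first.
  - exact: mc.
  - by move=> s _; rewrite lee_fin.
  apply: eq_integral => s _; rewrite /fubini_F /= -ge0_integralZl//.
  - exact: mc.
  - by move=> t _; rewrite lee_fin.
  - by rewrite lee_fin.
have -> : (pi ^+ 3)%:E = (pi%:E * pi%:E * pi%:E : \bar R)%E.
  by rewrite -!EFinM; congr EFin; ring.
by apply: lee_pmul => //; [exact: mule_ge0|exact: lee_pmul].
Qed.

End Schur.

(** * Derivatives of radial functions *)

Section Hermite.
Variable R : realType.
Implicit Types (g h : nat -> R) (s t : R).

(** If each [g p], as a function of [t], has derivative [t g(p+1)], then this is the a-th derivative
    of [g p]. The recursion comes from differentiating the product [t g(p+1)] and is that of the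
    Hermite polynomials with the opposite sign. *)
Fixpoint hermite t a g : nat -> R :=
  match a with
  | 0 => g
  | a1.+1 => fun p => t * hermite t a1 g p.+1 +
      match a1 with 0 => 0 | a2.+1 => a1%:R * hermite t a2 g p.+1 end
  end.

Lemma hermiteSS t a g p : hermite t a.+2 g p =
  t * hermite t a.+1 g p.+1 + a.+1%:R * hermite t a g p.+1.
Proof. by []. Qed.

Lemma hermite_ind2 (P : nat -> Prop) : P 0%N -> P 1%N ->
  (forall a, P a -> P a.+1 -> P a.+2) -> forall a, P a.
Proof.
move=> P0 P1 PS a; suff : P a /\ P a.+1 by case.
by elim: a => // a [] ? ?; split => //; exact: PS.
Qed.

Lemma hermite_ext t a g h p : (forall q, (p <= q <= p + a)%N -> g q = h q) ->
  hermite t a g p = hermite t a h p.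
Proof.
elim/hermite_ind2: a p => [|| a IH1 IH2] p gh.
- by apply: gh; rewrite addn0 leqnn.
- by rewrite /= gh// leqnSn addn1 leqnn.
- rewrite !hermiteSS IH1 ?IH2// => q /andP[pq qp]; apply: gh.
    by rewrite (ltnW pq)/= -addSnnS.
  by rewrite (ltnW pq)/= (leq_trans qp)// addSn !addnS.
Qed.

Lemma hermite_shift t a g p : hermite t a (fun q => g q.+1) p = hermite t a g p.+1.
Proof.
by elim/hermite_ind2: a p => [|| a IH1 IH2] p //; rewrite !hermiteSS IH1 IH2.
Qed.

Lemma hermiteZ t a c g p : hermite t a (fun q => c * g q) p = c * hermite t a g p.
Proof.
elim/hermite_ind2: a p => [|| a IH1 IH2] p //.
  by rewrite /= !addr0 mulrCA.
rewrite !hermiteSS IH1 IH2; ring.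
Qed.

Variable V : normedModType R.

Lemma der_hermite_cst t (x v : V) a (g : nat -> V -> R) (dg : nat -> R) p :
  (forall q, (p <= q <= p + a)%N -> is_derive x v (g q) (dg q)) ->
  is_derive x v (fun y => hermite t a (g^~ y) p) (hermite t a dg p).
Proof.
elim/hermite_ind2: a p => [|| a IH1 IH2] p gh.
- by apply: gh; rewrite addn0 leqnn.
- have h1 := gh p.+1; rewrite leqnSn addn1 leqnn in h1.
  rewrite /= addr0; have -> : (fun y => t * g p.+1 y + 0) = (fun y => t * g p.+1 y).
    by apply/funext => y; rewrite addr0.
  exact: (derZ t (h1 isT)).
- have h1 : is_derive x v (fun y => hermite t a.+1 (g^~ y) p.+1) (hermite t a.+1 dg p.+1).
    apply: IH2 => q /andP[pq qp]; apply: gh.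
    by rewrite (ltnW pq)/= -addSnnS.
  have h2 : is_derive x v (fun y => hermite t a (g^~ y) p.+1) (hermite t a dg p.+1).
    apply: IH1 => q /andP[pq qp]; apply: gh.
    by rewrite (ltnW pq)/= (leq_trans qp)// addSn !addnS.
  exact: (derD (derZ t h1) (derZ a.+1%:R h2)).
Qed.

(** The derivative falls on the explicit factor [t] and on the chain; the two contributions add up
    to the recursion with the order raised by one. *)
Lemma der_hermite_var (t : V -> R) (x v : V) a (g : nat -> V -> R) p :
  is_derive x v t 1 ->
  (forall q, (p <= q <= p + a)%N -> is_derive x v (g q) (t x * g q.+1 x)) ->
  is_derive x v (fun y => hermite (t y) a (g^~ y) p) (hermite (t x) a.+1 (g^~ x) p).
Proof.
move=> dt; elim/hermite_ind2: a p => [|| a IH1 IH2] p gh.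
- have h1 := gh p; rewrite addn0 leqnn in h1.
  by rewrite /= addr0; exact: h1.
- have h1 := gh p.+1; rewrite leqnSn addn1 leqnn in h1.
  have -> : (fun y => hermite (t y) 1 (g^~ y) p) = (fun y => t y * g p.+1 y).
    by apply/funext => y; rewrite /= addr0.
  apply: der_eq (derM dt (h1 isT)) _.
  by rewrite /= addr0 addrC.
- have h1 : is_derive x v (fun y => hermite (t y) a.+1 (g^~ y) p.+1)
      (hermite (t x) a.+2 (g^~ x) p.+1).
    apply: IH2 => q /andP[pq qp]; apply: gh.
    by rewrite (ltnW pq)/= -addSnnS.
  have h2 : is_derive x v (fun y => hermite (t y) a (g^~ y) p.+1)
      (hermite (t x) a.+1 (g^~ x) p.+1).
    apply: IH1 => q /andP[pq qp]; apply: gh.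
    by rewrite (ltnW pq)/= (leq_trans qp)// addSn !addnS.
  apply: der_eq (derD (derM dt h1) (derZ a.+1%:R h2)) _.
  rewrite [RHS]hermiteSS -[a.+2%:R]natr1; ring.
Qed.

Lemma continuous_hermite (t : V -> R) a (g : nat -> V -> R) p : continuous t ->
  (forall q, (p <= q <= p + a)%N -> continuous (g q)) ->
  continuous (fun y => hermite (t y) a (g^~ y) p).
Proof.
move=> ct; elim/hermite_ind2: a p => [|| a IH1 IH2] p gh.
- by apply: gh; rewrite addn0 leqnn.
- have h1 := gh p.+1; rewrite leqnSn addn1 leqnn in h1.
  have -> : (fun y => hermite (t y) 1 (g^~ y) p) = (fun y => t y * g p.+1 y).
    by apply/funext => y; rewrite /= addr0.
  by move=> y; apply: cvgM; [exact: ct|exact: h1].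
- have h1 : continuous (fun y => hermite (t y) a.+1 (g^~ y) p.+1).
    apply: IH2 => q /andP[pq qp]; apply: gh.
    by rewrite (ltnW pq)/= -addSnnS.
  have h2 : continuous (fun y => hermite (t y) a (g^~ y) p.+1).
    apply: IH1 => q /andP[pq qp]; apply: gh.
    by rewrite (ltnW pq)/= (leq_trans qp)// addSn !addnS.
  move=> y; apply: cvgD; first by apply: cvgM; [exact: ct|exact: h1].
  by apply: cvgM; [exact: cvg_cst|exact: h2].
Qed.

(** The subtraction is truncated, so the weight is 1 up to [n = 4]. It records the singularity
    allowed in the chain of a radial function with bounded derivatives up to order four: [F q] may
    grow like [s^(4 - 2q)] once [2q > 4]. *)
Definition weight (s : R) (n : nat) : R := (s ^+ (n - 4)%N)^-1.

Lemma weightS s (S : R) n : 0 < s -> s <= S -> 1 <= S ->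
  s * weight s n.+1 <= S * weight s n.
Proof.
move=> s0 sS S1; rewrite /weight; have [n4|n4] := leqP 4 n.
  rewrite subSn// exprS invfM mulrA divff ?gt_eqF// mul1r.
  by rewrite ler_peMl// invr_ge0 exprn_ge0// ltW.
have -> : (n.+1 - 4 = 0)%N by apply/eqP; rewrite subn_eq0.
have -> : (n - 4 = 0)%N by apply/eqP; rewrite subn_eq0 ltnW.
by rewrite expr0 invr1 !mulr1.
Qed.

(** Passing from [g p] to [g (p+1)] raises the weight index by two, and an accompanying factor [t],
    of size [s], lowers it by one. A derivative thus costs one index; the terms without the factor
    [t] account for two derivatives at once. *)
Lemma hermite_bound (S : R) a : 1 <= S -> exists2 C, 0 <= C &
  forall s t g (M : R) e P p, 0 < s -> s <= S -> `|t| <= s -> 0 <= M ->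
  (forall q, (q <= P)%N -> `|g q| <= M * weight s (q.*2 + e)) ->
  (p + a <= P)%N -> `|hermite t a g p| <= C * M * weight s (p.*2 + e + a).
Proof.
move=> S1; have S0 : 0 <= S by rewrite (le_trans _ S1).
elim/hermite_ind2: a => [||a [C1 C10 h1] [C2 C20 h2]].
- exists 1 => // s t g M e P p s0 sS ts M0 gM pP.
  by rewrite mul1r addn0; apply: gM; rewrite -[p]addn0.
- exists S => // s t g M e P p s0 sS ts M0 gM pP.
  rewrite /= addr0 normrM.
  apply: (@le_trans _ _ (s * (M * weight s (p.+1.*2 + e)))).
    by apply: ler_pM => //; apply: gM; rewrite -addn1.
  rewrite mulrCA (mulrC S) -mulrA ler_wpM2l//.
  by rewrite doubleS addn1 !addSn weightS.
- exists (S * C2 + a.+1%:R * C1); first by rewrite addr_ge0 ?mulr_ge0.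
  move=> s t g M e P p s0 sS ts M0 gM pP.
  rewrite hermiteSS mulrDl mulrDl; apply: le_trans (ler_normD _ _) _.
  have q1 : (p.+1 + a <= P)%N by rewrite (leq_trans _ pP)// addSn !addnS.
  have q2 : (p.+1 + a.+1 <= P)%N by rewrite addSnnS.
  apply: lerD; rewrite normrM.
    apply: (@le_trans _ _ (s * (C2 * M * weight s (p.+1.*2 + e + a.+1)))).
      by apply: ler_pM => //; exact: (h2 _ _ _ _ _ P).
    have hw : s * weight s (p.+1.*2 + e + a.+1) <= S * weight s (p.*2 + e + a.+2).
      by rewrite doubleS !addSn !addnS weightS.
    have := ler_wpM2l (mulr_ge0 C20 M0) hw; lra.
  rewrite ger0_norm// -!mulrA ler_wpM2l//.
  apply: le_trans (h1 _ _ _ _ _ P _ s0 sS ts M0 gM q1) _.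
  by rewrite mulrA doubleS !addSn !addnS.
Qed.

End Hermite.

Section MultiIndex.
Implicit Types (i j : 'I_3) (al : nat * nat * nat).

Definition order3 al : nat := (al.1.1 + al.1.2 + al.2)%N.

Definition inc i al : nat * nat * nat :=
  if (i : nat) == 0%N then (al.1.1.+1, al.1.2, al.2)
  else if (i : nat) == 1%N then (al.1.1, al.1.2.+1, al.2)
  else (al.1.1, al.1.2, al.2.+1).

Lemma order3_inc i al : order3 (inc i al) = (order3 al).+1.
Proof. by rewrite /inc /order3; case: i => [[|[|[|//]]] hi] /=; rewrite ?addSn ?addnS. Qed.

Lemma incC i j al : inc i (inc j al) = inc j (inc i al).
Proof. by rewrite /inc; case: i => [[|[|[|//]]] ?]; case: j => [[|[|[|//]]] ?]. Qed.

Lemma order3S al n : order3 al = n.+1 -> exists i be, al = inc i be /\ order3 be = n.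
Proof.
move: al => [[[|a] [|b]] [|c]]; rewrite /order3 /= => // h.
all: try by exists (@Ordinal 3 2 isT), (0, 0, c)%N; split => //; move: h => [].
all: try by exists (@Ordinal 3 1 isT), (0, b, 0)%N; split => //; move: h => []; rewrite !addn0.
- by exists (@Ordinal 3 1 isT), (0, b, c.+1)%N; split => //; move: h => [].
- by exists (@Ordinal 3 0 isT), (a, 0, 0)%N; split => //; move: h => [].
- by exists (@Ordinal 3 0 isT), (a, 0, c.+1)%N; split => //; move: h => [].
- by exists (@Ordinal 3 0 isT), (a, b.+1, 0)%N; split => //; move: h => [].
- by exists (@Ordinal 3 0 isT), (a, b.+1, c.+1)%N; split => //; move: h => [].
Qed.

End MultiIndex.

Section Arithmetic.
Implicit Types a b c p q n N : nat.

Lemma lt_of_ranges a b c q1 q2 q3 N : (a + b + c < N)%N -> (q1 <= 0 + a)%N ->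
  (q2 <= q1 + b)%N -> (q3 <= q2 + c)%N -> (q3 < N)%N.
Proof. lia. Qed.

Lemma le_of_ranges a b c q1 q2 q3 N : (a + b + c <= N)%N -> (q1 <= 0 + a)%N ->
  (q2 <= q1 + b)%N -> (q3 <= q2 + c)%N -> (q3 <= N)%N.
Proof. lia. Qed.

Lemma le_range3 a b c q : (a + b + c <= 4)%N -> (q <= 4 - c)%N -> (q + c <= 4)%N.
Proof. lia. Qed.

Lemma le_range2 a b c q : (a + b + c <= 4)%N -> (q <= 4 - c - b)%N ->
  (q + b <= 4 - c)%N.
Proof. lia. Qed.

Lemma le_range1 a b c : (a + b + c <= 4)%N -> (0 + a <= 4 - c - b)%N.
Proof. lia. Qed.

Lemma ranges_sub a b c : (a + b + c <= 4)%N -> (0.*2 + (c + b) + a - 4 = 0)%N.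
Proof. lia. Qed.

End Arithmetic.

Section Radial.
Variable R : realType.
Implicit Types (F : nat -> R -> R) (e : R) (x : R3 R) (al : nat * nat * nat).

(* Since [d_i (F p (regnorm e x)) = x_i F (p+1) (regnorm e x)] for such a chain, all
   partial derivatives of a radial function are polynomials in the [x_i] and
   the [F q (regnorm e x)]. *)
Definition chain N F := forall (p : nat) (s : R), 0 < s ->
  ((p < N)%N -> is_derive s (1 : R) (F p) (s * F p.+1 s)) /\
  ((p <= N)%N -> {for s, continuous (F p)}).

Definition sqnorm x : R := x.1.1 ^+ 2 + x.1.2 ^+ 2 + x.2 ^+ 2.

Definition regnorm e x : R := Num.sqrt (sqnorm x + e ^+ 2).

Lemma sqnorm_ge0 x : 0 <= sqnorm x.
Proof. by rewrite /sqnorm !addr_ge0 ?sqr_ge0. Qed.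

Lemma enormE x : enorm x = Num.sqrt (sqnorm x).
Proof. by []. Qed.

Lemma regnorm_sqr e x : regnorm e x ^+ 2 = sqnorm x + e ^+ 2.
Proof. by rewrite sqr_sqrtr// addr_ge0 ?sqr_ge0 ?sqnorm_ge0. Qed.

Lemma regnorm_gt0 e x : 0 < e -> 0 < regnorm e x.
Proof. by move=> e0; rewrite sqrtr_gt0 ltr_wpDl ?sqnorm_ge0 ?exprn_gt0. Qed.

Lemma proj3_sqr_le i x : proj3 i x ^+ 2 <= sqnorm x.
Proof.
have := sqr_ge0 x.1.1; have := sqr_ge0 x.1.2; have := sqr_ge0 x.2.
by rewrite /sqnorm; have [->|->|->] := proj3_cases R i; lra.
Qed.

Lemma ler_abs_sqr (a b : R) : 0 <= b -> a ^+ 2 <= b ^+ 2 -> `|a| <= b.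
Proof.
by move=> b0; rewrite -[a ^+ 2]real_normK ?num_real// ler_sqr ?nnegrE.
Qed.

Lemma proj3_le_regnorm e i x : `|proj3 i x| <= regnorm e x.
Proof.
apply: ler_abs_sqr; first exact: sqrtr_ge0.
by rewrite regnorm_sqr (le_trans (proj3_sqr_le i x))// lerDl sqr_ge0.
Qed.

Lemma is_derive_proj3 i j x : is_derive x (basis3 R i) (proj3 j) (i == j)%:R.
Proof.
apply/is_derive_line.
have -> : (fun h => proj3 j (h *: basis3 R i + x)) =
          (fun h => (i == j)%:R * h + proj3 j x).
  apply/funext => h; rewrite /proj3 /basis3 -val_eqE.
  by case: i j => [[|[|[|//]]] ?] [[|[|[|//]]] ?] /=;
    rewrite /GRing.scale /= ?mulr1 ?mul1r ?mulr0 ?mul0r.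
apply: der_eq (derD (derZ _ (der_id 0)) (derC (proj3 j x) 0 (1 : R))) _.
by rewrite mulr1 addr0.
Qed.

Lemma is_derive_sqnorm i x : is_derive x (basis3 R i) sqnorm (2 * proj3 i x).
Proof.
pose o0 := @Ordinal 3 0 isT; pose o1 := @Ordinal 3 1 isT; pose o2 := @Ordinal 3 2 isT.
have := derD (derD (derX 2 (is_derive_proj3 i o0 x)) (derX 2 (is_derive_proj3 i o1 x)))
  (derX 2 (is_derive_proj3 i o2 x)).
move=> d; apply: der_eq d _.
by rewrite /o0 /o1 /o2 -!val_eqE; case: i => [[|[|[|//]]] ?];
  rewrite /= ?mulr0 ?addr0 ?add0r ?expr1 ?mulr1.
Qed.

Lemma is_derive_sqrt (t : R) : 0 < t ->
  is_derive t (1 : R) Num.sqrt ((2 * Num.sqrt t)^-1).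
Proof. by move=> t0; exact: is_derive1_sqrt. Qed.

Lemma is_derive_regnorm e i x : 0 < e ->
  is_derive x (basis3 R i) (regnorm e) (proj3 i x / regnorm e x).
Proof.
move=> e0; have r0 := regnorm_gt0 x e0.
have t0 : 0 < sqnorm x + e ^+ 2 by rewrite ltr_wpDl ?sqnorm_ge0 ?exprn_gt0.
have d1 := derD (is_derive_sqnorm i x) (derC (e ^+ 2) x (basis3 R i)).
have d2 := @der_comp R _ Num.sqrt (fun y => sqnorm y + e ^+ 2) x _ _ _
  (is_derive_sqrt t0) d1.
apply: der_eq d2 _.
rewrite -/(regnorm e x); field; rewrite gt_eqF//=.
Qed.

Lemma continuous_regnorm e : continuous (regnorm e).
Proof.
move=> x; apply: (@continuous_comp _ _ _ (fun x => sqnorm x + e ^+ 2) Num.sqrt);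
  last exact: sqrt_continuous.
apply: cvgD; last exact: cvg_cst.
have h i : (fun x => proj3 i x ^+ 2) @ x --> proj3 i x ^+ 2.
  by apply: cvgM; exact: continuous_proj3.
apply: cvgD; last exact: (h (@Ordinal 3 2 isT)).
by apply: cvgD; [exact: (h (@Ordinal 3 0 isT))|exact: (h (@Ordinal 3 1 isT))].
Qed.

Definition radial F e (q : nat) x : R := F q (regnorm e x).

(** The partial derivative of order [al] of [x -> F 0 (regnorm e x)]: three one-dimensional
    recursions are nested, each taking the inner ones as its chain. *)
Definition dradial F e al x : R :=
  hermite x.1.1 al.1.1 (hermite x.1.2 al.1.2 (hermite x.2 al.2 (radial F e ^~ x))) 0%N.

Lemma is_derive_radial N F e q i x : 0 < e -> chain N F -> (q < N)%N ->
  is_derive x (basis3 R i) (radial F e q) (proj3 i x * radial F e q.+1 x).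
Proof.
move=> e0 cF qN; have r0 := regnorm_gt0 x e0.
have [/(_ qN) d _] := cF q _ r0.
apply: der_eq (der_comp d (is_derive_regnorm i x e0)) _.
by rewrite /radial; field; rewrite gt_eqF.
Qed.

Lemma continuous_radial N F e q : 0 < e -> chain N F -> (q <= N)%N ->
  continuous (radial F e q).
Proof.
move=> e0 cF qN x; have [_ /(_ qN) d] := cF q _ (regnorm_gt0 x e0).
by apply: continuous_comp; [exact: continuous_regnorm|exact: d].
Qed.

Lemma continuous_dradial N F e al : 0 < e -> chain N F -> (order3 al <= N)%N ->
  continuous (dradial F e al).
Proof.
move: al => [[a b] c] e0 cF; rewrite /order3 /= => N3.
apply: (@continuous_hermite _ _ (@proj3 R (@Ordinal 3 0 isT)) a
  (fun q x => hermite x.1.2 b (hermite x.2 c (radial F e ^~ x)) q)) => [|q /andP[_ q1]].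
  exact: continuous_proj3.
apply: (@continuous_hermite _ _ (@proj3 R (@Ordinal 3 1 isT)) b
  (fun q x => hermite x.2 c (radial F e ^~ x) q)) => [|q2 /andP[_ q12]].
  exact: continuous_proj3.
apply: (@continuous_hermite _ _ (@proj3 R (@Ordinal 3 2 isT)) c (radial F e)) => [|q3 /andP[_ q23]].
  exact: continuous_proj3.
exact: continuous_radial e0 cF (le_of_ranges N3 q1 q12 q23).
Qed.

Lemma der_hermite_proj j i x a (g : nat -> R3 R -> R) (dg : nat -> R) p : i != j ->
  (forall q, (p <= q <= p + a)%N -> is_derive x (basis3 R i) (g q) (dg q)) ->
  is_derive x (basis3 R i) (fun y => hermite (proj3 j y) a (g^~ y) p)
    (hermite (proj3 j x) a dg p).
Proof.
move=> ij gh; apply/is_derive_line.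
have -> : (fun h => hermite (proj3 j (h *: basis3 R i + x)) a
             (g^~ (h *: basis3 R i + x)) p) =
          (fun h => hermite (proj3 j x) a (g^~ (h *: basis3 R i + x)) p).
  apply/funext => h; congr hermite.
  rewrite /proj3 /basis3; move: ij; rewrite -val_eqE.
  by case: i {gh} j => [[|[|[|//]]] ?] [[|[|[|//]]] ?] //= _;
    rewrite /GRing.scale /= mulr0 add0r.
refine (@der_hermite_cst R _ (proj3 j x) (0 : R) (1 : R) a
  (fun q h => g q (h *: basis3 R i + x)) dg p _).
by move=> q /gh /is_derive_line.
Qed.

Lemma is_derive_dradial N F e i al x : 0 < e -> chain N F -> (order3 al < N)%N ->
  is_derive x (basis3 R i) (dradial F e al) (dradial F e (inc i al) x).
Proof.
move: al => [[a b] c] e0 cF; rewrite /order3 /= => N3.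
have dG q : (q < N)%N ->
    is_derive x (basis3 R i) (radial F e q) (proj3 i x * radial F e q.+1 x).
  exact: is_derive_radial.
pose o0 := @Ordinal 3 0 isT; pose o1 := @Ordinal 3 1 isT; pose o2 := @Ordinal 3 2 isT.
have hZ (t v : R) c' (g : nat -> R) q :
    hermite v c' (fun q => t * g q.+1) q = t * hermite v c' g q.+1.
  by rewrite hermiteZ hermite_shift.
have [->|->|->] : [\/ i = o0, i = o1 | i = o2].
  by case: (i) => [[|[|[|//]]] hi]; [apply: Or31|apply: Or32|apply: Or33]; exact: val_inj.
- apply: (@der_hermite_var _ _ (proj3 o0) x _ a
    (fun q x => hermite (proj3 o1 x) b (hermite (proj3 o2 x) c (radial F e ^~ x)) q)).
    exact: is_derive_proj3.
  move=> q /andP[_ q1].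
  have d1 q2 : (q <= q2 <= q + b)%N ->
      is_derive x (basis3 R o0) (fun y => hermite (proj3 o2 y) c (radial F e ^~ y) q2)
        (proj3 o0 x * hermite (proj3 o2 x) c (radial F e ^~ x) q2.+1).
    move=> /andP[_ q12]; rewrite -hZ; apply: der_hermite_proj => // q3 /andP[_ q23].
    exact: is_derive_radial e0 cF (lt_of_ranges N3 q1 q12 q23).
  apply: der_eq (der_hermite_proj (j := o1) _ d1) _ => //.
- apply: (@der_hermite_proj o0 o1 x a
    (fun q x => hermite (proj3 o1 x) b (hermite (proj3 o2 x) c (radial F e ^~ x)) q)
    (hermite (proj3 o1 x) b.+1 (hermite (proj3 o2 x) c (radial F e ^~ x)))) => //.
  move=> q1 /andP[_ q01].
  apply: (@der_hermite_var _ _ (proj3 o1) x _ b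
    (fun q x => hermite (proj3 o2 x) c (radial F e ^~ x) q)).
    exact: is_derive_proj3.
  move=> q2 /andP[_ q12]; rewrite -hZ; apply: der_hermite_proj => // q3 /andP[_ q23].
  exact: is_derive_radial e0 cF (lt_of_ranges N3 q01 q12 q23).
- apply: (@der_hermite_proj o0 o2 x a
    (fun q x => hermite (proj3 o1 x) b (hermite (proj3 o2 x) c (radial F e ^~ x)) q)
    (hermite (proj3 o1 x) b (hermite (proj3 o2 x) c.+1 (radial F e ^~ x)))) => //.
  move=> q1 /andP[_ q01].
  apply: (@der_hermite_proj o1 o2 x b
    (fun q x => hermite (proj3 o2 x) c (radial F e ^~ x) q)
    (hermite (proj3 o2 x) c.+1 (radial F e ^~ x))) => //.
  move=> q2 /andP[_ q12].
  apply: (@der_hermite_var _ _ (proj3 o2) x _ c (radial F e)).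
    exact: is_derive_proj3.
  move=> q3 /andP[_ q23].
  exact: is_derive_radial e0 cF (lt_of_ranges N3 q01 q12 q23).
Qed.

(** Each nested recursion takes its order from a budget of four. The final weight index is the total
    order, at most 4, where the weight is 1; so a chain that obeys the weights has bounded
    derivatives up to order four, uniformly in [e]. *)
Lemma dradial_bound al (S : R) : 1 <= S -> (order3 al <= 4)%N -> exists2 C, 0 <= C &
  forall F e x (M : R), 0 < e -> regnorm e x <= S -> 0 <= M ->
  (forall q, (q <= 4)%N -> `|F q (regnorm e x)| <= M * weight (regnorm e x) q.*2) ->
  `|dradial F e al x| <= C * M.
Proof.
move: al => [[a b] c] S1; rewrite /order3 /= => N4.
have [Ca Ca0 ha] := hermite_bound a S1.
have [Cb Cb0 hb] := hermite_bound b S1.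
have [Cc Cc0 hc] := hermite_bound c S1.
exists (Ca * (Cb * Cc)); first by rewrite !mulr_ge0.
move=> F e x M e0 sS M0 FM; have s0 := regnorm_gt0 x e0.
have p0 := proj3_le_regnorm e (@Ordinal 3 0 isT) x.
have p1 := proj3_le_regnorm e (@Ordinal 3 1 isT) x.
have p2 := proj3_le_regnorm e (@Ordinal 3 2 isT) x.
have bc q : (q <= 4 - c)%N -> `|hermite x.2 c (radial F e ^~ x) q| <=
    Cc * M * weight (regnorm e x) (q.*2 + c).
  move=> q4; have := hc _ _ (radial F e ^~ x) M 0%N 4%N q s0 sS p2 M0.
  by rewrite addn0; apply => [q' ?|]; [rewrite addn0; exact: FM|exact: le_range3 N4 q4].
have bb q : (q <= 4 - c - b)%N ->
    `|hermite x.1.2 b (hermite x.2 c (radial F e ^~ x)) q| <=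
    Cb * (Cc * M) * weight (regnorm e x) (q.*2 + c + b).
  move=> q4; apply: (hb _ _ _ _ _ (4 - c)%N) => //; first by rewrite mulr_ge0.
  exact: le_range2 N4 q4.
have := ha _ _ (hermite x.1.2 b (hermite x.2 c (radial F e ^~ x))) (Cb * (Cc * M))
  (c + b)%N (4 - c - b)%N 0%N s0 sS p0.
rewrite /dradial /= => h; apply: le_trans (h _ _ _) _.
- by rewrite !mulr_ge0.
- by move=> q q4; rewrite addnA; exact: bb.
- exact: le_range1 N4.
have -> : weight (regnorm e x) (0.*2 + (c + b) + a) = 1.
  rewrite /weight; rewrite (ranges_sub N4).
  by rewrite expr0 invr1.
by rewrite mulr1 !mulrA.
Qed.

Definition bilap (W : nat * nat * nat -> R3 R -> R) x : R :=
  \sum_(i < 3) \sum_(j < 3) W (inc i (inc i (inc j (inc j (0, 0, 0)%N)))) x.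

(** For a radial function on R^n the coefficients are [1], [2(n + 2)] and [n(n + 2)]; here
    [n = 3]. *)
Lemma bilap_dradial F e x : bilap (dradial F e) x =
  sqnorm x ^+ 2 * F 4 (regnorm e x) + 10 * sqnorm x * F 3 (regnorm e x) + 15 * F 2 (regnorm e x).
Proof.
rewrite /bilap !big_ord_recl !big_ord0 /inc /= /dradial /= /radial /sqnorm; ring.
Qed.

End Radial.

(** * The energy estimate *)

Section ConvolExtra.
Variable R : realType.
Notation mu := (@mu3 R).
Implicit Types (f K : R3 R -> R) (x y : R3 R).

Lemma vanish_supp f (A : R) : vanish_off A f -> forall x, f x != 0 -> cube A x.
Proof. by move=> fA x; apply: contraNP => /fA ->. Qed.

Lemma vanish_convol K f (A B : R) : vanish_off A K -> vanish_off B f ->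
  vanish_off (A + B) (convol K f).
Proof.
move=> KA fB x xAB; rewrite /convol /Rintegral integral0_eq// => y _.
have [->|fy] := eqVneq (f y) 0; first by rewrite mulr0.
rewrite KA ?mul0r// => xy; apply: xAB.
have -> : x = (x - y) - (- y) by rewrite opprK subrK.
apply: cubeB => //; apply/cubeP => i.
have -> : proj3 i (- y) = - proj3 i y by case: (proj3_cases R i) => ->.
by rewrite normrN; move/cubeP: (vanish_supp fB fy).
Qed.

Lemma inner_cube (A : R) f g : vanish_off A f ->
  inner mu (cube A) f g = \int[mu]_x (f x * g x).
Proof.
move=> fA; rewrite /inner Rintegral_mkcond; apply: eq_Rintegral => x _.
rewrite patchE; case: ifPn => // /negP xA; rewrite fA ?mul0r// => h.
by apply: xA; rewrite mem_set.
Qed.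

Lemma continuous_sum n (g : 'I_n -> R3 R -> R) : (forall i, continuous (g i)) ->
  continuous (fun x => \sum_(i < n) g i x).
Proof.
elim: n g => [|n ih] g cg x.
  have -> : (fun x => \sum_(i < 0) g i x) = (fun=> 0).
    by apply/funext => y; rewrite big_ord0.
  exact: cvg_cst.
have -> : (fun x => \sum_(i < n.+1) g i x) =
    (fun x => g ord0 x + \sum_(i < n) g (lift ord0 i) x).
  by apply/funext => y; rewrite big_ord_recl.
by apply: cvgD; [exact: cg|apply: ih].
Qed.

Lemma convol_sum n (K : 'I_n -> R3 R -> R) f x :
  (forall i, mu.-integrable setT (EFin \o (fun y => K i (x - y) * f y))) ->
  mu.-integrable setT (EFin \o (fun y : R3 R => (\sum_(i < n) K i (x - y)) * f y)) /\
  convol (fun z => \sum_(i < n) K i z) f x = \sum_(i < n) convol (K i) f x.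
Proof.
move=> iK; rewrite /convol.
have h (r : seq 'I_n) : mu.-integrable setT
      (EFin \o (fun y => \sum_(i <- r) K i (x - y) * f y)) /\
    \int[mu]_y (\sum_(i <- r) K i (x - y) * f y) =
    \sum_(i <- r) \int[mu]_y (K i (x - y) * f y).
  elim: r => [|i r [ih1 ih2]].
    split; last by rewrite big_nil; under eq_Rintegral do rewrite big_nil;
      rewrite Rintegral_cst// mul0r.
    by apply: (integrableE _ _ (integrable0 mu setT)) => // y _; rewrite big_nil.
  split.
    apply: (integrableE _ _ (integrableRD _ (iK i) ih1)) => // y _.
    by rewrite big_cons.
  rewrite big_cons -ih2 -RintegralD//.
  by apply: eq_Rintegral => y _; rewrite big_cons.
split.
  by apply: (integrableE _ _ (h _).1) => // y _; rewrite mulr_suml.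
rewrite -(h _).2; apply: eq_Rintegral => y _.
by rewrite mulr_suml.
Qed.

End ConvolExtra.

Section InnerSum.
Context d (T : measurableType d) (R : realType) (mu : {measure set T -> \bar R}).
Variable D : set T.
Hypothesis mD : measurable D.

Lemma l2_sum n (g : 'I_n -> T -> R) : (forall i, l2 mu D (g i)) ->
  l2 mu D (fun x => \sum_(i < n) g i x).
Proof.
move=> lg; have h (r : seq 'I_n) : l2 mu D (fun x => \sum_(i <- r) g i x).
  elim: r => [|i r ih].
    have -> : (fun x => \sum_(i <- [::]) g i x) = (fun=> 0) :> (T -> R).
      by apply/funext => x; rewrite big_nil.
    split => //; apply: (integrableE _ _ (integrable0 mu D)) => // x _.
    by rewrite expr0n.
  have -> : (fun x => \sum_(j <- i :: r) g j x) =
            (fun x => g i x + \sum_(j <- r) g j x).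
    by apply/funext => x; rewrite big_cons.
  exact: l2D.
exact: h.
Qed.

Lemma inner_suml n (g : 'I_n -> T -> R) (h : T -> R) : (forall i, l2 mu D (g i)) ->
  l2 mu D h ->
  inner mu D (fun x => \sum_(i < n) g i x) h = \sum_(i < n) inner mu D (g i) h.
Proof.
elim: n g => [|n ih] g lg lh.
  rewrite big_ord0 /inner -[RHS](mul0r (fine (mu D))) -(Rintegral_cst mu mD).
  by apply: eq_Rintegral => x _; rewrite big_ord0 mul0r.
rewrite big_ord_recl -ih// -innerDl//; last exact: l2_sum.
by apply: eq_Rintegral => x _; rewrite big_ord_recl.
Qed.

Lemma inner_sumr n (g : 'I_n -> T -> R) (h : T -> R) : (forall i, l2 mu D (g i)) ->
  l2 mu D h ->
  inner mu D h (fun x => \sum_(i < n) g i x) = \sum_(i < n) inner mu D h (g i).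
Proof.
move=> lg lh; rewrite innerC inner_suml//; apply: eq_bigr => i _.
exact: innerC.
Qed.

End InnerSum.

Section EnergyMethod.
Context d (T : measurableType d) (R : realType) (mu : {measure set T -> \bar R}).
Implicit Types (i j k l : 'I_3) (al be : nat * nat * nat).
Variables (X : set T) (W : nat * nat * nat -> T -> R).
Hypothesis mX : measurable X.
Hypothesis W_l2 : forall al, (order3 al <= 5)%N -> l2 mu X (W al).
Hypothesis ibp : forall i al be, (order3 al <= 4)%N -> (order3 be <= 4)%N ->
  inner mu X (W (inc i al)) (W be) = - inner mu X (W al) (W (inc i be)).

Let dd i j al := inc i (inc i (inc j (inc j al))).
Let o : nat * nat * nat := (0, 0, 0)%N.

(** Four integrations by parts move [i] and [k] to the right factor, [j] and [l] to the left one. On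
    the way a factor of order five appears, which is why L^2 membership is asked up to that
    order. *)
Let energy4 i j k l :
  inner mu X (W (inc i (inc j (inc k (inc l o))))) (W (inc i (inc j (inc k (inc l o))))) =
  inner mu X (W (dd j l o)) (W (dd i k o)).
Proof.
rewrite ibp ?order3_inc//.
have -> : inc i (inc i (inc j (inc k (inc l o)))) = inc j (inc i (inc i (inc k (inc l o)))).
  by rewrite (incC i j) (incC i j).
rewrite innerC ibp ?order3_inc// innerC opprK.
have -> : inc j (inc j (inc k (inc l o))) = inc k (inc j (inc j (inc l o))).
  by rewrite (incC j k) (incC j k).
rewrite ibp ?order3_inc//.
have -> : inc k (inc i (inc i (inc k (inc l o)))) = inc l (inc i (inc i (inc k (inc k o)))).
  by rewrite (incC k i) (incC k i) (incC k l) (incC k l) (incC i l) (incC i l).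
rewrite innerC ibp ?order3_inc// innerC opprK.
have -> : inc l (inc j (inc j (inc l o))) = dd j l o.
  by rewrite /dd (incC l j) (incC l j).
by [].
Qed.

Let BW x := \sum_(i < 3) \sum_(j < 3) W (dd i j o) x.

Let l2_BW : l2 mu X BW.
Proof.
apply: l2_sum => // i; apply: l2_sum => // j; apply: W_l2.
by rewrite !order3_inc.
Qed.

Let sum_energy4 :
  \sum_(i < 3) \sum_(k < 3) \sum_(j < 3) \sum_(l < 3)
    inner mu X (W (inc i (inc j (inc k (inc l o))))) (W (inc i (inc j (inc k (inc l o))))) =
  inner mu X BW BW.
Proof.
have ldd i j : l2 mu X (W (dd i j o)) by apply: W_l2; rewrite !order3_inc.
have ls i : l2 mu X (fun x => \sum_(j < 3) W (dd i j o) x) by exact: l2_sum.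
rewrite [RHS](@inner_sumr _ _ _ mu X mX _ (fun i x => \sum_(k < 3) W (dd i k o) x))//.
apply: eq_bigr => i _.
rewrite [RHS](@inner_sumr _ _ _ mu X mX _ (fun k => W (dd i k o)))//.
apply: eq_bigr => k _.
rewrite [RHS](@inner_suml _ _ _ mu X mX _ (fun j x => \sum_(l < 3) W (dd j l o) x))//.
apply: eq_bigr => j _.
rewrite [RHS](@inner_suml _ _ _ mu X mX _ (fun l => W (dd j l o)))//.
apply: eq_bigr => l _.
exact: energy4.
Qed.

(** Fourth derivatives are controlled by the bilaplacian through [sum_energy4]. The squared norms of
    the second derivatives add up to the pairing of [W o] with the bilaplacian, and for odd orders
    one integration by parts gives a pairing of the two neighbouring even orders; Young's inequality
    does the rest. *)
Lemma energy_bound (Q : R) al : inner mu X (W o) (W o) <= Q -> inner mu X BW BW <= Q ->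
  (order3 al <= 4)%N -> inner mu X (W al) (W al) <= 2 * Q.
Proof.
move=> Q0 Q4.
have Q00 : 0 <= Q by apply: le_trans Q0; exact: inner_ge0.
have lW be : (order3 be <= 4)%N -> l2 mu X (W be).
  by move=> be4; apply: W_l2; exact: leq_trans be4 _.
have young be ga : (order3 be <= 4)%N -> (order3 ga <= 4)%N ->
    inner mu X (W be) (W be) <= 2 * Q -> inner mu X (W ga) (W ga) <= 2 * Q ->
    - inner mu X (W be) (W ga) <= 2 * Q.
  move=> be4 ga4 hb hg; have := inner_young mX (lW be be4) (lW ga ga4).
  have := ler_norm (- inner mu X (W be) (W ga)); rewrite normrN; lra.
have h0 be : order3 be = 0%N -> inner mu X (W be) (W be) <= 2 * Q.
  move: be => [[[|a] [|b]] [|c]]; rewrite /order3//= => _; rewrite -/o; lra.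
have h4 be : order3 be = 4%N -> inner mu X (W be) (W be) <= Q.
  move=> /order3S[i [b1 [-> /order3S[j [b2 [-> /order3S[k [b3 [-> /order3S[l [b4 [->]]]]]]]]]]]].
  move: b4 => [[[|a] [|b]] [|c]]; rewrite /order3//= => _.
  apply: le_trans Q4; rewrite -sum_energy4.
  have N0 i' j' k' l' : 0 <= inner mu X (W (inc i' (inc j' (inc k' (inc l' o)))))
    (W (inc i' (inc j' (inc k' (inc l' o))))) by exact: inner_ge0.
  rewrite (bigD1 i)//= (bigD1 k)//= (bigD1 j)//= (bigD1 l)//=.
  by rewrite -!addrA lerDl !addr_ge0 ?sumr_ge0// => *; rewrite ?sumr_ge0// => *;
     rewrite ?sumr_ge0// => *; rewrite ?sumr_ge0.
have h2 be : order3 be = 2%N -> inner mu X (W be) (W be) <= 2 * Q.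
  move=> /order3S[i [b1 [-> /order3S[j [b2 [->]]]]]].
  move: b2 => [[[|a] [|b]] [|c]]; rewrite /order3//= => _.
  have e2 i' j' : inner mu X (W (inc i' (inc j' o))) (W (inc i' (inc j' o))) =
      inner mu X (W o) (W (dd i' j' o)).
    rewrite ibp ?order3_inc//.
    have -> : inc i' (inc i' (inc j' o)) = inc j' (inc i' (inc i' o)).
      by rewrite (incC i' j') (incC i' j').
    rewrite ibp ?order3_inc// opprK.
    by rewrite /dd (incC j' i') (incC j' i') (incC j' i') (incC j' i').
  apply: (@le_trans _ _ (inner mu X (W o) BW)); last first.
    have := inner_young mX (lW o isT) l2_BW.
    have := ler_norm (inner mu X (W o) BW); lra.
  have ldd i' j' : l2 mu X (W (dd i' j' o)) by apply: W_l2; rewrite !order3_inc.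
  have ls i' : l2 mu X (fun x => \sum_(j < 3) W (dd i' j o) x) by exact: l2_sum.
  have lo : l2 mu X (W o) by exact: lW.
  rewrite [leRHS](@inner_sumr _ _ _ mu X mX _ (fun i x => \sum_(k < 3) W (dd i k o) x))//.
  have es i' : inner mu X (W o) (fun x => \sum_(k < 3) W (dd i' k o) x) =
      \sum_(k < 3) inner mu X (W (inc i' (inc k o))) (W (inc i' (inc k o))).
    rewrite [LHS](@inner_sumr _ _ _ mu X mX _ (fun k => W (dd i' k o)))//.
    by apply: eq_bigr => k _; rewrite e2.
  under eq_bigr do rewrite es.
  rewrite (bigD1 i)//= (bigD1 j)//= -addrA lerDl addr_ge0 ?sumr_ge0// => *;
    rewrite ?sumr_ge0// => *; exact: inner_ge0.
have h1 be : order3 be = 1%N -> inner mu X (W be) (W be) <= 2 * Q.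
  move=> /order3S[i [b1 [-> b10]]].
  rewrite ibp ?order3_inc ?b10//; apply: young.
  - by rewrite b10.
  - by rewrite !order3_inc b10.
  - exact: h0.
  - by apply: h2; rewrite !order3_inc b10.
have h3 be : order3 be = 3%N -> inner mu X (W be) (W be) <= 2 * Q.
  move=> /order3S[i [b1 [-> b10]]].
  rewrite ibp ?order3_inc ?b10//; apply: young.
  - by rewrite b10.
  - by rewrite !order3_inc b10.
  - exact: h2.
  - by apply: le_trans (h4 _ _) _; [rewrite !order3_inc b10|lra].
case E : (order3 al) => [|[|[|[|[|//]]]]] _; [exact: h0|exact: h1|exact: h2|exact: h3|].
by apply: le_trans (h4 _ E) _; lra.
Qed.

End EnergyMethod.

Section Energy.
Variable R : realType.
Notation mu := (@mu3 R).
Implicit Types (i j k l : 'I_3) (al be : nat * nat * nat).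
Variables (F : nat -> R -> R) (e S B : R) (f : R3 R -> R).
Hypotheses (e0 : 0 < e) (cF : chain 5 F).
Hypothesis FS : forall q s, (q <= 5)%N -> S <= s -> F q s = 0.
Hypotheses (fi : mu.-integrable setT (EFin \o f)) (fB : vanish_off B f).

Let K := dradial F e.
Let W al := convol (K al) f.
Let X := cube (S + B).

Lemma vanish_dradial al : (order3 al <= 5)%N -> vanish_off S (K al).
Proof.
move=> al5 x xS.
have Sr : S <= regnorm e x.
  have [i hi] : exists i, ~ `|proj3 i x| <= S.
    apply: contrapT => h; apply: xS; apply/cubeP => i.
    by apply: contrapT => hi; apply: h; exists i.
  move/negP: hi; rewrite -ltNge => /ltW h; apply: le_trans h _.
  exact: proj3_le_regnorm.
have Z (t : R) a : hermite t a (fun=> 0) =1 (fun=> 0 : R).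
  move=> p; rewrite (@hermite_ext _ _ _ _ (fun=> 0 * 0)); last by move=> q _; rewrite mul0r.
  by rewrite (hermiteZ t a 0 (fun=> 0)) mul0r.
rewrite /K /dradial; move: al al5 => [[a b] c]; rewrite /order3 /= => al5.
rewrite (@hermite_ext _ _ _ _ (fun=> 0)); first exact: Z.
move=> p /andP[_ pa]; rewrite (@hermite_ext _ _ _ _ (fun=> 0)); first exact: Z.
move=> q /andP[_ qb]; rewrite (@hermite_ext _ _ _ _ (fun=> 0)); first exact: Z.
by move=> r /andP[_ rc]; apply: FS => //; exact: le_of_ranges al5 pa qb rc.
Qed.

Let K_continuous al : (order3 al <= 5)%N -> continuous (K al).
Proof. exact: continuous_dradial. Qed.

Let K_bounded al : (order3 al <= 5)%N -> exists2 C, 0 <= C & forall x, `|K al x| <= C.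
Proof.
move=> al5; have [C [C0 hC]] := bounded_on_cube S (K_continuous al5).
exists C => // x; have [xS|xS] := pselect (cube S x); first exact: hC.
by rewrite vanish_dradial// normr0.
Qed.

Let K_int al x : (order3 al <= 5)%N ->
  mu.-integrable setT (EFin \o (fun y => K al (x - y) * f y)).
Proof.
move=> al5; have [C C0 hC] := K_bounded al5.
apply: (@integrable_kernel _ _ _ _ C) => //.
exact: continuous_measurable (K_continuous al5).
Qed.

Let W_vanish al : (order3 al <= 5)%N -> vanish_off (S + B) (W al).
Proof. by move=> al5; apply: vanish_convol fB; exact: vanish_dradial. Qed.

Let W_l2 al : (order3 al <= 5)%N -> l2 mu X (W al).
Proof.
move=> al5; have [C C0 hC] := K_bounded al5.
have mK := continuous_measurable (K_continuous al5).
apply: (@l2_bounded _ _ _ _ _ _ (C * \int[mu]_y `|f y|)).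
- exact: measurable_cube.
- exact: mu3_cube.
- apply: (@measurable_conv _ _ _ _ C) => //; [exact: measurable_cube|exact: mu3_cube].
- by move=> x _; exact: conv_bound.
Qed.

Let W_int al : (order3 al <= 5)%N -> mu.-integrable setT (EFin \o W al).
Proof.
move=> al5.
have l21 : l2 mu X (fun=> 1).
  apply: (@l2_bounded _ _ _ _ _ _ 1) => //; [exact: measurable_cube|exact: mu3_cube|].
  by move=> x _; rewrite normr1.
have := l2M (@measurable_cube R (S + B)) (W_l2 al5) l21.
move/(integrable_mkcond _ (@measurable_cube R (S + B))).1.
apply: eq_integrable => // x _; rewrite /= patchE.
case: ifPn => [_|/negP xA]; first by rewrite /= mulr1.
by rewrite W_vanish// => h; apply: xA; rewrite mem_set.
Qed.

(** Fubini's theorem spreads one factor into translates of its kernel. Such a translate has compact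
    support and serves as the test function in [conv_weak_derivative], although [f] itself is merely
    integrable. *)
Lemma energy_ibp i al be : (order3 al <= 4)%N -> (order3 be <= 4)%N ->
  inner mu X (W (inc i al)) (W be) = - inner mu X (W al) (W (inc i be)).
Proof.
move=> al4 be4.
have al5 : (order3 al <= 5)%N by exact: leq_trans al4 _.
have be5 : (order3 be <= 5)%N by exact: leq_trans be4 _.
have ial5 : (order3 (inc i al) <= 5)%N by rewrite order3_inc.
have ibe5 : (order3 (inc i be) <= 5)%N by rewrite order3_inc.
rewrite !inner_cube; [|exact: W_vanish..].
have [C1 C10 h1] := K_bounded ial5; have [C2 C20 h2] := K_bounded al5.
have [_ _ ->] := conv_swap C10 (continuous_measurable (K_continuous ial5)) fi (W_int be5)
  (fun x y _ _ => h1 (x - y)).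
have [_ i2 ->] := conv_swap C20 (continuous_measurable (K_continuous al5)) fi (W_int ibe5)
  (fun x y _ _ => h2 (x - y)).
rewrite -mulN1r -RintegralZl//; apply: eq_Rintegral => y _.
have [->|fy] := eqVneq (f y) 0; first by rewrite !mul0r mulr0.
rewrite mulrCA; congr (_ * _); rewrite mulN1r.
have ct (g : R3 R -> R) : continuous g -> continuous (fun x => g (x - y)).
  move=> cg x; apply: (@continuous_comp _ _ _ (fun x => x - y)); last exact: cg.
  by apply: cvgB; [exact: cvg_id|exact: cvg_cst].
have := @conv_weak_derivative R (K be) (K (inc i be)) (fun x => K al (x - y))
  (fun x => K (inc i al) (x - y)) f i (S + B) B (K_continuous be5) (K_continuous ibe5).
have dK al' x : (order3 al' <= 4)%N -> is_derive x (basis3 R i) (K al') (K (inc i al') x).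
  by move=> al'4; apply: is_derive_dradial cF _.
move=> /(_ (fun x => dK be x be4) (ct _ (K_continuous al5)) (ct _ (K_continuous ial5))).
move=> /(_ (fun x => is_derive_translate (dK al (x - y) al4))) h.
under eq_Rintegral do rewrite mulrC.
under [in RHS]eq_Rintegral do rewrite mulrC.
apply: h => // x xA; apply: (vanish_dradial al5) => xy; apply: xA.
have -> : x = (x - y) - (- y) by rewrite opprK subrK.
apply: cubeB => //; apply/cubeP => j.
have -> : proj3 j (- y) = - proj3 j y by case: (proj3_cases R j) => ->.
by rewrite normrN; move/cubeP: (vanish_supp fB fy).
Qed.

Variables (s0 M : R).
Hypotheses (S0 : 0 < S) (M0 : 0 <= M).
Hypothesis F_near : forall s, 0 < s -> s < s0 ->
  [/\ F 2 s = - s ^- 3, F 3 s = 3 * s ^- 5 & F 4 s = - (15 * s ^- 7)].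
Hypothesis F_far : forall q s, (q <= 4)%N -> s0 <= s -> 0 < s -> `|F q s| <= M.
Hypothesis F0_bound : forall s, 0 < s -> `|F 0 s| <= M.
Hypothesis f2 : l2 mu setT f.

Let o : nat * nat * nat := (0, 0, 0)%N.
(** The kernel and, away from the origin, its bilaplacian are at most [M (1 + S^4 + 10 S^2 + 15)],
    with the coefficients of [bilap_dradial], and they vanish outside [cube S]. Inside that cube
    [(1 + S^2)^3 poisson 1] is at least 1. *)
Let C2 := M * (1 + S ^+ 4 + 10 * S ^+ 2 + 15) * (1 + S ^+ 2) ^+ 3.
(** One majorant for both kernels to which Schur's test is applied, [K o] and [bilap K]: the first
    term serves the bilaplacian near the origin, the second everything else. The bound on its
    integral does not involve [e]. *)
Let k x := 15 * poisson e x + C2 * poisson 1 x.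

Let Mpos : 0 <= M * (1 + S ^+ 4 + 10 * S ^+ 2 + 15).
Proof.
have := exprn_ge0 4 (ltW S0); have := exprn_ge0 2 (ltW S0) => h1 h2.
by apply: mulr_ge0 => //; lra.
Qed.

Let C20 : 0 <= C2.
Proof. by rewrite /C2 mulr_ge0// exprn_ge0// addr_ge0 ?sqr_ge0. Qed.

Let poisson1_ge x : cube S x -> 1 <= (1 + S ^+ 2) ^+ 3 * poisson 1 x.
Proof.
move=> /cubeP xS.
have h i : 1 <= (1 + S ^+ 2) * (1 / (proj3 i x ^+ 2 + 1 ^+ 2)).
  rewrite mulrA mulr1 ler_pdivlMr ?mul1r; last by rewrite ltr_wpDl ?sqr_ge0// expr1n.
  rewrite expr1n addrC lerD2l -[_ ^+ 2]real_normK ?num_real//.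
  by rewrite ler_sqr ?nnegrE ?(ltW S0)//; exact: xS.
have -> : (1 + S ^+ 2) ^+ 3 * poisson 1 x =
  ((1 + S ^+ 2) * (1 / (x.1.1 ^+ 2 + 1 ^+ 2))) *
  (((1 + S ^+ 2) * (1 / (x.1.2 ^+ 2 + 1 ^+ 2))) *
   ((1 + S ^+ 2) * (1 / (x.2 ^+ 2 + 1 ^+ 2)))) by rewrite /poisson; ring.
apply: mulr_ege1; first exact: (h (@Ordinal 3 0 isT)).
by apply: mulr_ege1; [exact: (h (@Ordinal 3 1 isT))|exact: (h (@Ordinal 3 2 isT))].
Qed.

(** [e^4 r^-7] is [(e/r^2)^3] times [e/r <= 1], and [r^2] dominates each [x_i^2 + e^2]. *)
Let poisson_near x : e ^+ 4 * regnorm e x ^- 7 <= poisson e x.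
Proof.
set r := regnorm e x; have r0 : 0 < r by exact: regnorm_gt0.
have er : e <= r.
  rewrite -(ger0_norm (ltW e0)); apply: ler_abs_sqr; first exact: ltW.
  by rewrite regnorm_sqr lerDr sqnorm_ge0.
have h i : e / r ^+ 2 <= e / (proj3 i x ^+ 2 + e ^+ 2).
  rewrite ler_pM2l// lef_pV2 ?posrE ?exprn_gt0//; last first.
    by rewrite ltr_wpDl ?sqr_ge0 ?exprn_gt0.
  by rewrite regnorm_sqr lerD2r proj3_sqr_le.
apply: (@le_trans _ _ (e / r ^+ 2 * (e / r ^+ 2) * (e / r ^+ 2))).
  have -> : e ^+ 4 * r ^- 7 = e / r ^+ 2 * (e / r ^+ 2) * (e / r ^+ 2) * (e / r).
    by field; rewrite gt_eqF.
  rewrite ler_piMr//; first by rewrite !mulr_ge0 ?invr_ge0 ?exprn_ge0 ?ltW.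
  by rewrite ler_pdivrMr ?mul1r.
have h0 : 0 <= e / r ^+ 2 by rewrite divr_ge0 ?exprn_ge0 ?ltW.
rewrite /poisson; apply: ler_pM => //; first by rewrite mulr_ge0.
  by apply: ler_pM => //; [exact: (h (@Ordinal 3 0 isT))|exact: (h (@Ordinal 3 1 isT))].
exact: (h (@Ordinal 3 2 isT)).
Qed.

Let k_ge0 x : 0 <= k x.
Proof. by rewrite /k addr_ge0// mulr_ge0 ?poisson_ge0. Qed.

Let far_bound x (v : R) : (cube S x -> `|v| <= M * (1 + S ^+ 4 + 10 * S ^+ 2 + 15)) ->
  (~ cube S x -> v = 0) -> `|v| <= k x.
Proof.
move=> h1 h2; have [xS|/h2 ->] := pselect (cube S x); last by rewrite normr0 k_ge0.
apply: (@le_trans _ _ (C2 * poisson 1 x)); last by rewrite lerDr mulr_ge0 ?poisson_ge0.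
apply: le_trans (h1 xS) _; rewrite /C2 -mulrA ler_peMr ?poisson1_ge//.
Qed.

Let K0_le x : `|K o x| <= k x.
Proof.
apply: far_bound => [_|]; last exact: vanish_dradial.
apply: le_trans (F0_bound (regnorm_gt0 x e0)) _.
have := exprn_ge0 4 (ltW S0); have := exprn_ge0 2 (ltW S0) => h1 h2.
by rewrite ler_peMr//; lra.
Qed.

Let bilap_le x : `|bilap K x| <= k x.
Proof.
set r := regnorm e x; have r0 : 0 < r by exact: regnorm_gt0.
have r2 : sqnorm x = r ^+ 2 - e ^+ 2 by rewrite regnorm_sqr addrK.
have [rs|rs] := ltP r s0.
  have [f2' f3' f4'] := F_near r0 rs.
  rewrite bilap_dradial -/r f2' f3' f4' r2.
  (* Everything cancels except a multiple of [e^4]: for [e = 0] the distance is biharmonic away from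
     the origin. *)
  have -> : (r ^+ 2 - e ^+ 2) ^+ 2 * - (15 * r ^- 7) +
     10 * (r ^+ 2 - e ^+ 2) * (3 * r ^- 5) + 15 * - r ^- 3 = - (15 * (e ^+ 4 * r ^- 7)).
    by field; rewrite gt_eqF.
  rewrite normrN ger0_norm; last by rewrite !mulr_ge0 ?invr_ge0 ?exprn_ge0 ?ltW.
  apply: (@le_trans _ _ (15 * poisson e x)); first by rewrite ler_pM2l// poisson_near.
  by rewrite lerDl mulr_ge0 ?poisson_ge0.
apply: far_bound => xS; last first.
  rewrite /bilap big1// => i _; rewrite big1// => j _.
  by apply: (vanish_dradial _ xS); rewrite !order3_inc.
have [rS|rS] := ltP r S; last first.
  by rewrite bilap_dradial !FS// !mulr0 !addr0 normr0; exact: Mpos.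
have x2S : sqnorm x <= S ^+ 2.
  rewrite r2 (@le_trans _ _ (r ^+ 2))//; first by rewrite gerBl sqr_ge0.
  by rewrite !expr2; apply: ler_pM; exact: ltW.
have x20 := sqnorm_ge0 x.
have := F_far (q := 2) isT rs r0; have := F_far (q := 3) isT rs r0.
have := F_far (q := 4) isT rs r0; rewrite bilap_dradial -/r.
set a := F 4 r; set b := F 3 r; set c := F 2 r; set t := sqnorm x in x20 x2S *.
move=> ha hb hc; apply: le_trans (ler_normD _ _) _.
apply: (@le_trans _ _ (S ^+ 4 * M + 10 * S ^+ 2 * M + 15 * M)).
  apply: lerD; last by rewrite normrM ger0_norm// ler_pM2l.
  apply: le_trans (ler_normD _ _) _; rewrite !normrM !(ger0_norm x20) (ger0_norm (ler0n _ 10)).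
  apply: lerD; apply: ler_pM => //.
  - by rewrite mulr_ge0.
  - have -> : S ^+ 4 = S ^+ 2 * S ^+ 2 by ring.
    by apply: ler_pM.
  - by rewrite mulr_ge0.
  - by rewrite ler_pM2l.
by have := M0; have := exprn_ge0 4 (ltW S0); have := exprn_ge0 2 (ltW S0); lra.
Qed.

Lemma energy_estimate al : (order3 al <= 4)%N ->
  inner mu X (W al) (W al) <=
  2 * (((15 + C2) * pi ^+ 3) ^+ 2 * inner mu setT f f).
Proof.
move=> al4; set A := (15 + C2) * pi ^+ 3.
have A0 : 0 < A by rewrite mulr_gt0 ?exprn_gt0 ?pi_gt0// ltr_wpDr.
have mX : measurable X by exact: measurable_cube.
have ck : continuous k.
  move=> x; apply: cvgD; apply: cvgM; (try exact: cvg_cst); exact: continuous_poisson.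
have mk := continuous_measurable ck.
have mf : measurable_fun setT f by case: f2.
have kA x : (\int[mu]_y (k (x - y))%:E <= A%:E)%E.
  have e1 y : ((k (x - y))%:E = 15%:E * (poisson e (x - y))%:E +
      C2%:E * (poisson 1 (x - y))%:E)%E by [].
  under eq_integral do rewrite e1.
  have mp e' : 0 < e' -> measurable_fun setT (fun y : R3 R => (poisson e' (x - y))%:E).
    move=> e'0; apply/measurable_EFinP; apply: measurable_translate.
    exact: continuous_measurable (continuous_poisson e'0).
  have p0 c e' y : 0 <= c -> 0 < e' -> (0 <= c%:E * (poisson e' (x - y))%:E)%E.
    by move=> c0 e'0; rewrite mule_ge0// lee_fin poisson_ge0.
  rewrite ge0_integralD//; last 4 first.
  - by move=> y _; exact: p0.
  - by apply: measurable_funeM; exact: mp.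
  - by move=> y _; exact: p0.
  - by apply: measurable_funeM; exact: mp.
  rewrite !ge0_integralZl//; last 4 first.
  - exact: mp.
  - by move=> y _; rewrite lee_fin poisson_ge0.
  - exact: mp.
  - by move=> y _; rewrite lee_fin poisson_ge0.
  rewrite /A mulrDl.
  have sc c v : 0 <= c -> (v <= (pi ^+ 3)%:E -> c%:E * v <= (c * pi ^+ 3)%:E :> \bar R)%E.
    by move=> c0 v3; rewrite EFinM; apply: lee_wpmul2l.
  rewrite [leRHS]EFinD; apply: leeD; apply: sc => //; exact: integral_poisson.
have kA' y : (\int[mu]_x (k (x - y))%:E <= A%:E)%E.
  by under eq_integral do rewrite /k poissonB (poissonB 1) -/(k _); exact: kA.
have sch L : continuous L -> measurable_fun X (convol L f) -> (forall x, `|L x| <= k x) ->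
    l2 mu X (convol L f) /\ inner mu X (convol L f) (convol L f) <= A ^+ 2 * inner mu setT f f.
  move=> cL mL Lk; apply: l2_of_le => //.
  apply: (@schur _ L k) => //; first exact: continuous_measurable.
apply: (@energy_bound _ _ _ mu X W) => //.
- by move=> i be ga; exact: energy_ibp.
- by apply: (sch (K o) _ _ K0_le).2; [exact: K_continuous|case: (W_l2 (al := o) isT)].
(* Schur's test has to act on the summed kernel [bilap K], where the cancellation takes place; term
   by term its bounds would not be uniform in [e]. *)
have eB : (fun x => \sum_(i < 3) \sum_(j < 3) W (inc i (inc i (inc j (inc j o)))) x) =
          convol (bilap K) f.
  have iK i j x : mu.-integrable setT
      (EFin \o (fun y => K (inc i (inc i (inc j (inc j o)))) (x - y) * f y)).
    by apply: K_int; rewrite !order3_inc.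
  apply/funext => x.
  have -> : convol (bilap K) f x = \sum_(i < 3)
      convol (fun z => \sum_(j < 3) K (inc i (inc i (inc j (inc j o)))) z) f x.
    apply: (convol_sum _).2 => i.
    by apply: (convol_sum (K := fun j => K (inc i (inc i (inc j (inc j o))))) _).1.
  apply: eq_bigr => i _; apply/esym.
  by apply: (convol_sum (K := fun j => K (inc i (inc i (inc j (inc j o))))) _).2.
have cK i j : continuous (K (inc i (inc i (inc j (inc j o))))).
  by apply: K_continuous; rewrite !order3_inc.
have cB : continuous (bilap K).
  by apply: continuous_sum => i; apply: continuous_sum => j; exact: cK.
rewrite /= eB; apply: (sch _ cB _ bilap_le).2.
rewrite -eB; apply: (l2_sum mX _).1 => i; apply: l2_sum => // j.
by apply: W_l2; rewrite !order3_inc.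
Qed.

End Energy.

(** * The cut-off distance *)

Section Cutoff.
Variable R : realType.
Implicit Types (f g : R -> R) (s t : R).

(** Class C^n on the open half-line, with derivatives given existentially: the chain of the cut-off
    distance then follows from closure properties, without formulas in the transition region. *)
Fixpoint Cpos n f : Prop :=
  match n with
  | 0 => forall s, 0 < s -> {for s, continuous f}
  | n1.+1 => exists2 f', forall s, 0 < s -> is_derive s (1 : R) f (f' s) & Cpos n1 f'
  end.

Lemma is_derive_continuous f s a : is_derive s (1 : R) f a -> {for s, continuous f}.
Proof. by move=> [df _]; apply/differentiable_continuous/derivable1_diffP. Qed.

Lemma Cpos_weaken n f : Cpos n.+1 f -> Cpos n f.
Proof.
elim: n f => [|n ih] f [f' df Cf']; last by exists f' => //; exact: ih.
by move=> s /df /is_derive_continuous.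
Qed.

Lemma Cpos_cst n (c : R) : Cpos n (fun=> c).
Proof.
elim: n c => [|n ih] c; first by move=> s _; exact: cvg_cst.
by exists (fun=> 0) => // s _; exact: derC.
Qed.

Lemma Cpos_id n : Cpos n id.
Proof.
case: n => [|n]; first by move=> s _; exact: cvg_id.
by exists (fun=> 1) => [s _|]; [exact: der_id|exact: Cpos_cst].
Qed.

Lemma CposD n f g : Cpos n f -> Cpos n g -> Cpos n (fun s => f s + g s).
Proof.
elim: n f g => [|n ih] f g.
  by move=> cf cg s s0; apply: cvgD; [exact: cf|exact: cg].
move=> [f' df cf'] [g' dg cg']; exists (fun s => f' s + g' s); last exact: ih.
by move=> s s0; exact: (derD (df s s0) (dg s s0)).
Qed.

Lemma CposM n f g : Cpos n f -> Cpos n g -> Cpos n (fun s => f s * g s).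
Proof.
elim: n f g => [|n ih] f g.
  by move=> cf cg s s0; apply: cvgM; [exact: cf|exact: cg].
move=> Cf Cg; have cf := Cpos_weaken Cf; have cg := Cpos_weaken Cg.
move: Cf Cg => [f' df cf'] [g' dg cg'].
exists (fun s => f' s * g s + f s * g' s).
  by move=> s s0; exact: (derM (df s s0) (dg s s0)).
by apply: CposD; exact: ih.
Qed.

Lemma CposV n : Cpos n (fun s => s^-1).
Proof.
elim: n => [|n ih].
  by move=> s s0; apply: cvgV; [rewrite gt_eqF|exact: cvg_id].
exists (fun s => -1 * (s^-1 * s^-1)).
  move=> s s0; have sn0 : s != 0 by rewrite gt_eqF.
  apply: der_eq (derV (f := id) sn0 (der_id s)) _.
  by rewrite /=; field.
by apply: CposM; [exact: Cpos_cst|exact: CposM].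
Qed.

(** A truncated power, of class C^(m-1) on the line for positive [m]. The energy method involves
    only five derivatives of the kernel, so finite smoothness is enough for a cut-off. *)
Definition pospow m t : R := Num.max 0 t ^+ m.

Lemma continuous_pospow m : continuous (pospow m).
Proof.
move=> t; apply: (@continuous_comp _ _ _ (fun t => Num.max 0 t) (fun t => t ^+ m)).
  by apply: continuous_max; [exact: cvg_cst|exact: cvg_id].
exact: exprn_continuous.
Qed.

Lemma pospow_gt0 m t : 0 < t -> pospow m t = t ^+ m.
Proof. by move=> t0; rewrite /pospow max_r// ltW. Qed.

Lemma pospow_le0 m t : t <= 0 -> pospow m.+1 t = 0.
Proof. by move=> t0; rewrite /pospow max_l// expr0n. Qed.

Lemma is_derive_pospow m t :
  is_derive t (1 : R) (pospow m.+2) (m.+2%:R * pospow m.+1 t).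
Proof.
have [t0|t0|->] := ltgtP t 0.
- rewrite pospow_le0 ?ltW// mulr0.
  apply: near_eq_is_derive (derC 0 t (1 : R)).
  by apply: filterS (lt_nbhsl t0) => u /ltW u0; rewrite pospow_le0.
- rewrite pospow_gt0//.
  have := derX m.+2 (der_id t); rewrite mulr1 => d.
  apply: near_eq_is_derive d.
  by apply: filterS (lt_nbhsr t0) => u u0; rewrite pospow_gt0.
(* At 0 the slope function in Caratheodory's criterion is again a truncated power, one degree
   lower. *)
- rewrite pospow_le0// mulr0; apply/is_derive1_caratheodory.
  exists (pospow m.+1); split.
  + move=> z; rewrite [pospow _ 0]pospow_le0// !subr0.
    have [z0|z0] := leP z 0; first by rewrite !pospow_le0// mul0r.
    by rewrite !pospow_gt0// exprSr.
  + exact: continuous_pospow.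
  + by rewrite pospow_le0.
Qed.

Lemma Cpos_pospow m n g : (n <= m)%N -> Cpos n g ->
  Cpos n (fun s => pospow m.+1 (g s)).
Proof.
elim: n m g => [|n ih] m g nm.
  by move=> cg s s0; apply: continuous_comp; [exact: cg|exact: continuous_pospow].
move=> Cg; have cg := Cpos_weaken Cg; move: Cg => [g' dg cg'].
case: m nm => // m nm.
exists (fun s => m.+2%:R * pospow m.+1 (g s) * g' s).
  by move=> s s0; exact: (der1_comp (is_derive_pospow m (g s)) (dg s s0)).
by apply: CposM => //; apply: CposM; [exact: Cpos_cst|exact: ih].
Qed.

Lemma Cpos_chain n f : Cpos n f -> exists2 F, F 0%N = f & chain n F.
Proof.
elim: n f => [|n ih] f.
  move=> cf; exists (fun=> f) => // p s s0; split => // _.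
  exact: cf.
move=> Cf; have cf := Cpos_weaken Cf; move: Cf => [f' df cf'].
have [G G0 cG] := ih _ (CposM cf' (CposV n)).
exists (fun q => if q is q1.+1 then G q1 else f) => // -[|p] s s0.
  split=> _; last exact: is_derive_continuous (df s s0).
  by apply: der_eq (df s s0) _; rewrite G0 mulrCA divff ?mulr1// gt_eqF.
by have [c1 c2] := cG p s s0; split; rewrite ltnS.
Qed.

Lemma chain_local N F q (h h1 : R -> R) a b : chain N F -> (q < N)%N -> 0 <= a ->
  (forall s, a < s < b -> F q s = h s) ->
  (forall s, a < s < b -> is_derive s (1 : R) h (s * h1 s)) ->
  forall s, a < s < b -> F q.+1 s = h1 s.
Proof.
move=> cF qN a0 Fh dh s /andP[s1 s2].
have s0 : 0 < s by exact: le_lt_trans s1.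
have [/(_ qN) d _] := cF q s s0.
have d2 : is_derive s (1 : R) h (s * F q.+1 s).
  apply: near_eq_is_derive d; near=> u; apply: Fh; apply/andP; split; near: u.
    exact: lt_nbhsr.
  exact: lt_nbhsl.
have := dh s; rewrite s1 s2 => /(_ isT) [_ e1]; case: d2 => _.
by rewrite e1 => /(mulfI (lt0r_neq0 s0)).
Unshelve. all: by end_near. Qed.

Lemma is_derive_exprNn s n : 0 < s ->
  is_derive s (1 : R) (fun s => s ^- n) (- n%:R * s ^- n.+1).
Proof.
move=> s0; have h : s ^+ n != 0 by rewrite expf_neq0// gt_eqF.
have d : is_derive s (1 : R) (fun s => s ^+ n) (n%:R * s ^+ n.-1).
  by apply: der_eq (derX n (der_id s)) _; rewrite mulr1.
have d2 := derV (f := fun s => s ^+ n) h d.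
apply: der_eq d2 _.
case: n {h d} => [|n]; first by rewrite /= !mul0r !oppr0 !mul0r.
have sn : s != 0 by rewrite gt_eqF.
have tn : s ^+ n != 0 by rewrite expf_neq0.
by rewrite /= !exprS; field; rewrite ?tn ?sn.
Qed.

Lemma cutoff_chain (s0 : R) : 0 < s0 ->
  exists S M F, [/\ [/\ 0 < S, 0 <= M & chain 5 F],
    forall q s, (q <= 5)%N -> S <= s -> F q s = 0,
    forall s, 0 < s -> s < s0 -> [/\ F 0%N s = s, F 2 s = - s ^- 3,
      F 3 s = 3 * s ^- 5 & F 4 s = - (15 * s ^- 7)],
    forall q s, (q <= 4)%N -> s0 <= s -> 0 < s -> `|F q s| <= M &
    forall s, 0 < s -> `|F 0%N s| <= M].
Proof.
move=> s00.
(* A cut-off function built from two truncated powers. For [s < s0] the inner argument exceeds 1,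
   the outer one is at most 0 and [chi = 1]; for [s >= s0 + 1] the inner power vanishes and
   [chi = 0]. The exponent six gives class C^5. *)
pose chi s : R := 1 - pospow 6 (1 - pospow 6 (s0 + 1 - s)).
have Cchi : Cpos 5 (fun s => s * chi s).
  apply: CposM; first exact: Cpos_id.
  have CposN f : Cpos 5 f -> Cpos 5 (fun s => 1 - f s).
    move=> Cf; have -> : (fun s => 1 - f s) = (fun s => 1 + (-1) * f s).
      by apply/funext => s; rewrite mulN1r.
    by apply: CposD; [exact: Cpos_cst|apply: CposM; [exact: Cpos_cst|]].
  apply: (CposN _); apply: Cpos_pospow => //; apply: (CposN _); apply: Cpos_pospow => //.
  apply: CposD; first exact: Cpos_cst.
  have -> : -%R = (fun s : R => (-1) * s) by apply/funext => s; rewrite mulN1r.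
  by apply: CposM; [exact: Cpos_cst|exact: Cpos_id].
have [F F0 cF] := Cpos_chain Cchi.
have chi_near s : s < s0 -> chi s = 1.
  move=> ss0; rewrite /chi [X in _ - X]pospow_le0 ?subr0//.
  rewrite pospow_gt0; last lra.
  by rewrite subr_le0 exprn_ege1//; lra.
have chi_far s : s0 + 1 <= s -> chi s = 0.
  move=> ss0; rewrite /chi (@pospow_le0 5 (s0 + 1 - s)); last lra.
  by rewrite subr0 /pospow max_r ?ler01// expr1n subrr.
have Ffar q s : (q <= 5)%N -> s0 + 1 < s -> F q s = 0.
  move=> + ss; elim: q s ss => [|q ih] s ss q5; first by rewrite F0 chi_far ?mulr0// ltW.
  apply: (@chain_local 5 F q (fun=> 0) (fun=> 0) (s0 + 1) (s + 1)) => //.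
  - by rewrite addr_ge0 ?ltW.
  - by move=> u /andP[u1 _]; apply: ih => //; exact: ltnW.
  - by move=> u _; rewrite mulr0; exact: derC.
  - by rewrite ss ltrDl ltr01.
have near0 s : 0 < s < s0 -> F 0 s = s.
  by move=> /andP[_ s1]; rewrite F0 chi_near// mulr1.
have near1 s : 0 < s < s0 -> F 1 s = s ^- 1.
  apply: (@chain_local 5 F 0 id) => // u /andP[u0 _].
  by apply: der_eq (der_id u) _; rewrite divff// gt_eqF.
(* Applying [(1/s) d/ds] to [c s^-n] gives [-n c s^-(n+2)]; starting from [s^-1], the coefficients
   become -1, 3 and -15. *)
have step q n c : (q < 5)%N -> (forall s, 0 < s < s0 -> F q s = c * s ^- n) ->
    forall s, 0 < s < s0 -> F q.+1 s = (- n%:R * c) * s ^- n.+2.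
  move=> q5 hq; apply: (@chain_local 5 F q (fun s => c * s ^- n)) => // u /andP[u0 _].
  apply: der_eq (derZ c (is_derive_exprNn n u0)) _.
  have un : u != 0 by rewrite gt_eqF.
  have tn : u ^+ n != 0 by rewrite expf_neq0.
  by rewrite !exprS; field; rewrite ?tn ?un.
have near1' s : 0 < s < s0 -> F 1 s = 1 * s ^- 1 by move=> /near1 ->; rewrite mul1r.
have near2 := step 1%N 1%N 1 isT near1'.
have near3 := step 2%N 3%N _ isT near2.
have near4 := step 3%N 5%N _ isT near3.
have bnd q : (q <= 5)%N -> exists2 M, 0 <= M & forall s, s0 <= s -> `|F q s| <= M.
  move=> q5.
  have cFq : {within `[s0, s0 + 2], continuous (F q)}.
    apply: continuous_in_subspaceT => u /set_mem; rewrite /= in_itv/= => /andP[u1 _].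
    by have [_ c] := cF q u (lt_le_trans s00 u1); exact: c.
  have := continuous_compact cFq (@segment_compact R s0 (s0 + 2)).
  move=> /compact_bounded[M [_ hM]]; exists (`|M| + 1); first by rewrite addr_ge0.
  move=> s s1; have [s2|s2] := leP s (s0 + 2); last first.
    by rewrite Ffar// ?normr0 ?addr_ge0//; lra.
  apply: (hM (`|M| + 1)); first by rewrite (le_lt_trans (ler_norm _))// ltrDl.
  by exists s => //; rewrite /= in_itv/= s1.
have [M0 M00 h0] := bnd 0%N isT; have [M1 M10 h1] := bnd 1%N isT.
have [M2 M20 h2] := bnd 2%N isT; have [M3 M30 h3] := bnd 3%N isT.
have [M4 M40 h4] := bnd 4%N isT.
(* [Ffar] asks for a strict inequality with [s0 + 1], hence the margin; the summand [s0] bounds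
   [F 0 s = s] near the origin. *)
exists (s0 + 2), (M0 + M1 + M2 + M3 + M4 + s0), F; split.
- by split => //; lra.
- by move=> q s q5 ss; apply: Ffar => //; lra.
- move=> s sp ss; have ss' : 0 < s < s0 by rewrite sp.
  rewrite near0// near2// near3// near4//; split => //; ring.
- move=> [|[|[|[|[|//]]]]] s _ ss _.
  + by have := h0 s ss; lra.
  + by have := h1 s ss; lra.
  + by have := h2 s ss; lra.
  + by have := h3 s ss; lra.
  + by have := h4 s ss; lra.
- move=> s sp; have [ss|ss] := ltP s s0; last by have := h0 s ss; lra.
  by rewrite near0 ?sp// ger0_norm ?ltW//; lra.
Qed.

End Cutoff.

(** * Weak derivatives *)

Section SmoothProducts.
Variable R : realType.
Implicit Types (f g : R3 R -> R) (s : seq 'I_3) (i : 'I_3).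

(** Smoothness up to a finite order, so that stability under products can be proved by induction on
    the order. *)
Definition smoothn n f : Prop :=
  forall s, (size s <= n)%N -> forall x, differentiable (partials s f) x.

Lemma partials_rcons s i f : partials (rcons s i) f = partials s ('D_(basis3 R i) f).
Proof. by rewrite /partials foldr_rcons. Qed.

Lemma partialsD n f g s : smoothn n f -> smoothn n g -> (size s <= n.+1)%N ->
  partials s (f \+ g) = partials s f \+ partials s g.
Proof.
move=> sf sg; elim: s => [//|i s ih] /= sn.
rewrite [in LHS]/partials /= -/(partials s (f \+ g)) ih ?(ltnW sn)//.
apply/funext => x /=.
by rewrite (deriveD (f := partials s f) (g := partials s g)) //;
  apply: diff_derivable; [exact: sf|exact: sg].
Qed.

Lemma smoothnD n f g : smoothn n f -> smoothn n g -> smoothn n (f \+ g).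
Proof.
move=> sf sg s sn x; rewrite (partialsD sf sg) ?(leq_trans sn)//.
by apply: differentiableD; [exact: sf|exact: sg].
Qed.

Lemma smoothnS n f i : smoothn n.+1 f -> smoothn n ('D_(basis3 R i) f).
Proof. by move=> sf s sn x; rewrite -partials_rcons; apply: sf; rewrite size_rcons. Qed.

Lemma smoothn_weaken n f : smoothn n.+1 f -> smoothn n f.
Proof. by move=> sf s sn; apply: sf; exact: leqW. Qed.

Lemma deriveM_fun f g i : smoothn 0 f -> smoothn 0 g ->
  'D_(basis3 R i) (f \* g) =
  (f \* 'D_(basis3 R i) g) \+ ('D_(basis3 R i) f \* g).
Proof.
move=> sf sg; apply/funext => x /=.
rewrite (deriveM (f := f) (g := g)); try by apply: diff_derivable; [exact: (sf [::])|..].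
  by rewrite /GRing.scale /= [g x * _]mulrC.
by apply: diff_derivable; exact: (sg [::]).
Qed.

Lemma smoothnM n f g : smoothn n f -> smoothn n g -> smoothn n (f \* g).
Proof.
have base f' g' : smoothn 0 f' -> smoothn 0 g' -> forall x, differentiable (f' \* g') x.
  by move=> sf sg x; apply: differentiableM; [exact: (sf [::])|exact: (sg [::])].
elim: n f g => [|n ih] f g sf sg.
  by move=> s; rewrite leqn0 size_eq0 => /eqP -> x; exact: base.
have w m f' : smoothn m f' -> smoothn 0 f'.
  by move=> sf' s; rewrite leqn0 => /eqP s0; apply: sf'; rewrite s0.
(* The last letter is the derivative applied first; splitting it off by the product rule leaves a
   sum of two products of one order less. *)
move=> s; case/lastP: s => [_ x|s i]; first by apply: base; [exact: w sf|exact: w sg].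
rewrite size_rcons ltnS => sn x; rewrite partials_rcons deriveM_fun; [|exact: w sf|exact: w sg].
apply: (smoothnD _ _ sn); apply: ih; (try exact: smoothn_weaken); exact: smoothnS.
Qed.

Lemma smoothP f : smooth f <-> forall n, smoothn n f.
Proof.
by split => [sf n s _|sf s x]; [exact: sf|exact: (sf (size s))].
Qed.

Lemma Cc_infty_supp D f g : Cc_infty D f -> smooth g ->
  (forall x, g x != 0 -> closure [set x | f x != 0] x) -> Cc_infty D g.
Proof.
move=> [sf cf fD] sg gf.
have sub : closure [set x | g x != 0] `<=` closure [set x | f x != 0].
  rewrite [X in _ `<=` X]((closure_id _).1 (@closed_closure _ [set x | f x != 0])).
  by apply: closure_subset => y; exact: gf.
split => //; last exact: subset_trans fD.
by apply: subclosed_compact cf _ => //; exact: closed_closure.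
Qed.

Lemma Cc_infty_mul D f g : Cc_infty D f -> smooth g -> Cc_infty D (f \* g).
Proof.
move=> cf sg; have [/smoothP sf _ _] := cf; move/smoothP : sg => sg.
apply: Cc_infty_supp cf _ _.
  by apply/smoothP => n; exact: smoothnM.
by move=> x; rewrite /= mulf_eq0 negb_or => /andP[fx _]; exact: subset_closure.
Qed.

Lemma smooth_derive f i : smooth f -> smooth ('D_(basis3 R i) f).
Proof. by move=> sf s x; rewrite -partials_rcons; exact: sf. Qed.

Lemma smooth_is_derive f i x : smooth f ->
  is_derive x (basis3 R i) f ('D_(basis3 R i) f x).
Proof. by move=> sf; split => //; apply: diff_derivable; exact: (sf [::]). Qed.

Lemma smooth_continuous f : smooth f -> continuous f.
Proof. by move=> sf x; apply: differentiable_continuous; exact: (sf [::]). Qed.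

Lemma Cc_infty_derive D f i : Cc_infty D f -> Cc_infty D ('D_(basis3 R i) f).
Proof.
move=> cf; have [sf _ _] := cf; apply: Cc_infty_supp cf (smooth_derive i sf) _ => x.
apply: contraNP => xf; apply/eqP.
have : is_derive x (basis3 R i) (cst 0 : R3 R -> R) ('D_(basis3 R i) f x).
  apply: near_eq_is_derive (smooth_is_derive i x sf).
  have : nbhs x (~` closure [set x | f x != 0]).
    by apply: open_nbhs_nbhs; split => //; apply: closed_openC; exact: closed_closure.
  apply: filterS => y yA; apply/eqP/negPn/negP => fy; apply: yA.
  exact: subset_closure.
by case=> _ <-; rewrite derive_cst.
Qed.

Lemma Cc_infty_vanish D f : Cc_infty D f -> exists A, vanish_off A f.
Proof.
move=> [_ cf _]; set Kf := closure _ in cf.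
have /choice[M hM] : forall i : 'I_3, exists M : R, forall x, Kf x -> `|proj3 i x| <= M.
  move=> i; have : compact (proj3 i @` Kf).
    by apply: continuous_compact cf; apply: continuous_subspaceT; exact: continuous_proj3.
  move=> /compact_bounded[M [_ hM]]; exists (`|M| + 1) => x Kx.
  apply: (hM (`|M| + 1)); last by exists x.
  by rewrite (le_lt_trans (ler_norm _))// ltrDl.
exists (\sum_i `|M i|) => x xA; apply/eqP/negPn/negP => fx; apply: xA.
apply/cubeP => i; have Kx : Kf x by exact: subset_closure.
rewrite (le_trans (hM i x Kx))// (le_trans (ler_norm _))//.
by rewrite (bigD1 i)//= lerDl sumr_ge0.
Qed.

Lemma Cc_infty_off D f x : Cc_infty D f -> ~ D x -> f x = 0.
Proof.
move=> [_ _ fD] xD; apply/eqP/negPn/negP => fx; apply: xD; apply: fD.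
exact: subset_closure.
Qed.

End SmoothProducts.

Section SobolevTree.
Variable R : realType.
Notation mu := (@mu3 R).
Variable D : set (R3 R).
Hypotheses (mD : measurable D) (muD : (mu D < +oo)%E).
Implicit Types (u v w rho phi psi : R3 R -> R) (i : 'I_3) (n : nat) (Q : R).
Local Notation l2 := (l2 mu D).
Local Notation inner := (inner mu D).

Definition weak_partial i u w : Prop :=
  forall psi, Cc_infty D psi -> inner u ('D_(basis3 R i) psi) = - inner w psi.

(** A tree of iterated weak derivatives: every inner node has weak derivatives in the three
    directions, and every node has squared norm at most [Q]. Nodes reached by permuted directions
    are not identified; each is found along its own path. *)
Fixpoint sobolev n Q v : Prop :=
  (l2 v /\ inner v v <= Q) /\
  (if n is n1.+1 then forall i, exists2 w, weak_partial i v w & sobolev n1 Q w else True).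

Lemma sobolev_l2 n Q v : sobolev n Q v -> l2 v /\ inner v v <= Q.
Proof. by case: n => [|n] []. Qed.

Lemma sobolev_weaken n Q v : sobolev n.+1 Q v -> sobolev n Q v.
Proof.
elim: n v => [|n ih] v [lv hv]; first by split.
by split => // i; have [w iw /ih hw] := hv i; exists w.
Qed.

Lemma sobolev_le n Q Q' v : Q <= Q' -> sobolev n Q v -> sobolev n Q' v.
Proof.
move=> QQ; elim: n v => [|n ih] v [[lv vQ] hv]; split;
  (try by split => //; exact: le_trans vQ QQ) => //.
by move=> i; have [w iw /ih hw] := hv i; exists w.
Qed.

Lemma Cc_infty_l2 phi : Cc_infty D phi -> l2 phi.
Proof.
move=> cphi; have [A vA] := Cc_infty_vanish cphi.
have cf := smooth_continuous (let: And3 s _ _ := cphi in s).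
have [M [M0 hM]] := bounded_on_cube A cf.
apply: (@l2_bounded _ _ _ _ _ _ M) => //.
  by apply: measurable_funTS; exact: continuous_measurable.
move=> x _; have [xA|/vA ->] := pselect (cube A x); first exact: hM.
by rewrite normr0.
Qed.

Lemma sobolevD n Q Q' u v : sobolev n Q u -> sobolev n Q' v ->
  sobolev n (2 * (Q + Q')) (fun x => u x + v x).
Proof.
elim: n u v => [|n ih] u v [[lu uQ] hu] [[lv vQ] hv]; split => //; last first.
  move=> i; have [u' iu su] := hu i; have [v' iv sv] := hv i.
  exists (fun x => u' x + v' x); last exact: ih.
  move=> psi cpsi; have lp := Cc_infty_l2 cpsi.
  have lpi := Cc_infty_l2 (Cc_infty_derive i cpsi).
  have [lu' _] := sobolev_l2 su; have [lv' _] := sobolev_l2 sv.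
  by rewrite !innerDl// iu// iv// opprD.
all: split; first exact: l2D.
all: rewrite innerDl ?innerDr//; [|exact: l2D..].
all: have := inner_young mD lu lv; have := ler_norm (inner u v).
all: by rewrite (innerC _ _ v u); lra.
Qed.

Lemma sobolevZ n Q c v : sobolev n Q v -> sobolev n (c ^+ 2 * Q) (fun x => c * v x).
Proof.
elim: n v => [|n ih] v [[lv vQ] hv]; split => //; last first.
  move=> i; have [v' iv sv] := hv i; exists (fun x => c * v' x); last exact: ih.
  move=> psi cpsi; have lp := Cc_infty_l2 cpsi.
  have lpi := Cc_infty_l2 (Cc_infty_derive i cpsi).
  have [lv' _] := sobolev_l2 sv.
  by rewrite !innerZl// iv// mulrN.
all: split; first exact: l2Z.
all: rewrite innerZl ?innerZr//; [|exact: l2Z..].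
all: by rewrite mulrA -expr2 ler_wpM2l ?sqr_ge0.
Qed.

Lemma l2_bounded_mul rho v (B : R) : measurable_fun D rho ->
  (forall x, D x -> `|rho x| <= B) -> l2 v -> l2 (fun x => rho x * v x) /\
  inner (fun x => rho x * v x) (fun x => rho x * v x) <= B ^+ 2 * inner v v.
Proof.
move=> mr rB lv; have [mv iv] := lv.
have rB2 x : D x -> rho x ^+ 2 <= B ^+ 2.
  move=> Dx; rewrite -[rho x ^+ 2]real_normK ?num_real// ler_sqr ?nnegrE ?rB//.
  by rewrite (le_trans _ (rB x Dx)).
have i2 : mu.-integrable D (EFin \o (fun x => B ^+ 2 * v x ^+ 2)).
  exact: integrableRZ.
have lr : l2 (fun x => rho x * v x).
  split; first exact: measurable_funM.
  apply: (integrable_dominated _ _ _ i2) => //.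
    by apply: measurable_funX; exact: measurable_funM.
  move=> x Dx; rewrite ger0_norm ?sqr_ge0// exprMn ler_wpM2r ?sqr_ge0//.
  exact: rB2.
split => //.
have -> : B ^+ 2 * inner v v = \int[mu]_(x in D) (B ^+ 2 * (v x * v x)).
  by rewrite (RintegralZl _ mD (l2M mD lv lv)).
apply: le_Rintegral => //; first exact: (l2M mD lr lr).
by move=> x Dx; rewrite mulrACA -!expr2 ler_wpM2r ?sqr_ge0// rB2.
Qed.

(** The weak Leibniz rule, obtained by testing the derivative of [v] against [rho psi]. The constant
    is chosen before [Q] and [v]. *)
Lemma sobolevM n rho : Cc_infty D rho -> exists2 C, 0 <= C &
  forall Q v, 0 <= Q -> sobolev n Q v -> sobolev n (C * Q) (fun x => rho x * v x).
Proof.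
elim: n rho => [|n ih] rho crho.
all: have [A rA] := Cc_infty_vanish crho.
all: have crho' := smooth_continuous (let: And3 s _ _ := crho in s).
all: have [B [B0 hB]] := bounded_on_cube A crho'.
all: have mrho : measurable_fun D rho by apply: measurable_funTS; exact: continuous_measurable.
all: have rB x : D x -> `|rho x| <= B by
  move=> _; have [xA|/rA ->] := pselect (cube A x); [exact: hB|rewrite normr0].
  exists (B ^+ 2); first exact: sqr_ge0.
  move=> Q v Q0 [[lv vQ] _]; split => //.
  have [l1 l2'] := l2_bounded_mul mrho rB lv; split => //.
  by rewrite (le_trans l2')// ler_wpM2l ?sqr_ge0.
have [C0 C00 h0] := ih _ crho.
have /choice[C hC] : forall i, exists C, 0 <= C /\ forall Q v, 0 <= Q -> sobolev n Q v ->
    sobolev n (C * Q) (fun x => 'D_(basis3 R i) rho x * v x).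
  by move=> i; have [C C1 h1] := ih _ (Cc_infty_derive i crho); exists C.
have C0' i : 0 <= C i by case: (hC i).
exists (B ^+ 2 + \sum_i 2 * (C0 + C i)).
  by rewrite addr_ge0 ?sqr_ge0 ?sumr_ge0// => i _; rewrite mulr_ge0// addr_ge0.
move=> Q v Q0 sv; have [[lv vQ] hv] := sv.
have [l1 l2'] := l2_bounded_mul mrho rB lv; split.
  split => //; apply: (le_trans l2'); rewrite mulrDl.
  apply: (@le_trans _ _ (B ^+ 2 * Q)); first by rewrite ler_wpM2l ?sqr_ge0.
  rewrite lerDl mulr_ge0// sumr_ge0// => i _.
  by rewrite mulr_ge0// addr_ge0.
move=> i; have [w iw sw] := hv i.
exists (fun x => rho x * w x + 'D_(basis3 R i) rho x * v x); last first.
  have [_ hCi] := hC i.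
  have := sobolevD (h0 _ _ Q0 sw) (hCi _ _ Q0 (sobolev_weaken sv)).
  apply: sobolev_le; rewrite (bigD1 i)//= -mulrDl mulrA ler_wpM2r//.
  have h : 0 <= \sum_(j < 3 | j != i) 2 * (C0 + C j).
    by rewrite sumr_ge0// => j _; rewrite mulr_ge0// addr_ge0.
  by have := sqr_ge0 B; lra.
move=> psi cpsi.
have [srho _ _] := crho; have [spsi _ _] := cpsi.
have crp : Cc_infty D (rho \* psi) by apply: Cc_infty_mul.
have crdp : Cc_infty D ('D_(basis3 R i) rho \* psi).
  exact: (Cc_infty_mul (Cc_infty_derive i crho)).
have crpd : Cc_infty D (rho \* 'D_(basis3 R i) psi).
  exact: (Cc_infty_mul crho (smooth_derive i spsi)).
have := iw _ crp.
rewrite deriveM_fun; [|by move/smoothP: srho|by move/smoothP: spsi].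
have lv1 := Cc_infty_l2 crdp; have lv2 := Cc_infty_l2 crpd.
have lw := (sobolev_l2 sw).1.
rewrite [inner v (_ \+ _)]innerDr// => e.
have e1 : inner (fun x => rho x * v x) ('D_(basis3 R i) psi) =
          inner v (rho \* 'D_(basis3 R i) psi).
  by apply: eq_Rintegral => x _ /=; ring.
have ldr : l2 (fun x => 'D_(basis3 R i) rho x * v x).
  have [_ hCi] := hC i.
  by have [] := sobolev_l2 (hCi _ _ Q0 (sobolev_weaken sv)).
have lrw : l2 (fun x => rho x * w x) by have [] := sobolev_l2 (h0 _ _ Q0 sw).
rewrite e1 innerDl//; last exact: Cc_infty_l2.
have -> : inner (fun x => rho x * w x) psi = inner w (rho \* psi).
  by apply: eq_Rintegral => x _ /=; ring.
have -> : inner (fun x => 'D_(basis3 R i) rho x * v x) psi =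
          inner v ('D_(basis3 R i) rho \* psi).
  by apply: eq_Rintegral => x _ /=; ring.
by move: e; lra.
Qed.

Lemma Cc_infty_partials s phi : Cc_infty D phi -> Cc_infty D (partials s phi).
Proof. by elim: s => // i s ih cphi; apply: Cc_infty_derive; exact: ih. Qed.

Lemma sobolev_partials n Q v s : sobolev n Q v -> (size s <= n)%N ->
  exists2 w, l2 w /\ inner w w <= Q &
    forall phi, Cc_infty D phi -> inner v (partials s phi) = (-1) ^+ size s * inner w phi.
Proof.
elim: s n v => [|i s ih] n v sv.
  by move=> _; exists v; [exact: sobolev_l2 sv|move=> phi _; rewrite expr0 mul1r].
case: n sv => // n [_ hv] /= sn; have [w iw sw] := hv i.
have [g lg hg] := ih _ _ sw sn; exists g => // phi cphi.
rewrite iw; last exact: Cc_infty_partials.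
by rewrite hg// exprS mulN1r mulNr.
Qed.

(** Uniform convergence identifies the limits of the pairings: the derivative of [vm m] paired with
    [phi] is, up to sign, [vm m] paired with a derivative of [phi]. Weak compactness, indexed by all
    test functions, then produces the derivative of [v] along the path [s], with the same bound
    [Q]. *)
Lemma sobolev_limit n Q v (vm : nat -> R3 R -> R) (e : nat -> R) s :
  (forall m, sobolev n Q (vm m)) -> (forall m x, D x -> `|vm m x - v x| <= e m) ->
  e @ \oo --> 0 -> (size s <= n)%N ->
  l2 v /\ exists2 w, l2 w /\ inner w w <= Q &
    forall phi, Cc_infty D phi -> inner v (partials s phi) = (-1) ^+ size s * inner w phi.
Proof.
move=> svm ve e0 sn.
have lvm m : l2 (vm m) by have [] := sobolev_l2 (svm m).
have mv : measurable_fun D v.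
  apply: (@measurable_fun_cvg _ _ _ _ vm) => [m|x Dx]; first by case: (lvm m).
  apply/cvgrPdist_le => eps eps0; move/cvgrPdist_le : e0 => /(_ _ eps0).
  apply: filterS => m; rewrite sub0r normrN => he.
  by rewrite distrC (le_trans (ve m x Dx))// (le_trans (ler_norm _)).
have lvd m : l2 (fun x => vm m x - v x).
  apply: (@l2_bounded _ _ _ _ _ _ (e m)) => //; last exact: ve.
  by apply: measurable_funB => //; case: (lvm m).
have lv : l2 v.
  have -> : v = (fun x => vm 0%N x - (vm 0%N x - v x)) by apply/funext => x; ring.
  exact: l2B.
split => //.
have /choice[w hw] : forall m, exists w, (l2 w /\ inner w w <= Q) /\
    forall phi, Cc_infty D phi ->
      inner (vm m) (partials s phi) = (-1) ^+ size s * inner w phi.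
  by move=> m; have [w lw h] := sobolev_partials (svm m) sn; exists w.
pose I := {phi | Cc_infty D phi}.
have [| | | |g lg hg] := weak_compactness mD muD (I := I) (phi := fun q => sval q)
  (L := fun q => (-1) ^+ size s * inner v (partials s (sval q))) (w := w) (Q := Q).
- by move=> [phi cphi]; exact: Cc_infty_l2.
- by move=> m; case: (hw m) => [[]].
- by move=> m; case: (hw m) => [[]].
- move=> [phi cphi] /=; set p := partials s phi.
  have cp : Cc_infty D p by exact: Cc_infty_partials.
  have lp := Cc_infty_l2 cp.
  have sgn2 : (-1) ^+ size s * (-1) ^+ size s = 1 :> R.
    by rewrite -expr2 sqrr_sign.
  have -> : (fun m => inner (w m) phi) = (fun m => (-1) ^+ size s * inner (vm m) p).
    by apply/funext => m; have [_ ->] := hw m; rewrite // mulrA sgn2 mul1r.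
  apply: cvgM; first exact: cvg_cst.
  have l1 : l2 (fun=> 1).
    by apply: (@l2_bounded _ _ _ _ _ _ 1) => // x _; rewrite normr1.
  have ip : mu.-integrable D (EFin \o p).
    by apply: (integrableE _ _ (l2M mD lp l1)) => // x _; rewrite mulr1.
  set c := \int[mu]_(x in D) `|p x|.
  have c0 : 0 <= c by apply: Rintegral_ge0.
  apply/cvgrPdist_le => eps eps0.
  have eps' : 0 < eps / (c + 1) by rewrite divr_gt0// ltr_wpDl.
  move/cvgrPdist_le : e0 => /(_ _ eps'); apply: filterS => m.
  rewrite sub0r normrN => he.
  have em : 0 <= `|e m| by [].
  rewrite distrC -innerBl//.
  apply: le_trans (le_normr_Rintegral mD (l2M mD (lvd m) lp)) _.
  apply: (@le_trans _ _ (`|e m| * c)).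
    rewrite /c -RintegralZl//; last exact: integrable_norm.
    apply: le_Rintegral => //; first exact: (integrable_norm (l2M mD (lvd m) lp)).
      by apply: integrableRZ => //; exact: integrable_norm.
    move=> x Dx; rewrite normrM ler_wpM2r// (le_trans (ve m x Dx))//.
    exact: ler_norm.
  apply: (@le_trans _ _ (eps / (c + 1) * c)); first by rewrite ler_wpM2r.
  rewrite mulrAC -mulrA ler_piMr ?(ltW eps0)// ler_pdivrMr ?ltr_wpDl//.
  by rewrite mul1r lerDl.
exists g => // phi cphi; rewrite (hg (exist _ phi cphi)) /= mulrA -expr2 sqrr_sign.
by rewrite mul1r.
Qed.

End SobolevTree.

(** * Integral operators with a radial kernel on a ball *)

Section Ball.
Variable R : realType.
Notation mu := (@mu3 R).
Implicit Types (x y z : R3 R) (rad e : R).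

Lemma enorm_regnorm x : enorm x = regnorm 0 x.
Proof. by rewrite enormE /regnorm expr0n addr0. Qed.

Lemma enorm_sqr x : enorm x ^+ 2 = sqnorm x.
Proof. by rewrite enorm_regnorm regnorm_sqr expr0n addr0. Qed.

Lemma enorm_ge0 x : 0 <= enorm x.
Proof. by rewrite enormE sqrtr_ge0. Qed.

Lemma regnorm_enorm e x : 0 <= e -> enorm x <= regnorm e x <= enorm x + e.
Proof.
move=> e0; have r0 : 0 <= regnorm e x by exact: sqrtr_ge0.
have n0 := enorm_ge0 x; have e2 : 0 <= e ^+ 2 by exact: sqr_ge0.
have ne : 0 <= enorm x * e by exact: mulr_ge0.
apply/andP; split.
  by rewrite -ler_sqr ?nnegrE// regnorm_sqr enorm_sqr lerDl.
rewrite -ler_sqr ?nnegrE ?addr_ge0// regnorm_sqr -enorm_sqr sqrrD.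
rewrite -mulr_natr; lra.
Qed.

Lemma continuous_enorm : continuous (@enorm R).
Proof.
have -> : @enorm R = regnorm 0 by apply/funext => x; exact: enorm_regnorm.
exact: continuous_regnorm.
Qed.

Lemma measurable_eball rad : measurable (@eball R rad).
Proof.
have -> : @eball R rad = setT `&` @enorm R @^-1` `]-oo, rad[.
  by rewrite setTI; apply/seteqP; split => x /=; rewrite in_itv.
by apply: (continuous_measurable continuous_enorm).
Qed.

Lemma eball_cube rad : eball rad `<=` @cube R rad.
Proof.
move=> x xr; apply/cubeP => i.
have := proj3_le_regnorm 0 i x; rewrite -enorm_regnorm.
by move=> h; apply: (le_trans h); exact: ltW.
Qed.

Lemma mu_eball rad : (mu (eball rad) < +oo)%E.
Proof.
apply: le_lt_trans (mu3_cube rad); apply: le_measure; rewrite ?inE.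
- exact: measurable_eball.
- exact: measurable_cube.
- exact: eball_cube.
Qed.

Lemma enormB_eball rad x y : eball rad x -> eball rad y -> enorm (x - y) < 2 * rad.
Proof.
rewrite /eball /= => xr yr.
have x0 := enorm_ge0 x; have y0 := enorm_ge0 y.
have r0 : 0 < rad by exact: le_lt_trans xr.
have xr2 : enorm x ^+ 2 < rad ^+ 2 by rewrite ltr_sqr ?nnegrE// ltW.
have yr2 : enorm y ^+ 2 < rad ^+ 2 by rewrite ltr_sqr ?nnegrE// ltW.
rewrite -ltr_sqr ?nnegrE ?enorm_ge0 ?mulr_ge0 ?(ltW r0)//.
move: xr2 yr2; rewrite !enorm_sqr /sqnorm /=.
have := sqr_ge0 (x.1.1 + y.1.1); have := sqr_ge0 (x.1.2 + y.1.2).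
have := sqr_ge0 (x.2 + y.2); nra.
Qed.

Lemma vanish_off_eball rad (F : R3 R -> R) : (forall x, ~ eball rad x -> F x = 0) ->
  vanish_off rad F.
Proof. by move=> FD x xA; apply: FD => /eball_cube. Qed.

End Ball.

Section ConvolLinear.
Variable R : realType.
Notation mu := (@mu3 R).
Implicit Types (K F : R3 R -> R) (x y : R3 R).

Lemma convolZl c K F x :
  mu.-integrable setT (EFin \o (fun y => K (x - y) * F y)) ->
  convol (fun z => c * K z) F x = c * convol K F x.
Proof.
move=> iK; rewrite /convol -RintegralZl//.
by apply: eq_Rintegral => y _; rewrite mulrA.
Qed.

Lemma inner_subset (A B : set (R3 R)) F : measurable A -> measurable B -> A `<=` B ->
  l2 mu A F -> l2 mu B F -> inner mu A F F <= inner mu B F F.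
Proof.
move=> mA mB AB lA lB; rewrite -lee_fin -!inner_ereal//.
apply: ge0_subset_integral => //; first by case: lB => _ /integrableP[].
by move=> x _; rewrite lee_fin sqr_ge0.
Qed.

Lemma convol_continuous_l2 K F X (A B : R) : continuous K ->
  mu.-integrable setT (EFin \o F) -> vanish_off B F -> measurable X -> X `<=` cube A ->
  l2 mu X (convol K F).
Proof.
move=> cK iF FB mX XA; have [M [M0 hM]] := bounded_on_cube (A + B) cK.
have hK x y : X x -> F y != 0 -> `|K (x - y)| <= M.
  by move=> Xx Fy; apply: hM; apply: cubeB; [exact: XA|exact: vanish_supp FB _ Fy].
have muX : (mu X < +oo)%E.
  apply: le_lt_trans (mu3_cube A); apply: le_measure; rewrite ?inE//.
  exact: measurable_cube.
have mK := continuous_measurable cK.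
apply: (@l2_bounded _ _ _ _ _ _ (M * \int[mu]_y `|F y|)) => //.
  exact: (measurable_conv M0).
by move=> x Xx; apply: conv_bound => // y; exact: hK.
Qed.

End ConvolLinear.

Section SobolevConvol.
Variable R : realType.
Notation mu := (@mu3 R).
Variable rad : R.
Hypothesis rad0 : 0 < rad.
Let D : set (R3 R) := eball rad.
Let mD : measurable D := measurable_eball rad.
Let muD : (mu D < +oo)%E := mu_eball rad.
Implicit Types (F v : R3 R -> R) (G : nat -> R -> R).

Lemma inner_off (f g : R3 R -> R) : (forall x, ~ D x -> g x = 0) ->
  inner mu D f g = \int[mu]_x (f x * g x).
Proof.
move=> gD; rewrite /inner Rintegral_mkcond; apply: eq_Rintegral => x _.
rewrite patchE; case: ifPn => // /negP xA; rewrite gD ?mulr0// => h.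
by apply: xA; rewrite mem_set.
Qed.

(** For a regularised kernel the tree of derivatives is explicit: its nodes are the convolutions of
    [F] with the derivatives of the kernel. *)
Lemma sobolev_convol n G e (B Q : R) F al : 0 < e -> chain 4 G ->
  mu.-integrable setT (EFin \o F) -> vanish_off B F ->
  (forall be, (order3 be <= 4)%N -> l2 mu D (convol (dradial G e be) F) /\
    inner mu D (convol (dradial G e be) F) (convol (dradial G e be) F) <= Q) ->
  (n + order3 al <= 4)%N -> sobolev D n Q (convol (dradial G e al) F).
Proof.
move=> e0 cG iF FB hQ; elim: n al => [|n ih] al nal; split => //; try exact: hQ.
  by apply: hQ; rewrite (leq_trans _ nal)// leq_addl.
have al4 : (order3 al < 4)%N by rewrite (leq_trans _ nal)// addSn ltnS leq_addl.
move=> i; exists (convol (dradial G e (inc i al)) F); last first.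
  by apply: ih; rewrite order3_inc addnS -addSn.
move=> psi cpsi; have [A pA] := Cc_infty_vanish cpsi.
have [spsi _ _] := cpsi.
rewrite !inner_off; [|by move=> x; exact: (Cc_infty_off cpsi)|].
  apply: (conv_weak_derivative (i := i) _ _ _ _ _ _ pA iF FB).
  - by apply: continuous_dradial e0 cG _; exact: ltnW.
  - by apply: continuous_dradial e0 cG _; rewrite order3_inc.
  - by move=> x; apply: is_derive_dradial e0 cG al4.
  - exact: smooth_continuous.
  - exact: smooth_continuous (smooth_derive i spsi).
  - by move=> x; exact: smooth_is_derive.
by move=> x; exact: (Cc_infty_off (Cc_infty_derive i cpsi)).
Qed.

(** Uniform limits of functions with a common Sobolev bound. Sums, multiples and cut-offs are
    performed on the approximants, and weak derivatives of the limit are extracted only at the end,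
    in [Hnorm_le]. *)
Definition sobolev_lim n Q v := exists (vm : nat -> R3 R -> R) (e : nat -> R),
  [/\ forall m, sobolev D n Q (vm m),
      forall m x, D x -> `|vm m x - v x| <= e m & e @ \oo --> 0].

Lemma sobolev_limD n Q Q' u v : sobolev_lim n Q u -> sobolev_lim n Q' v ->
  sobolev_lim n (2 * (Q + Q')) (fun x => u x + v x).
Proof.
move=> [um [d [su ud d0]]] [vm [e [sv ve e0]]].
exists (fun m x => um m x + vm m x), (fun m => d m + e m); split.
- by move=> m; exact: sobolevD.
- move=> m x Dx; rewrite opprD addrACA (le_trans (ler_normD _ _))//.
  by rewrite lerD ?ud ?ve.
- by rewrite -[0 in X in _ --> X]addr0; exact: cvgD.
Qed.

Lemma sobolev_limZ n Q c v : sobolev_lim n Q v ->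
  sobolev_lim n (c ^+ 2 * Q) (fun x => c * v x).
Proof.
move=> [vm [e [sv ve e0]]].
exists (fun m x => c * vm m x), (fun m => `|c| * e m); split.
- by move=> m; exact: sobolevZ.
- by move=> m x Dx; rewrite -mulrBr normrM ler_wpM2l// ve.
- by rewrite -(mulr0 `|c|); apply: cvgM => //; exact: cvg_cst.
Qed.

Lemma sobolev_limM n rho : Cc_infty D rho -> exists2 C, 0 <= C &
  forall Q v, 0 <= Q -> sobolev_lim n Q v -> sobolev_lim n (C * Q) (fun x => rho x * v x).
Proof.
move=> crho; have [C C0 hC] := sobolevM mD muD n crho.
have [A rA] := Cc_infty_vanish crho.
have crho' := smooth_continuous (let: And3 s _ _ := crho in s).
have [B [B0 hB]] := bounded_on_cube A crho'.
exists C => // Q v Q0 [vm [e [sv ve e0]]].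
exists (fun m x => rho x * vm m x), (fun m => B * e m); split.
- by move=> m; exact: hC.
- move=> m x Dx; rewrite -mulrBr normrM ler_pM ?ve//.
  by have [xA|/rA ->] := pselect (cube A x); [exact: hB|rewrite normr0].
- by rewrite -(mulr0 B); apply: cvgM => //; exact: cvg_cst.
Qed.

Lemma sobolev_lim_le n Q Q' v : Q <= Q' -> sobolev_lim n Q v -> sobolev_lim n Q' v.
Proof.
move=> QQ [vm [e [sv ve e0]]]; exists vm, e; split => // m.
exact: sobolev_le (sv m).
Qed.

End SobolevConvol.

(** * The linear term and the smooth part of the kernel *)

Section KernelEstimate.
Variable R : realType.
Notation mu := (@mu3 R).
Variable rad : R.
Hypothesis rad0 : 0 < rad.
Let D : set (R3 R) := eball rad.
Let mD : measurable D := measurable_eball rad.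
Let muD : (mu D < +oo)%E := mu_eball rad.
(** For [x], [y] in the ball and [e <= 1] the regularised norm of [x - y] is at most [2 rad + e]. *)
Let S0 : R := 2 * rad + 1.
Implicit Types (F v : R3 R -> R) (G : nat -> R -> R).

Lemma chain_weaken n m G : (m <= n)%N -> @chain R n G -> chain m G.
Proof.
move=> mn cG p s s0; have [h1 h2] := cG p s s0; split => pm; [apply: h1|apply: h2].
- exact: leq_trans mn.
- exact: leq_trans mn.
Qed.

Lemma l2_off_integrable F : l2 mu setT F -> (forall x, ~ D x -> F x = 0) ->
  mu.-integrable setT (EFin \o F) /\
  (\int[mu]_y `|F y|) ^+ 2 <= fine (mu D) * inner mu setT F F.
Proof.
move=> lF FD.
have l1 : l2 mu D (fun=> 1).
  by apply: (@l2_bounded _ _ _ _ _ _ 1) => // x _; rewrite normr1.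
have lFD : l2 mu D F.
  have [mF iF] := lF; split; first exact: measurable_funTS.
  exact: (integrableS _ _ _ iF).
have iD : mu.-integrable D (EFin \o F).
  by apply: (integrableE _ _ (l2M mD lFD l1)) => // x _; rewrite mulr1.
have restr : F \_ D = F.
  apply/funext => x; rewrite patchE; case: ifPn => // /negP xD.
  by rewrite FD// => h; apply: xD; rewrite mem_set.
have iF : mu.-integrable setT (EFin \o F).
  by rewrite -restr -restrict_EFin; exact/(integrable_mkcond _ mD).
split => //.
have eqn : \int[mu]_y `|F y| = inner mu D (fun y => `|F y|) (fun=> 1).
  rewrite /inner [RHS]Rintegral_mkcond; apply: eq_Rintegral => x _.
  rewrite patchE mulr1; case: ifPn => // /negP xD.
  by rewrite FD ?normr0// => h; apply: xD; rewrite mem_set.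
have lN : l2 mu D (fun y => `|F y|).
  have [mF iF2] := lFD; split; first exact: measurableT_comp.
  by apply: (integrableE _ _ iF2) => // x _; rewrite /= real_normK ?num_real.
rewrite eqn; apply: le_trans (inner_cauchy_schwarz mD lN l1) _.
have -> : inner mu D (fun=> 1) (fun=> 1) = fine (mu D).
  rewrite /inner; under eq_Rintegral do rewrite mulr1.
  by rewrite Rintegral_cst// mul1r.
rewrite mulrC ler_wpM2l ?fine_ge0//.
have -> : inner mu D (fun y => `|F y|) (fun y => `|F y|) = inner mu D F F.
  by apply: eq_Rintegral => x _; rewrite -normrM ger0_norm// -expr2 sqr_ge0.
exact: inner_subset.
Qed.

(** The kernel and its derivatives up to order four are bounded by a multiple of [M], so their
    convolutions with [F] are bounded by this multiple times the L^1 norm of [F]. One factor [mu D]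
    of the constant comes from integrating the square of this bound, the other from comparing L^1
    with L^2. *)
Lemma smooth_part_estimate : exists2 C, 0 <= C & forall M G F e, 0 <= M -> chain 4 G ->
  (forall q s, (q <= 4)%N -> 0 < s -> s <= S0 -> `|G q s| <= M * weight s q.*2) ->
  l2 mu setT F -> (forall x, ~ D x -> F x = 0) -> 0 < e -> e <= 1 ->
  sobolev D 4 (C * M ^+ 2 * inner mu setT F F) (convol (dradial G e (0, 0, 0)%N) F).
Proof.
have S01 : 1 <= S0 by rewrite /S0 lerDr mulr_ge0 ?(ltW rad0).
(* Multi-indices of order at most four have entries below five; over a finite type the constants can
   be summed to a single one. *)
pose I := ('I_5 * 'I_5 * 'I_5)%type.
pose mi (t : I) : nat * nat * nat := (t.1.1 : nat, t.1.2 : nat, t.2 : nat).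
have /choice[c hc] : forall t : I, exists C : R, 0 <= C /\ ((order3 (mi t) <= 4)%N ->
    forall (F : nat -> R -> R) (e : R) x (M : R), 0 < e -> regnorm e x <= S0 -> 0 <= M ->
    (forall q, (q <= 4)%N -> `|F q (regnorm e x)| <= M * weight (regnorm e x) q.*2) ->
    `|dradial F e (mi t) x| <= C * M).
  move=> t; case: (boolP (order3 (mi t) <= 4)%N) => ht; last by exists 0.
  by have [C C0 hC] := dradial_bound S01 ht; exists C.
have c0 t : 0 <= c t by case: (hc t).
pose C := \sum_t c t.
have C0 : 0 <= C by apply: sumr_ge0.
exists (fine (mu D) * (C ^+ 2 * fine (mu D))).
  by rewrite mulr_ge0 ?fine_ge0// mulr_ge0 ?fine_ge0// sqr_ge0.
move=> M G F e M0 cG hG lF FD e0 e1.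
have [iF FL1] := l2_off_integrable lF FD; have FB := vanish_off_eball FD.
apply: (sobolev_convol e0 cG iF FB _ _) => // al al4.
have cK : continuous (dradial G e al) by exact: (continuous_dradial e0 cG al4).
have bK z : regnorm e z <= S0 -> `|dradial G e al z| <= C * M.
  move=> zS.
  have [t tE] : exists t, mi t = al.
    move: al4; case: al cK => -[a b] d _; rewrite /order3 /= -addnA => h.
    have a5 : (a < 5)%N by rewrite ltnS (leq_trans _ h)// leq_addr.
    have b5 : (b < 5)%N by rewrite ltnS (leq_trans _ h)// addnCA leq_addr.
    have d5 : (d < 5)%N by rewrite ltnS (leq_trans _ h)// addnA leq_addl.
    by exists (Ordinal a5, Ordinal b5, Ordinal d5).
  have [_] := hc t; rewrite tE => /(_ al4 G e z M e0 zS M0) h.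
  apply: (@le_trans _ _ (c t * M)); last first.
    by rewrite ler_wpM2r// /C (bigD1 t)//= lerDl sumr_ge0.
  by apply: h => q q4; apply: hG => //; exact: regnorm_gt0.
have bKD x y : D x -> F y != 0 -> `|dradial G e al (x - y)| <= C * M.
  move=> Dx Fy; apply: bK; have /andP[_ h] := regnorm_enorm (x - y) (ltW e0).
  apply: (le_trans h); apply: lerD => //; apply/ltW/enormB_eball => //.
  by apply: contrapT => /FD Fy0; rewrite Fy0 eqxx in Fy.
have CM0 : 0 <= C * M by exact: mulr_ge0.
have lW := convol_continuous_l2 cK iF FB mD (@eball_cube R rad).
split => //.
set m := fine (mu D); set b := C * M * \int[mu]_y `|F y|.
have b0 : 0 <= b by rewrite mulr_ge0// Rintegral_ge0.
have Wb x : D x -> `|convol (dradial G e al) F x| <= b.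
  by move=> Dx; apply: conv_bound => //; [exact: continuous_measurable|move=> y; exact: bKD].
apply: (@le_trans _ _ (m * b ^+ 2)).
  have -> : m * b ^+ 2 = \int[mu]_(x in D) (b ^+ 2) by rewrite Rintegral_cst// mulrC.
  apply: le_Rintegral => //; first exact: l2M.
    exact: integrable_const.
  move=> x Dx; rewrite -expr2 -[leLHS]real_normK ?num_real//.
  by rewrite ler_sqr ?nnegrE// Wb.
have -> : m * (C ^+ 2 * m) * M ^+ 2 * inner mu setT F F =
  m * ((C * M) ^+ 2 * (m * inner mu setT F F)) by ring.
by rewrite ler_wpM2l ?fine_ge0// /b exprMn ler_wpM2l ?sqr_ge0.
Qed.

(** The approximants replace [enorm] by [regnorm (1/(m+1))] in both terms, and the identity by the
    cut-off chain [H] in the linear term. At the distances that occur they differ from the true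
    kernel by at most [(|c| + L)/(m+1)]. The common Sobolev bound comes from [energy_estimate] for
    the linear term and from [smooth_part_estimate] for the other one. *)
Lemma kernel_estimate : exists2 C, 0 <= C & forall c M L G F, 0 <= M -> chain 4 G ->
  (forall q s, (q <= 4)%N -> 0 < s -> s <= S0 -> `|G q s| <= M * weight s q.*2) ->
  (forall s t, 0 <= s -> s <= t -> t <= S0 -> `|G 0%N t - G 0%N s| <= L * (t - s)) ->
  measurable_fun setT (fun z : R3 R => G 0%N (enorm z)) ->
  l2 mu setT F -> (forall x, ~ D x -> F x = 0) ->
  sobolev_lim rad 4 (C * (c ^+ 2 + M ^+ 2) * inner mu setT F F)
    (convol (fun z => c * enorm z + G 0%N (enorm z)) F).
Proof.
have [C1 C10 h1] := smooth_part_estimate.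
have s00 : 0 < S0 + 1 by rewrite /S0 !addr_gt0// mulr_gt0.
(* Cutting off beyond [S0 + 1] only leaves [H 0 s = s] at every distance that occurs in the ball. *)
have [S [M1 [H [[Sp M10 cH] HS Hnear Hfar H0]]]] := @cutoff_chain R (S0 + 1) s00.
pose C2 := 2 * ((15 + M1 * (1 + S ^+ 4 + 10 * S ^+ 2 + 15) * (1 + S ^+ 2) ^+ 3) *
  pi ^+ 3) ^+ 2 : R.
have C20 : 0 <= C2 by rewrite mulr_ge0// sqr_ge0.
exists (2 * (C1 + C2)); first by rewrite mulr_ge0// addr_ge0.
move=> c M L G F M0 cG hG hL mG lF FD.
have [iF _] := l2_off_integrable lF FD; have FB := vanish_off_eball FD.
set E := inner mu setT F F; have E0 : 0 <= E := inner_ge0 _ _ _.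
have cH4 : chain 4 H by exact: chain_weaken cH.
pose e (m : nat) : R := m.+1%:R^-1.
have e0 m : 0 < e m by rewrite invr_gt0.
have e1 m : e m <= 1 by rewrite invf_le1// ler1n.
pose o : nat * nat * nat := (0, 0, 0)%N.
have cut m : sobolev D 4 (C2 * E) (convol (dradial H (e m) o) F).
  apply: (sobolev_convol (e0 m) cH4 iF FB _ _) => // al al4.
  have cK : continuous (dradial H (e m) al) by exact: (continuous_dradial (e0 m) cH4 al4).
  have lD := convol_continuous_l2 cK iF FB mD (@eball_cube R rad).
  have lX := convol_continuous_l2 cK iF FB (measurable_cube (S + rad)) (@subset_refl _ _).
  split => //; apply: (@le_trans _ _ (inner mu (cube (S + rad))
    (convol (dradial H (e m) al) F) (convol (dradial H (e m) al) F))).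
    apply: inner_subset => //; first exact: measurable_cube.
    move=> x /eball_cube/cubeP hx; apply/cubeP => i; apply: (le_trans (hx i)).
    by rewrite lerDr ltW.
  rewrite /C2 -[leRHS]mulrA.
  have Hn s : 0 < s -> s < S0 + 1 ->
    [/\ H 2 s = - s ^- 3, H 3 s = 3 * s ^- 5 & H 4 s = - (15 * s ^- 7)].
    by move=> sp ss; have [] := Hnear s sp ss.
  exact: (energy_estimate (e0 m) cH HS iF FB Sp M10 Hn Hfar H0 lF al4).
exists (fun m x => c * convol (dradial H (e m) o) F x + convol (dradial G (e m) o) F x).
exists (fun m => (`|c| + L) * e m * \int[mu]_y `|F y|); split.
- move=> m; have := sobolevD mD muD (sobolevZ mD muD c (cut m))
    (h1 M G F (e m) M0 cG hG lF FD (e0 m) (e1 m)).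
  apply: sobolev_le; rewrite -/E.
  have h : 0 <= M ^+ 2 * C2 by rewrite mulr_ge0// sqr_ge0.
  have h' : 0 <= c ^+ 2 * C1 by rewrite mulr_ge0// sqr_ge0.
  rewrite [leRHS](_ : _ = 2 * (c ^+ 2 * (C2 * E) + C1 * M ^+ 2 * E) +
    2 * (M ^+ 2 * C2 + c ^+ 2 * C1) * E); last by ring.
  by rewrite lerDl mulr_ge0// mulr_ge0// addr_ge0.
- move=> m x Dx.
  have Dy y : F y != 0 -> D y.
    by move=> Fy; apply: contrapT => /FD Fy0; rewrite Fy0 eqxx in Fy.
  have nS y : F y != 0 -> enorm (x - y) + e m <= S0.
    by move=> Fy; apply: lerD => //; apply/ltW/enormB_eball => //; exact: Dy.
  have hreg y := regnorm_enorm (x - y) (ltW (e0 m)).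
  have ck al N' : (order3 al <= 4)%N -> chain 4 N' ->
      mu.-integrable setT (EFin \o (fun y => dradial N' (e m) al (x - y) * F y)).
    move=> al4 cN; have cK := continuous_dradial (e0 m) cN al4.
    have [B [B0 hB]] := bounded_on_cube (rad + rad) cK.
    apply: (@integrable_kernel _ _ _ _ B) => //; first exact: continuous_measurable.
    move=> y Fy; apply: hB; apply: cubeB; first exact: eball_cube.
    exact: (vanish_supp FB).
  have G0b y : F y != 0 -> `|G 0%N (enorm (x - y))| <= `|G 0%N 0| + `|L| * S0.
    move=> Fy; have n0 := enorm_ge0 (x - y).
    have nS0 : enorm (x - y) <= S0 by have := nS y Fy; have := e0 m; lra.
    have := hL 0 _ (lexx 0) n0 nS0; rewrite subr0 => h.
    have h2 : L * enorm (x - y) <= `|L| * S0.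
      by apply: (le_trans (ler_norm _)); rewrite normrM ler_pM// ger0_norm.
    have := ler_normD (G 0%N (enorm (x - y)) - G 0%N 0) (G 0%N 0); rewrite subrK; lra.
  have iN : mu.-integrable setT (EFin \o (fun y => enorm (x - y) * F y)).
    apply: (@integrable_kernel _ _ _ _ S0) => //.
      exact: continuous_measurable (@continuous_enorm R).
    move=> y Fy; rewrite ger0_norm ?enorm_ge0//.
    by have := nS y Fy; have := e0 m; lra.
  have iG : mu.-integrable setT (EFin \o (fun y => G 0%N (enorm (x - y)) * F y)).
    exact: (@integrable_kernel _ _ _ _ _ mG iF G0b).
  have icN : mu.-integrable setT (EFin \o (fun y => c * enorm (x - y) * F y)).
    apply: (@integrableE _ _ _ mu setT (fun y : R3 R => c * (enorm (x - y) * F y))) => //.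
      by move=> y _; rewrite mulrA.
    exact: integrableRZ.
  pose K1 z := c * (dradial H (e m) o z - enorm z).
  pose K2 z := dradial G (e m) o z - G 0%N (enorm z).
  have mK : measurable_fun setT (fun z => K1 z + K2 z).
    have mn := continuous_measurable (@continuous_enorm R).
    have mH : measurable_fun setT (dradial H (e m) o).
      exact: (continuous_measurable (continuous_dradial (al := o) (e0 m) cH4 erefl)).
    have mG' : measurable_fun setT (dradial G (e m) o).
      exact: (continuous_measurable (continuous_dradial (al := o) (e0 m) cG erefl)).
    by apply: measurable_funD; [apply: measurable_funM => //|]; exact: measurable_funB.
  have -> : c * convol (dradial H (e m) o) F x + convol (dradial G (e m) o) F x -
      convol (fun z => c * enorm z + G 0%N (enorm z)) F x =
      convol (fun z => K1 z + K2 z) F x.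
    have iH := ck o H erefl cH4; have iG' := ck o G erefl cG.
    rewrite -convolZl// /convol.
    have icH : mu.-integrable setT
        (EFin \o (fun y => c * dradial H (e m) o (x - y) * F y)).
      apply: (@integrableE _ _ _ mu setT (fun y : R3 R =>
        c * (dradial H (e m) o (x - y) * F y))) => //.
        by move=> y _; rewrite mulrA.
      exact: integrableRZ.
    rewrite -RintegralD// -RintegralB//.
    + by apply: eq_Rintegral => y _; rewrite /K1 /K2 /=; ring.
    + exact: integrableRD.
    + apply: (@integrableE _ _ _ mu setT (fun y : R3 R => c * enorm (x - y) * F y +
        G 0%N (enorm (x - y)) * F y)) => //.
        by move=> y _; rewrite mulrDl.
      exact: integrableRD.
  have L0 : 0 <= L.
    have h01 : (0 : R) <= 1 by [].
    have S01 : 1 <= S0 by rewrite /S0 lerDr mulr_ge0 ?(ltW rad0).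
    by have := hL _ _ (lexx 0) h01 S01; rewrite subr0 mulr1; exact: le_trans.
  apply: conv_bound => //.
    by rewrite mulr_ge0 ?(ltW (e0 m))// addr_ge0.
  move=> y Fy; have /andP[r1 r2] := hreg y; have n0 := enorm_ge0 (x - y).
  have rS := le_trans r2 (nS y Fy).
  have rp : 0 < regnorm (e m) (x - y) by exact: regnorm_gt0.
  apply: (le_trans (ler_normD _ _)); rewrite mulrDl lerD//.
    rewrite /K1 normrM ler_wpM2l//.
    have -> : dradial H (e m) o (x - y) = regnorm (e m) (x - y).
      rewrite /dradial /= /radial.
      have [] // := Hnear (regnorm (e m) (x - y)) rp.
      by apply: (le_lt_trans rS); rewrite ltrDl.
    by rewrite ger0_norm ?subr_ge0// lerBlDl.
  apply: (le_trans (hL _ _ n0 r1 rS)); rewrite ler_wpM2l// lerBlDl//.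
- have e_to0 : e @ \oo --> 0 by exact: cvg_harmonic.
  rewrite -[0 in X in _ --> X](mul0r (\int[mu]_y `|F y|)).
  apply: cvgM; last exact: cvg_cst.
  rewrite -[0 in X in _ --> X](mulr0 (`|c| + L)); apply: cvgM => //; exact: cvg_cst.
Qed.

End KernelEstimate.

(** * Taylor expansion of the numerator *)

Section TaylorRemainder.
Variable R : realType.
Implicit Types (N : nat -> R -> R) (a : nat -> R) (s t M : R).

Definition taylor n a s : R := \sum_(j < n) a j * (s ^+ j / j`!%:R).

Lemma is_derive_taylor n a s :
  is_derive s (1 : R) (taylor n.+1 a) (taylor n (fun j => a j.+1) s).
Proof.
elim: n => [|n ih].
  have -> : taylor 1 a = fun=> a 0%N.
    by apply/funext => t; rewrite /taylor big_ord1 expr0 fact0 divr1 mulr1.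
  by apply: der_eq (derC _ _ _) _; rewrite /taylor big_ord0.
have -> : taylor n.+2 a = fun t => taylor n.+1 a t + a n.+1 * (n.+1)`!%:R^-1 * t ^+ n.+1.
  by apply/funext => t; rewrite /taylor big_ord_recr/= mulrA mulrAC.
apply: der_eq (derD ih (derZ _ (derX n.+1 (der_id s)))) _.
rewrite [RHS]/taylor big_ord_recr/= -/(taylor n _ s); congr (_ + _).
rewrite factS natrM invfM mulr1.
have h : n.+1%:R != 0 :> R by rewrite pnatr_eq0.
have hf : n`!%:R != 0 :> R by rewrite pnatr_eq0 -lt0n fact_gt0.
by field; rewrite hf nat1r h.
Qed.

Lemma taylor0 n a : taylor n.+1 a 0 = a 0%N.
Proof.
rewrite /taylor big_ord_recl /= expr0 fact0 divr1 mulr1 big1 ?addr0// => j _.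
by rewrite expr0n mul0r mulr0.
Qed.

(** [N q] minus its Taylor polynomial of degree [5 - q] at 0. The shrinking degree makes each
    remainder the derivative of the preceding one; for [q = 6] the polynomial is empty. *)
Definition remainder N q s : R := N q s - taylor (6 - q) (fun j => N (q + j)%N 0) s.

Variables (N : nat -> R -> R) (M S0 : R).
Hypothesis dN : forall q s, (q < 6)%N -> is_derive s (1 : R) (N q) (N q.+1 s).
Hypotheses (M0 : 0 <= M) (S01 : 1 <= S0).
Hypothesis N_top : forall s, 0 <= s -> s <= S0 -> `|N 6 s| <= M.
Hypothesis N_zero : forall j, (j < 6)%N -> `|N j 0| <= M.
Let f := remainder N.

Lemma is_derive_remainder q s : (q < 6)%N -> is_derive s (1 : R) (f q) (f q.+1 s).
Proof.
move=> q6; rewrite /f /remainder (_ : (6 - q = (6 - q.+1).+1)%N); last first.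
  by rewrite subnSK.
apply: der_eq (derB (dN s q6) (is_derive_taylor _ _ s)) _; congr (_ - _).
by apply: eq_bigr => j _; rewrite addnS.
Qed.

(** Downward induction from the sixth derivative: each lower remainder vanishes at 0, and the mean
    value theorem gains one power of [s]. *)
Lemma remainder_bound q s : (q <= 6)%N -> 0 <= s -> s <= S0 -> `|f q s| <= M * s ^+ (6 - q).
Proof.
move=> q6; have [p pq] : exists p, (q + p = 6)%N by exists (6 - q)%N; rewrite subnKC.
rewrite (_ : (6 - q)%N = p); last by rewrite -pq addKn.
elim: p q pq {q6} s => [|p ih] q pq s s0 sS.
  rewrite addn0 in pq; rewrite /f /remainder pq subnn /taylor big_ord0 subr0 expr0 mulr1.
  exact: N_top.
have q6 : (q < 6)%N by rewrite -pq -addSnnS leq_addr.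
have c : {within `[0, s], continuous (f q)}.
  apply: derivable_within_continuous => t _.
  by have [] := is_derive_remainder t q6.
have [t] := MVT_segment s0 (fun t _ => is_derive_remainder t q6) c.
rewrite in_itv/= subr0 => /andP[t0 ts].
have -> : f q 0 = 0.
  rewrite /f /remainder (_ : (6 - q = (6 - q.+1).+1)%N); last by rewrite subnSK.
  by rewrite taylor0 addn0 subrr.
rewrite subr0 => ->; rewrite normrM [`|s|]ger0_norm//.
rewrite exprSr mulrA ler_wpM2r//.
apply: (@le_trans _ _ (M * t ^+ p)).
  by apply: ih => //; [rewrite addSnnS|exact: le_trans sS].
by rewrite ler_wpM2l// lerXn2r ?nnegrE.
Qed.

Hypotheses (N00 : N 0 0 = 0) (N40 : N 4 0 = 0).

(* The chain of the part of [N 0 s / s] that is of class C^4 in the variable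
   [x] with [s = |x|]; only the term linear in [s] is missing. *)
Definition smooth_chain (q : nat) (s : R) : R :=
  match q with
  | 0 => N 1 0 + N 3 0 / 6 * s ^+ 2 + N 5 0 / 120 * s ^+ 4 + f 0 s / s
  | 1 => N 3 0 / 3 + N 5 0 / 30 * s ^+ 2 + (f 1 s * s ^- 2 - f 0 s * s ^- 3)
  | 2 => N 5 0 / 15 + (f 2 s * s ^- 3 - 3 * (f 1 s * s ^- 4) + 3 * (f 0 s * s ^- 5))
  | 3 => f 3 s * s ^- 4 - 6 * (f 2 s * s ^- 5) + 15 * (f 1 s * s ^- 6)
         - 15 * (f 0 s * s ^- 7)
  | _ => f 4 s * s ^- 5 - 10 * (f 3 s * s ^- 6) + 45 * (f 2 s * s ^- 7)
         - 105 * (f 1 s * s ^- 8) + 105 * (f 0 s * s ^- 9)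
  end.

Lemma numerator_split s : 0 < s ->
  N 0 s / s = N 2 0 / 2 * s + smooth_chain 0 s.
Proof.
move=> s0; have sn : s != 0 by rewrite gt_eqF.
rewrite /smooth_chain /f /remainder /taylor !big_ord_recr big_ord0 /= N00 N40.
by rewrite !factS fact0 !mulnE /=; field.
Qed.

Let term q n s : (q < 6)%N -> 0 < s ->
  is_derive s (1 : R) (fun t => f q t * t ^- n)
    (f q.+1 s * s ^- n - n%:R * (f q s * s ^- n.+1)).
Proof.
move=> q6 s0; apply: der_eq (derM (is_derive_remainder s q6) (is_derive_exprNn n s0)) _.
ring.
Qed.

Lemma chain_smooth_chain : chain 4 smooth_chain.
Proof.
suff d q s : (q <= 4)%N -> 0 < s -> exists2 c, is_derive s (1 : R) (smooth_chain q) c &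
    ((q < 4)%N -> c = s * smooth_chain q.+1 s).
  move=> q s s0; split => q4.
    by have [c dc /(_ q4) ce] := d q s (ltnW q4) s0; rewrite -ce.
  by have [c dc _] := d q s q4 s0; exact: is_derive_continuous dc.
move=> q4 s0; have sn : s != 0 by rewrite gt_eqF.
have sq n : is_derive s (1 : R) (fun t => t ^+ n) (n%:R * s ^+ n.-1 * 1) := derX n (der_id s).
case: q q4 => [|[|[|[|[|//]]]]] _ /=.
- eexists; last by move=> _; reflexivity.
  have e : smooth_chain 0 = fun s =>
      N 1 0 + N 3 0 / 6 * s ^+ 2 + N 5 0 / 120 * s ^+ 4 + f 0 s * s ^- 1 by [].
  rewrite e.
  apply: der_eq (derD (derD (derD (derC _ _ _) (derZ _ (sq 2%N))) (derZ _ (sq 4%N)))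
    (@term 0 1 s isT s0)) _; rewrite /smooth_chain /=; field; exact: sn.
- eexists; last by move=> _; reflexivity.
  apply: der_eq (derD (derD (derC _ _ _) (derZ _ (sq 2%N)))
    (derB (@term 1 2 s isT s0) (@term 0 3 s isT s0))) _; rewrite /smooth_chain /=; field; exact: sn.
- eexists; last by move=> _; reflexivity.
  apply: der_eq (derD (derC _ _ _) (derD (derB (@term 2 3 s isT s0)
    (derZ _ (@term 1 4 s isT s0))) (derZ _ (@term 0 5 s isT s0)))) _.
  rewrite /smooth_chain /=; field; exact: sn.
- eexists; last by move=> _; reflexivity.
  apply: der_eq (derB (derD (derB (@term 3 4 s isT s0) (derZ _ (@term 2 5 s isT s0)))
    (derZ _ (@term 1 6 s isT s0))) (derZ _ (@term 0 7 s isT s0))) _.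
  rewrite /smooth_chain /=; field; exact: sn.
- apply: ex_intro2; last by move=> h; exfalso; rewrite ltnn in h.
  apply: der_eq (derD (derB (derD (derB (@term 4 5 s isT s0) (derZ _ (@term 3 6 s isT s0)))
    (derZ _ (@term 2 7 s isT s0))) (derZ _ (@term 1 8 s isT s0))) (derZ _ (@term 0 9 s isT s0))) _.
  reflexivity.
Qed.

(** The term is of size [s^(6 - q - n)]. After multiplication by [s^k] the exponent lies between 0
    and 5, so [S0^5] bounds the power, as [S0 >= 1]. *)
Let term_bound q n k s : (q <= 6)%N -> (n <= 6 - q + k)%N -> (6 - q + k <= n + 5)%N ->
  0 < s -> s <= S0 -> `|f q s * s ^- n| <= M * S0 ^+ 5 * (s ^+ k)^-1.
Proof.
move=> q6 n1 n2 s0 sS; have sk : 0 < s ^+ k by rewrite exprn_gt0.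
have sn : 0 < s ^+ n by rewrite exprn_gt0.
rewrite normrM (ger0_norm (x := s ^- n)) ?invr_ge0 ?(ltW sn)//.
rewrite ler_pdivlMr// mulrAC ler_pdivrMr//.
apply: (@le_trans _ _ (M * s ^+ (6 - q) * s ^+ k)).
  by rewrite ler_wpM2r ?(ltW sk)// remainder_bound// ltW.
rewrite -[leLHS]mulrA -[leRHS]mulrA ler_wpM2l// -exprD -(subnK n1) exprD ler_wpM2r ?(ltW sn)//.
apply: (@le_trans _ _ (S0 ^+ (6 - q + k - n))).
  by rewrite lerXn2r ?nnegrE ?(ltW s0)// ltW// (lt_le_trans s0).
by rewrite ler_weXn2l// leq_subLR.
Qed.

Let poly_bound j n s : (j < 6)%N -> (n <= 5)%N -> 0 < s -> s <= S0 ->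
  `|N j 0 * s ^+ n| <= M * S0 ^+ 5.
Proof.
move=> j6 n5 s0 sS; rewrite normrM ler_pM ?N_zero//.
rewrite ger0_norm ?exprn_ge0 ?(ltW s0)//.
apply: (@le_trans _ _ (S0 ^+ n)); last by rewrite ler_weXn2l.
by rewrite lerXn2r ?nnegrE ?(ltW s0)// ltW// (lt_le_trans s0).
Qed.

(** 300 exceeds the sum of the coefficients in every line of [smooth_chain]; the largest sum,
    [1 + 10 + 45 + 105 + 105 = 266], occurs for [q = 4]. *)
Lemma smooth_chain_bound q s : (q <= 4)%N -> 0 < s -> s <= S0 ->
  `|smooth_chain q s| <= 300 * (M * S0 ^+ 5) * weight s q.*2.
Proof.
move=> q4 s0 sS.
have tb q' n k : (q' <= 6)%N -> (n <= 6 - q' + k)%N -> (6 - q' + k <= n + 5)%N ->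
    - (M * S0 ^+ 5 * (s ^+ k)^-1) <= f q' s * s ^- n <= M * S0 ^+ 5 * (s ^+ k)^-1.
  by move=> h1 h2 h3; rewrite -ler_norml; exact: term_bound.
have pb j n : (j < 6)%N -> (n <= 5)%N -> - (M * S0 ^+ 5) <= N j 0 * s ^+ n <= M * S0 ^+ 5.
  by move=> h1 h2; rewrite -ler_norml; exact: poly_bound.
case: q q4 => [|[|[|[|[|//]]]]] _ /=; rewrite ler_norml.
- rewrite (_ : weight s _ = 1); last by rewrite /weight expr0 invr1.
  have := pb 1%N 0%N isT isT; have := pb 3%N 2%N isT isT; have := pb 5%N 4%N isT isT.
  have := tb 0%N 1%N 0%N isT isT isT; rewrite !expr0 expr1 invr1; lra.
- rewrite (_ : weight s _ = 1); last by rewrite /weight expr0 invr1.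
  have := pb 3%N 0%N isT isT; have := pb 5%N 2%N isT isT.
  have := tb 1%N 2%N 0%N isT isT isT; have := tb 0%N 3%N 0%N isT isT isT.
  rewrite !expr0 invr1; lra.
- rewrite (_ : weight s _ = 1); last by rewrite /weight expr0 invr1.
  have := pb 5%N 0%N isT isT.
  have := tb 2%N 3%N 0%N isT isT isT; have := tb 1%N 4%N 0%N isT isT isT.
  have := tb 0%N 5%N 0%N isT isT isT.
  rewrite !expr0 invr1; lra.
- rewrite (_ : weight s _ = (s ^+ 2)^-1)// -[300 * _ * _]mulrA.
  have := tb 3%N 4%N 2%N isT isT isT; have := tb 2%N 5%N 2%N isT isT isT.
  have := tb 1%N 6%N 2%N isT isT isT; have := tb 0%N 7%N 2%N isT isT isT.
  by move: (M * S0 ^+ 5 * (s ^+ 2)^-1) => b; lra.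
- rewrite (_ : weight s _ = (s ^+ 4)^-1)// -[300 * _ * _]mulrA.
  have := tb 4%N 5%N 4%N isT isT isT.
  have := tb 3%N 6%N 4%N isT isT isT; have := tb 2%N 7%N 4%N isT isT isT.
  have := tb 1%N 8%N 4%N isT isT isT; have := tb 0%N 9%N 4%N isT isT isT.
  by move: (M * S0 ^+ 5 * (s ^+ 4)^-1) => b; lra.
Qed.

Lemma smooth_chain_lipschitz s t : 0 <= s -> s <= t -> t <= S0 ->
  `|smooth_chain 0 t - smooth_chain 0 s| <= 300 * (M * S0 ^+ 6) * (t - s).
Proof.
(* At [s = 0] the quotient [f 0 s / s] takes the default value 0, which is also its limit. The chain
   relations hold for positive [s] only, so this end point is treated by hand. *)
move=> + st tS; rewrite le_eqVlt => /orP[/eqP s0|s0].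
  move: st; rewrite -s0 subr0 le_eqVlt => /orP[/eqP <-|t0].
    by rewrite subrr normr0 mulr0.
  have -> : smooth_chain 0 t - smooth_chain 0 0 =
      (N 3 0 * t ^+ 1 / 6 + N 5 0 * t ^+ 3 / 120 + f 0 t * t ^- 2) * t.
    rewrite /smooth_chain expr0n invr0 mulr0 !addr0 expr0n !mulr0 !addr0.
    by field; rewrite gt_eqF.
  rewrite normrM (gtr0_norm t0) ler_wpM2r ?(ltW t0)//.
  have h : M * S0 ^+ 5 <= M * S0 ^+ 6 by rewrite ler_wpM2l// ler_weXn2l.
  have h0 : 0 <= M * S0 ^+ 5 by rewrite mulr_ge0// exprn_ge0// (le_trans ler01).
  have := poly_bound (j := 3) (n := 1) isT isT t0 tS.
  have := poly_bound (j := 5) (n := 3) isT isT t0 tS.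
  have := term_bound (q := 0) (n := 2) (k := 0) isT isT isT t0 tS.
  rewrite expr0 invr1 mulr1 !ler_norml; lra.
have d u : u \in `]s, t[ -> is_derive u (1 : R) (smooth_chain 0) (u * smooth_chain 1 u).
  rewrite in_itv/= => /andP[su _].
  by have [/(_ isT) d _] := chain_smooth_chain 0 (lt_trans s0 su).
have c : {within `[s, t], continuous (smooth_chain 0)}.
  apply: continuous_in_subspaceT => u /set_mem; rewrite /= in_itv/= => /andP[u1 _].
  by have [_ /(_ isT) c] := chain_smooth_chain 0 (lt_le_trans s0 u1).
have [u] := MVT_segment st d c; rewrite in_itv/= => /andP[su ut] ->.
have u0 := lt_le_trans s0 su; have uS := le_trans ut tS.
rewrite normrM (ger0_norm (x := t - s)) ?subr_ge0// ler_wpM2r ?subr_ge0//.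
rewrite normrM (gtr0_norm u0) exprS [M * _]mulrCA [300 * _]mulrCA ler_pM ?(ltW u0)//.
have := smooth_chain_bound (q := 1) isT u0 uS.
by rewrite /weight expr0 invr1 mulr1.
Qed.

End TaylorRemainder.

Section Numerator.
Variable R : realType.
Notation mu := (@mu3 R).
Implicit Types (N : nat -> R -> R) (x y z : R3 R).

Lemma mu3_set1 x : measurable [set x] /\ mu [set x] = 0%E.
Proof.
have -> : [set x] = ([set x.1.1] `*` [set x.1.2]) `*` [set x.2].
  by apply/seteqP; split => [y -> //|[[a b] c] [] [/= -> ->] ->]; case: x => [[]].
have m2 : measurable ([set x.1.1] `*` [set x.1.2]) by exact: measurableX.
split; first exact: measurableX.
have e := product_measure1E (@leb2 R) (@lebesgue_measure R) m2 (measurable_set1 x.2).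
exact (etrans e (etrans (congr1 _ (lebesgue_measure_set1 x.2)) (mule0 _))).
Qed.

Lemma measurable_enorm_inv : measurable_fun setT (fun z : R3 R => (enorm z)^-1).
Proof.
apply: (@measurable_fun_cvg _ _ _ _ (fun m z => enorm z * (enorm z ^+ 2 + m.+1%:R^-1)^-1)).
  move=> m; apply: continuous_measurable => z.
  have cn : {for z, continuous (@enorm R)} by exact: continuous_enorm.
  apply: cvgM => //; apply: cvgV; last first.
    by apply: cvgD; [exact: (cvgM cn cn)|exact: cvg_cst].
  by rewrite gt_eqF// ltr_wpDl ?invr_gt0// sqr_ge0.
move=> z _; have [->|zn] := eqVneq (enorm z) 0.
  rewrite invr0; under eq_fun do rewrite mul0r; exact: cvg_cst.
have -> : (enorm z)^-1 = enorm z * (enorm z ^+ 2 + 0)^-1.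
  by rewrite addr0 expr2 invfM mulrA divff// mul1r.
apply: cvgM; first exact: cvg_cst.
apply: cvgV; first by rewrite addr0 expf_neq0.
by apply: cvgD; [exact: cvg_cst|exact: cvg_harmonic].
Qed.

Lemma measurable_enorm_comp (g : R -> R) : continuous g ->
  measurable_fun setT (fun z : R3 R => g (enorm z)).
Proof.
move=> cg; apply: continuous_measurable => z.
by apply: continuous_comp; [exact: continuous_enorm|exact: cg].
Qed.

(** Division by [enorm z] gives the default value 0 at the origin, where the split form of the
    kernel has another value. The two forms differ only at [y = x], a null set. *)
Lemma convol_eq0 (K K' F : R3 R -> R) x :
  measurable_fun setT K -> measurable_fun setT K' -> measurable_fun setT F ->
  (forall z, 0 < enorm z -> K z = K' z) -> convol K F x = convol K' F x.
Proof.
move=> mK mK' mF KK; rewrite /convol /Rintegral; congr fine.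
apply: ae_eq_integral => //.
- by apply/measurable_EFinP/measurable_funM => //; exact: measurable_translate.
- by apply/measurable_EFinP/measurable_funM => //; exact: measurable_translate.
have [mx x0] := mu3_set1 x; exists [set x]; split => //.
move=> y /= hy; apply/eqP; rewrite eq_sym; apply: contrapT => /eqP xy.
apply: hy => _; rewrite KK// lt_neqAle enorm_ge0 andbT eq_sym.
apply: contra_neq xy => /eqP; rewrite -sqrf_eq0 enorm_sqr /sqnorm.
rewrite !paddr_eq0 ?addr_ge0 ?sqr_ge0// !sqrf_eq0 /= !subr_eq0.
case: x y {mx x0} => [[a b] c] [[a' b'] c'] /= /andP[/andP[/eqP -> /eqP ->] /eqP ->]; exact: eqxx.
Qed.

(** What enters of [N] is [M] and two vanishing values, so the estimate serves alike for the kernel,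
    its derivative in [k] and the remainder of the difference quotient. It is quadratic in [M]
    because the norms are squared. *)
Lemma numerator_estimate rad : 0 < rad -> exists2 C, 0 <= C & forall M N F, 0 <= M ->
  (forall q s, (q < 6)%N -> is_derive s (1 : R) (N q) (N q.+1 s)) ->
  (forall s, 0 <= s -> s <= 2 * rad + 1 -> `|N 6 s| <= M) ->
  (forall j, (j < 6)%N -> `|N j 0| <= M) -> N 0 0 = 0 -> N 4 0 = 0 ->
  l2 mu setT F -> (forall x, ~ eball rad x -> F x = 0) ->
  sobolev_lim rad 4 (C * M ^+ 2 * inner mu setT F F)
    (convol (fun z => N 0 (enorm z) / enorm z) F).
Proof.
move=> rad0; have [C C0 hC] := kernel_estimate rad0.
set S0 := 2 * rad + 1 in hC *.
have S01 : 1 <= S0 by rewrite /S0 lerDr mulr_ge0 ?(ltW rad0).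
exists (C * (1 + (300 * S0 ^+ 5) ^+ 2)).
  exact: (mulr_ge0 C0 (addr_ge0 ler01 (sqr_ge0 _))).
move=> M N F M0 dN N6 Nz N00 N40 lF FD.
have h0 : 0 <= 300 * (M * S0 ^+ 5).
  exact: (mulr_ge0 (ler0n _ 300) (mulr_ge0 M0 (exprn_ge0 5 (le_trans ler01 S01)))).
have cN q : (q < 6)%N -> continuous (N q).
  by move=> q6 s; have := is_derive_continuous (dN q s q6).
have mN0 : measurable_fun setT (fun z : R3 R => N 0 (enorm z) / enorm z).
  apply: measurable_funM; last exact: measurable_enorm_inv.
  exact: (measurable_enorm_comp (cN 0%N isT)).
have mG : measurable_fun setT (fun z : R3 R => smooth_chain N 0 (enorm z)).
  apply: measurable_funD.
    apply: (@measurable_enorm_comp (fun s =>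
      N 1 0 + N 3 0 / 6 * s ^+ 2 + N 5 0 / 120 * s ^+ 4)) => s.
    have sq n : is_derive s (1 : R) (fun t => t ^+ n) (n%:R * s ^+ n.-1 * 1) := derX n (der_id s).
    exact: (is_derive_continuous (derD (derD (derC (N 1 0) s 1) (derZ (N 3 0 / 6) (sq 2%N)))
      (derZ (N 5 0 / 120) (sq 4%N)))).
  apply: measurable_funM; last exact: measurable_enorm_inv.
  apply: (@measurable_enorm_comp (remainder N 0)) => s.
  exact: (is_derive_continuous (is_derive_remainder dN s (q := 0) isT)).
have := hC (N 2 0 / 2) (300 * (M * S0 ^+ 5)) (300 * (M * S0 ^+ 6)) (smooth_chain N) F h0
  (chain_smooth_chain dN) (fun q s => @smooth_chain_bound _ _ _ _ dN M0 S01 N6 Nz q s)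
  (@smooth_chain_lipschitz _ _ _ _ dN M0 S01 N6 Nz) mG lF FD.
have -> : convol (fun z => N 2 0 / 2 * enorm z + smooth_chain N 0 (enorm z)) F =
    convol (fun z => N 0 (enorm z) / enorm z) F.
  apply/funext => x; apply: convol_eq0 => //.
  - apply: measurable_funD => //; apply: measurable_funM => //.
    exact: continuous_measurable (@continuous_enorm R).
  - by case: lF.
  - by move=> z z0; rewrite numerator_split.
apply: sobolev_lim_le; rewrite ler_wpM2r ?inner_ge0// -mulrA ler_wpM2l//.
rewrite [leRHS]mulrDl mul1r (_ : 300 * (M * S0 ^+ 5) = 300 * S0 ^+ 5 * M); last by ring.
rewrite [(_ * M) ^+ 2]exprMn lerD//.
rewrite -[leLHS]real_normK ?num_real// ler_sqr ?nnegrE//.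
by rewrite normrM; have := Nz 2%N isT; rewrite [`|2^-1|]ger0_norm//; lra.
Qed.

End Numerator.

(** * Complex-valued kernels *)

Section ComplexParts.
Variable R : realType.
Implicit Types (z w : R[i]) (c : R).
Local Notation Re := (@complex.Re R).
Local Notation Im := (@complex.Im R).
Local Notation normc := (@Normc.normc R).

Lemma cReD z w : Re (z + w) = Re z + Re w. Proof. by case: z w => [a b] []. Qed.
Lemma cImD z w : Im (z + w) = Im z + Im w. Proof. by case: z w => [a b] []. Qed.
Lemma cReN z : Re (- z) = - Re z. Proof. by case: z. Qed.
Lemma cImN z : Im (- z) = - Im z. Proof. by case: z. Qed.
Lemma cReM z w : Re (z * w) = Re z * Re w - Im z * Im w.
Proof. by case: z w => [a b] []. Qed.
Lemma cImM z w : Im (z * w) = Re z * Im w + Im z * Re w.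
Proof. by case: z w => [a b] []. Qed.
Lemma cReZ z c : Re (z * c%:C) = Re z * c.
Proof. by rewrite cReM /= mulr0 subr0. Qed.
Lemma cImZ z c : Im (z * c%:C) = Im z * c.
Proof. by rewrite cImM /= mulr0 add0r. Qed.
Lemma complex_ext z w : Re z = Re w -> Im z = Im w -> z = w.
Proof. by case: z w => [a b] [c d] /= -> ->. Qed.

Lemma normc_sqr z : normc z ^+ 2 = Re z ^+ 2 + Im z ^+ 2.
Proof. by case: z => a b; rewrite /= sqr_sqrtr// addr_ge0 ?sqr_ge0. Qed.

Lemma normc_ge0 z : 0 <= normc z. Proof. by case: z => a b; exact: sqrtr_ge0. Qed.

Lemma Re_le_normc z : `|Re z| <= normc z.
Proof. by apply: ler_abs_sqr (normc_ge0 z) _; rewrite normc_sqr lerDl sqr_ge0. Qed.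

Lemma Im_le_normc z : `|Im z| <= normc z.
Proof. by apply: ler_abs_sqr (normc_ge0 z) _; rewrite normc_sqr lerDr sqr_ge0. Qed.

End ComplexParts.

Section ComplexOperator.
Variable R : realType.
Notation mu := (@mu3 R).
Variable rad : R.
Hypothesis rad0 : 0 < rad.
Let D : set (R3 R) := eball rad.
Let mD : measurable D := measurable_eball rad.
Let muD : (mu D < +oo)%E := mu_eball rad.
Let S0 : R := 2 * rad + 1.
Implicit Types (f g u F : R3 R -> R[i]) (N : nat -> R -> R).
Local Notation re f := (fun x => complex.Re (f x)).
Local Notation im f := (fun x => complex.Im (f x)).
Local Notation normc := (@Normc.normc R).

Definition energy f : R := inner mu D (re f) (re f) + inner mu D (im f) (im f).

Lemma energy_ge0 f : 0 <= energy f.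
Proof. by rewrite addr_ge0 ?inner_ge0. Qed.

Lemma L2sq_energy f : l2 mu D (re f) -> l2 mu D (im f) -> L2sq D f = (energy f)%:E.
Proof.
move=> lr li; rewrite /L2sq /energy EFinD -!inner_ereal// -ge0_integralD//.
- by apply: eq_integral => x _; rewrite normc_sqr EFinD.
- by move=> x _; rewrite lee_fin sqr_ge0.
- by case: lr => _ /integrableP[].
- by move=> x _; rewrite lee_fin sqr_ge0.
- by case: li => _ /integrableP[].
Qed.

Lemma inL2P f : inL2 D f <-> l2 mu D (re f) /\ l2 mu D (im f).
Proof.
split=> [[[mr mi] fin]|[lr li]]; last first.
  split; first by case: lr li => [? _] [? _].
  by rewrite /L2norm L2sq_energy//= ltry.
have ge0 : (0 <= L2sq D f)%E.
  by apply: integral_ge0 => x _; rewrite lee_fin sqr_ge0.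
have fin2 : (L2sq D f < +oo)%E.
  by rewrite ltey; apply/eqP => e; move: fin; rewrite /L2norm e /= ltxx.
have mE (q : R3 R -> R) : measurable_fun D q -> measurable_fun D (fun x => (q x)%:E).
  by move=> mq; exact/measurable_EFinP.
have le (p : R3 R -> R) : measurable_fun D p ->
    (forall x, p x ^+ 2 <= normc (f x) ^+ 2) -> l2 mu D p.
  move=> mp hp; apply: (proj1 (l2_of_le (Q := fine (L2sq D f)) mD mp _)).
  rewrite fineK ?ge0_fin_numE//; apply: ge0_le_integral => //.
  - by move=> x _; rewrite lee_fin sqr_ge0.
  - exact: (mE _ (measurable_funX 2 mp)).
  - apply: (mE (fun x => normc (f x) ^+ 2)).
    have -> : (fun x => normc (f x) ^+ 2) = (fun x => re f x ^+ 2 + im f x ^+ 2).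
      by apply/funext => x; exact: normc_sqr.
    by apply: measurable_funD; exact: measurable_funX.
  - by move=> x _; rewrite lee_fin.
by split; apply: le => // x; rewrite normc_sqr ?lerDl ?lerDr sqr_ge0.
Qed.

Lemma L2norm_energy f : inL2 D f -> L2norm D f = (Num.sqrt (energy f))%:E.
Proof. by move=> /inL2P[lr li]; rewrite /L2norm L2sq_energy. Qed.

Lemma size_mindex j (a : {ffun 'I_3 -> 'I_j.+1}) :
  size (flatten [seq nseq (a i) i | i <- enum 'I_3]) = mindex_order a.
Proof.
rewrite size_flatten /shape -map_comp sumnE big_map /mindex_order big_enum /=.
by apply: eq_bigr => i _; rewrite size_nseq.
Qed.

Lemma sign_real n : ((-1) ^+ n : R[i]) = ((-1) ^+ n)%:C.
Proof. by rewrite rmorphXn rmorphN rmorph1. Qed.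

Lemma card_mindex j : (j <= 4)%N -> (#|{ffun 'I_3 -> 'I_j.+1}| <= 125)%N.
Proof. by move=> j4; rewrite card_ffun !card_ord (@leq_exp2r _ 5 3). Qed.

(** The constant: at most [5^3 = 125] multi-indices, each contributing one [Q] for the real and one
    for the imaginary part. The weak derivatives of the two parts are found separately and then
    combined. *)
Lemma Hnorm_le j u (Q : R) : (j <= 4)%N -> 0 <= Q -> sobolev_lim rad 4 Q (re u) ->
  sobolev_lim rad 4 Q (im u) -> (Hnorm D j u <= (Num.sqrt (250 * Q))%:E)%E.
Proof.
move=> j4 Q0 [vr [er [sr vr1 er0]]] [vi [ei [si vi1 ei0]]].
have lr s : (size s <= 4)%N -> _ := sobolev_limit mD muD sr vr1 er0 (s := s).
have li s : (size s <= 4)%N -> _ := sobolev_limit mD muD si vi1 ei0 (s := s).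
have [lur _] := lr [::] isT; have [lui _] := li [::] isT.
have /choice[g hg] : forall a : {ffun 'I_3 -> 'I_j.+1}, exists g : R3 R -> R[i],
    (mindex_order a <= j)%N -> [/\ inL2 D g, energy g <= 2 * Q & weak_derivative D a u g].
  move=> a; have [aj|aj] := boolP (mindex_order a <= j)%N; last by exists (fun=> 0).
  set s := flatten [seq nseq (a i) i | i <- enum 'I_3].
  have s4 : (size s <= 4)%N by rewrite size_mindex (leq_trans aj).
  have [_ [wr [lwr qr] hwr]] := lr s s4; have [_ [wi [lwi qi] hwi]] := li s s4.
  exists (fun x => wr x +i* wi x) => _; split.
  - by apply/inL2P.
  - by rewrite /energy /=; lra.
  - move=> phi cphi; rewrite sign_real -size_mindex -/s.
    apply: complex_ext.
    + rewrite mulrC cReZ mulrC /=.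
      have := hwr phi cphi; rewrite /inner.
      under [in X in X -> _]eq_Rintegral do rewrite -cReZ.
      by rewrite /mindex_partial -/s => ->; congr (_ * _);
        apply: eq_Rintegral => x _; rewrite mulr0 subr0.
    + rewrite mulrC cImZ mulrC /=.
      have := hwi phi cphi; rewrite /inner.
      under [in X in X -> _]eq_Rintegral do rewrite -cImZ.
      by rewrite /mindex_partial -/s => ->; congr (_ * _);
        apply: eq_Rintegral => x _; rewrite mulr0 add0r.
apply: (@le_trans _ _ (sqrte (\sum_(a : {ffun 'I_3 -> 'I_j.+1}
    | (mindex_order a <= j)%N) L2sq D (g a))%E)).
  apply: ereal_inf_lbound; exists g => //; split; first exact/inL2P.
  by move=> a aj; have [? ? ?] := hg a aj.
have -> : (Num.sqrt (250 * Q))%:E = sqrte (250 * Q)%:E by [].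
rewrite lee_sqrt; last by rewrite lee_fin; exact: (mulr_ge0 (ler0n _ 250) Q0).
rewrite (eq_bigr (fun a => (energy (g a))%:E)); last first.
  by move=> a aj; have [/inL2P[? ?] _ _] := hg a aj; exact: L2sq_energy.
rewrite sumEFin lee_fin.
apply: (@le_trans _ _ (\sum_(a : {ffun 'I_3 -> 'I_j.+1}) 2 * Q)).
  rewrite big_mkcond /=; apply: ler_sum => a _; case: ifPn => [aj|_].
    by have [] := hg a aj.
  by rewrite mulr_ge0.
rewrite sumr_const -[leLHS]mulr_natr.
have := card_mindex j4; rewrite -(ler_nat R) => h.
by rewrite mulrAC ler_wpM2r//; lra.
Qed.

Lemma sobolev_lim_eq n Q (u v : R3 R -> R) : (forall x, D x -> u x = v x) ->
  sobolev_lim rad n Q u -> sobolev_lim rad n Q v.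
Proof.
move=> uv [vm [e [sv ve e0]]]; exists vm, e; split => // m x Dx.
by rewrite -uv// ve.
Qed.

Definition numerator (M : R) N :=
  [/\ forall q s, (q < 6)%N -> is_derive s (1 : R) (N q) (N q.+1 s),
      forall s, 0 <= s -> s <= S0 -> `|N 6 s| <= M,
      forall j, (j < 6)%N -> `|N j 0| <= M, N 0 0 = 0 & N 4 0 = 0].

Lemma integrable_potential M N (F : R3 R -> R) x : 0 <= M -> numerator M N ->
  l2 mu setT F -> (forall y, ~ D y -> F y = 0) -> D x ->
  mu.-integrable setT (EFin \o (fun y => N 0 (enorm (x - y)) / enorm (x - y) * F y)).
Proof.
move=> M0 [dN N6 Nz N00 N40] lF FD Dx.
have S01 : 1 <= S0 by rewrite /S0 lerDr mulr_ge0 ?(ltW rad0).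
have mN0 : measurable_fun setT (fun z : R3 R => N 0 (enorm z) / enorm z).
  apply: measurable_funM; last exact: measurable_enorm_inv.
  by apply: measurable_enorm_comp => s; exact: (is_derive_continuous (dN 0%N s isT)).
have [iF _] := l2_off_integrable lF FD.
have b0 : 0 <= 300 * (M * S0 ^+ 5).
  exact: (mulr_ge0 (ler0n _ 300) (mulr_ge0 M0 (exprn_ge0 5 (le_trans ler01 S01)))).
apply: (@integrable_kernel _ _ _ _ (M * S0 + 300 * (M * S0 ^+ 5)) mN0 iF) => y Fy.
have s0 := enorm_ge0 (x - y).
have sS : enorm (x - y) <= S0.
  apply/ltW/(lt_le_trans (enormB_eball Dx _)); last by rewrite /S0 lerDl.
  by apply: contrapT => /FD Fy0; rewrite Fy0 eqxx in Fy.
move: s0; rewrite le_eqVlt => /orP[/eqP <-|s0].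
  by rewrite invr0 mulr0 normr0 addr_ge0// mulr_ge0// (le_trans ler01).
rewrite numerator_split// (le_trans (ler_normD _ _))// lerD//.
  rewrite normrM ler_pM// ?(gtr0_norm s0)//.
  by have := Nz 2%N isT; rewrite normrM [`|2^-1|]ger0_norm//; lra.
have := smooth_chain_bound dN M0 S01 N6 Nz (q := 0) isT s0 sS.
by rewrite /weight expr0 invr1 mulr1.
Qed.

Definition integrableC f :=
  mu.-integrable setT (EFin \o re f) /\ mu.-integrable setT (EFin \o im f).

Lemma CintegralD f g : integrableC f -> integrableC g ->
  integrableC (fun y => f y + g y) /\
  Cintegral setT (fun y => f y + g y) = Cintegral setT f + Cintegral setT g.
Proof.
move=> [fr fi] [gr gi]; split.
  split.
    apply: (integrableE _ _ (integrableRD _ fr gr)) => // y _; exact/esym/cReD.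
  by apply: (integrableE _ _ (integrableRD _ fi gi)) => // y _; exact/esym/cImD.
by apply: complex_ext => /=; rewrite -RintegralD//; apply: eq_Rintegral => y _;
  rewrite ?cReD ?cImD.
Qed.

Lemma CintegralZ (c : R[i]) f : integrableC f ->
  integrableC (fun y => c * f y) /\
  Cintegral setT (fun y => c * f y) = c * Cintegral setT f.
Proof.
move=> [fr fi].
have ar a : mu.-integrable setT (EFin \o (fun y => a * re f y)) by exact: integrableRZ.
have ai a : mu.-integrable setT (EFin \o (fun y => a * im f y)) by exact: integrableRZ.
split.
  split.
    by apply: (integrableE _ _ (integrableRB _ (ar (complex.Re c)) (ai (complex.Im c)))) => // y _;
      exact/esym/cReM.
  by apply: (integrableE _ _ (integrableRD _ (ai (complex.Re c)) (ar (complex.Im c)))) => // y _;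
    exact/esym/cImM.
apply: complex_ext; rewrite ?cReM ?cImM /= -!RintegralZl// -?RintegralB -?RintegralD//.
  by apply: eq_Rintegral => y _; rewrite cReM.
by apply: eq_Rintegral => y _; rewrite cImM.
Qed.

(** [P] is the numerator of the kernel; the inverse distance is kept as a separate real factor, so
    that real and imaginary parts split without touching it. *)
Definition potential (P : R -> R[i]) F x : R[i] :=
  Cintegral setT (fun y => P (enorm (x - y)) * ((enorm (x - y))^-1)%:C * F y).

Definition numeratorC M (N : nat -> R -> R[i]) :=
  numerator M (fun q s => complex.Re (N q s)) /\ numerator M (fun q s => complex.Im (N q s)).

Definition source F := [/\ l2 mu setT (re F), l2 mu setT (im F) & forall y, ~ D y -> F y = 0].

Lemma potential_integrable M (N : nat -> R -> R[i]) F x : 0 <= M -> numeratorC M N ->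
  source F -> D x ->
  integrableC (fun y => N 0%N (enorm (x - y)) * ((enorm (x - y))^-1)%:C * F y) /\
  potential (N 0%N) F x =
    (convol (fun z => complex.Re (N 0%N (enorm z)) / enorm z) (re F) x -
     convol (fun z => complex.Im (N 0%N (enorm z)) / enorm z) (im F) x) +i*
    (convol (fun z => complex.Re (N 0%N (enorm z)) / enorm z) (im F) x +
     convol (fun z => complex.Im (N 0%N (enorm z)) / enorm z) (re F) x).
Proof.
move=> M0 [nr ni] [lr li FD] Dx.
have FDr y : ~ D y -> re F y = 0 by move=> /FD /= ->.
have FDi y : ~ D y -> im F y = 0 by move=> /FD /= ->.
have rr := integrable_potential M0 nr lr FDr Dx.
have ri := integrable_potential M0 nr li FDi Dx.
have ir := integrable_potential M0 ni lr FDr Dx.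
have ii := integrable_potential M0 ni li FDi Dx.
split.
  split.
    by apply: (integrableE _ _ (integrableRB _ rr ii)) => // y _; rewrite /= cReM cReZ cImZ.
  by apply: (integrableE _ _ (integrableRD _ ri ir)) => // y _; rewrite /= cImM cReZ cImZ.
apply: complex_ext => /=; rewrite /convol -?RintegralB -?RintegralD//.
  by apply: eq_Rintegral => y _; rewrite cReM cReZ cImZ.
by apply: eq_Rintegral => y _; rewrite cImM cReZ cImZ.
Qed.

End ComplexOperator.

(** * The operator between two cut-offs *)

Section CutOperator.
Variable R : realType.
Notation mu := (@mu3 R).
Variable rad : R.
Hypothesis rad0 : 0 < rad.
Let D : set (R3 R) := eball rad.
Let mD : measurable D := measurable_eball rad.
Let muD : (mu D < +oo)%E := mu_eball rad.
Implicit Types (f g u F : R3 R -> R[i]).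
Local Notation re f := (fun x => complex.Re (f x)).
Local Notation im f := (fun x => complex.Im (f x)).
Local Notation normc := (@Normc.normc R).

Lemma l2_extend (p : R3 R -> R) : l2 mu D p -> (forall x, ~ D x -> p x = 0) ->
  l2 mu setT p /\ inner mu setT p p = inner mu D p p.
Proof.
move=> [mp ip] pD.
have restr (q : R3 R -> R) : (forall x, ~ D x -> q x = 0) -> q \_ D = q.
  move=> qD; apply/funext => x; rewrite patchE; case: ifPn => // /negP xD.
  by rewrite qD// => h; apply: xD; rewrite mem_set.
split; last by rewrite inner_off.
have mpT : measurable_fun setT (p \_ D) := (measurable_restrictT p mD).1 mp.
split; first by rewrite -(restr p pD).
have p2D x : ~ D x -> p x ^+ 2 = 0 by move=> /pD ->; rewrite expr0n.
have -> : (fun x => (p x ^+ 2)%:E) = EFin \o ((fun x => p x ^+ 2) \_ D).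
  by rewrite restr.
by rewrite -restrict_EFin; exact/(integrable_mkcond _ mD).1.
Qed.

Lemma Cc_infty_bounded (rho : R3 R -> R) : Cc_infty D rho ->
  measurable_fun D rho /\ exists2 B : R, 0 <= B & forall x, `|rho x| <= B.
Proof.
move=> crho; have [A rA] := Cc_infty_vanish crho.
have crho' := smooth_continuous (let: And3 s _ _ := crho in s).
have [B [B0 hB]] := bounded_on_cube A crho'.
split; first by apply: measurable_funTS; exact: continuous_measurable.
exists B => // x; have [xA|/rA ->] := pselect (cube A x); [exact: hB|by rewrite normr0].
Qed.

Variable rho : R3 R -> R[i].
Hypothesis crho : Cc_inftyC D rho.

Let rho_off y : ~ D y -> rho y = 0.
Proof.
case: crho => cr ci yD.
by apply: complex_ext; rewrite /=; [exact: Cc_infty_off cr yD|exact: Cc_infty_off ci yD].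
Qed.

Lemma source_cut : exists2 B : R, 0 <= B & forall f, inL2 D f ->
  [/\ source rad (fun y => rho y * f y),
   inner mu setT (re (fun y => rho y * f y)) (re (fun y => rho y * f y)) <= B * energy rad f &
   inner mu setT (im (fun y => rho y * f y)) (im (fun y => rho y * f y)) <= B * energy rad f].
Proof.
case: crho => cr ci.
have [mr [Br Br0 hr]] := Cc_infty_bounded cr; have [mi [Bi Bi0 hi]] := Cc_infty_bounded ci.
exists (2 * (Br ^+ 2 + Bi ^+ 2)); first by rewrite mulr_ge0// addr_ge0// sqr_ge0.
move=> f /inL2P[lr li].
have [l1 b1] := l2_bounded_mul mD mr (fun x _ => hr x) lr.
have [l2' b2] := l2_bounded_mul mD mi (fun x _ => hi x) li.
have [l3 b3] := l2_bounded_mul mD mr (fun x _ => hr x) li.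
have [l4 b4] := l2_bounded_mul mD mi (fun x _ => hi x) lr.
have er : re (fun y => rho y * f y) =
    fun y => complex.Re (rho y) * complex.Re (f y) - complex.Im (rho y) * complex.Im (f y).
  by apply/funext => y; rewrite cReM.
have ei : im (fun y => rho y * f y) =
    fun y => complex.Re (rho y) * complex.Im (f y) + complex.Im (rho y) * complex.Re (f y).
  by apply/funext => y; rewrite cImM.
have off y : ~ D y -> rho y * f y = 0 by move=> /rho_off ->; rewrite mul0r.
have [lR bR] : l2 mu setT (re (fun y => rho y * f y)) /\
    inner mu setT (re (fun y => rho y * f y)) (re (fun y => rho y * f y)) =
    inner mu D (re (fun y => rho y * f y)) (re (fun y => rho y * f y)).
  apply: l2_extend; last by move=> y /off ->.
  by rewrite er; exact: l2B.
have [lI bI] : l2 mu setT (im (fun y => rho y * f y)) /\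
    inner mu setT (im (fun y => rho y * f y)) (im (fun y => rho y * f y)) =
    inner mu D (im (fun y => rho y * f y)) (im (fun y => rho y * f y)).
  apply: l2_extend; last by move=> y /off ->.
  by rewrite ei; exact: l2D.
have Er0 := inner_ge0 mu D (re f); have Ei0 := inner_ge0 mu D (im f).
have cross1 : 0 <= Br ^+ 2 * inner mu D (im f) (im f) by rewrite mulr_ge0// sqr_ge0.
have cross2 : 0 <= Bi ^+ 2 * inner mu D (re f) (re f) by rewrite mulr_ge0// sqr_ge0.
have cross3 : 0 <= Br ^+ 2 * inner mu D (re f) (re f) by rewrite mulr_ge0// sqr_ge0.
have cross4 : 0 <= Bi ^+ 2 * inner mu D (im f) (im f) by rewrite mulr_ge0// sqr_ge0.
split; [by split|rewrite bR er|rewrite bI ei]; rewrite /energy.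
  rewrite innerBl ?innerBr//; [|exact: l2B..].
  have := inner_young mD l1 l2'.
  rewrite (innerC _ _ (fun x => _ * complex.Im (f x)) (fun x => _ * complex.Re (f x))).
  have := ler_norm (- inner mu D (fun x => complex.Re (rho x) * complex.Re (f x))
    (fun x => complex.Im (rho x) * complex.Im (f x))); rewrite normrN.
  lra.
rewrite innerDl ?innerDr//; [|exact: l2D..].
have := inner_young mD l3 l4.
rewrite (innerC _ _ (fun x => complex.Im (rho x) * complex.Re (f x))
  (fun x => complex.Re (rho x) * complex.Im (f x))).
have := ler_norm (inner mu D (fun x => complex.Re (rho x) * complex.Im (f x))
    (fun x => complex.Im (rho x) * complex.Re (f x))).
lra.
Qed.

Let sobolev_limB n Q (p q : R3 R -> R) : sobolev_lim rad n Q p -> sobolev_lim rad n Q q ->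
  sobolev_lim rad n (4 * Q) (fun x => p x - q x).
Proof.
move=> su sv; have := sobolev_limD su (sobolev_limZ (-1) sv).
rewrite sqrrN expr1n mul1r => h; apply: sobolev_lim_eq (sobolev_lim_le _ h).
  by move=> x _; rewrite mulN1r.
by rewrite (_ : 2 * (Q + Q) = 4 * Q)//; ring.
Qed.

(** All [j <= 4] are covered by the bounds of order four. The linearity in [M] is what later turns a
    numerator of size [O(|h|)] into convergence of the difference quotients in operator norm. *)
Lemma cut_estimate : exists2 C : R, 0 <= C & forall M N f u j, 0 <= M ->
  numeratorC rad M N -> inL2 D f -> (j <= 4)%N ->
  (forall x, D x -> u x = rho x * potential (N 0%N) (fun y => rho y * f y) x) ->
  (Hnorm D j u <= (C * M)%:E * L2norm D f)%E.
Proof.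
have [B B0 hB] := source_cut; have [C1 C10 h1] := numerator_estimate rad0.
case: crho => cr ci.
have [Cr Cr0 hr] := sobolev_limM 4 cr; have [Ci Ci0 hi] := sobolev_limM 4 ci.
(* One factor 4 comes from combining real and imaginary parts in the potential, the other from the
   multiplication by the complex [rho]. *)
pose A := 16 * (Cr + Ci) * C1 * B.
have A0 : 0 <= A by rewrite !mulr_ge0// addr_ge0.
exists (Num.sqrt (250 * A)); first exact: sqrtr_ge0.
move=> M N f u j M0 nN fD j4 uE.
have [sF bR bI] := hB f fD; set F := fun y => rho y * f y in uE sF bR bI.
have [lr li FD] := sF; have [nr ni] := nN.
have FDr y : ~ D y -> re F y = 0 by move=> /FD /= ->.
have FDi y : ~ D y -> im F y = 0 by move=> /FD /= ->.
set E := energy rad f in bR bI; have E0 : 0 <= E := energy_ge0 _ _.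
pose q := C1 * M ^+ 2 * (B * E).
have q0 : 0 <= q by rewrite !mulr_ge0// sqr_ge0.
have key (K : nat -> R -> R) (p : R3 R -> R) : numerator rad M K -> l2 mu setT p ->
    (forall y, ~ D y -> p y = 0) -> inner mu setT p p <= B * E ->
    sobolev_lim rad 4 q (convol (fun z => K 0 (enorm z) / enorm z) p).
  move=> [k1 k2 k3 k4 k5] lp pD pE.
  apply: sobolev_lim_le (h1 M K p M0 k1 k2 k3 k4 k5 lp pD).
  by rewrite /q ler_wpM2l// mulr_ge0// sqr_ge0.
have rr := key _ _ nr lr FDr bR; have ri := key _ _ nr li FDi bI.
have ir := key _ _ ni lr FDr bR; have ii := key _ _ ni li FDi bI.
have VE x : D x -> _ := fun Dx => (potential_integrable rad0 M0 nN sF Dx).2.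
have sVr : sobolev_lim rad 4 (4 * q) (re (potential (N 0%N) F)).
  apply: sobolev_lim_eq (sobolev_limB rr ii) => x Dx.
  by rewrite VE.
have sVi : sobolev_lim rad 4 (4 * q) (im (potential (N 0%N) F)).
  apply: sobolev_lim_eq (sobolev_lim_le _ (sobolev_limD ri ir)) => [x Dx|].
    by rewrite VE.
  by rewrite (_ : 4 * q = 2 * (q + q))//; ring.
have q40 : 0 <= 4 * q by rewrite mulr_ge0.
have le1 : Cr * (4 * q) <= (Cr + Ci) * (4 * q) by rewrite ler_wpM2r// lerDl.
have le2 : Ci * (4 * q) <= (Cr + Ci) * (4 * q) by rewrite ler_wpM2r// lerDr.
have Qe : 4 * ((Cr + Ci) * (4 * q)) = A * (M ^+ 2 * E) by rewrite /q /A; ring.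
have sur : sobolev_lim rad 4 (A * (M ^+ 2 * E)) (re u).
  rewrite -Qe; apply: sobolev_lim_eq (sobolev_limB (sobolev_lim_le le1 (hr _ _ q40 sVr))
    (sobolev_lim_le le2 (hi _ _ q40 sVi))) => x Dx.
  by rewrite uE// cReM.
have sui : sobolev_lim rad 4 (A * (M ^+ 2 * E)) (im u).
  rewrite -Qe; apply: sobolev_lim_eq (sobolev_lim_le _ (sobolev_limD
    (sobolev_lim_le le1 (hr _ _ q40 sVi)) (sobolev_lim_le le2 (hi _ _ q40 sVr)))) => [x Dx|].
    by rewrite uE// cImM.
  by move: ((Cr + Ci) * (4 * q)) => t; lra.
have M2 : 0 <= M ^+ 2 := sqr_ge0 M.
have AME0 : 0 <= A * (M ^+ 2 * E) by rewrite mulr_ge0// mulr_ge0.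
apply: (le_trans (Hnorm_le j4 AME0 sur sui)).
rewrite L2norm_energy// -EFinM lee_fin -/E.
rewrite (_ : 250 * (A * (M ^+ 2 * E)) = 250 * A * (M ^+ 2 * E)); last by ring.
have A2500 : 0 <= 250 * A := mulr_ge0 (ler0n _ 250) A0.
by rewrite (sqrtrM _ A2500) (sqrtrM _ M2) sqrtr_sqr (ger0_norm M0) mulrA.
Qed.

Lemma cut_linear M (N : nat -> R -> R[i]) c f g x : 0 <= M -> numeratorC rad M N ->
  inL2 D f -> inL2 D g -> D x ->
  rho x * potential (N 0%N) (fun y => rho y * (c * f y + g y)) x =
  c * (rho x * potential (N 0%N) (fun y => rho y * f y) x) +
  rho x * potential (N 0%N) (fun y => rho y * g y) x.
Proof.
move=> M0 nN fD gD Dx; have [B _ hB] := source_cut.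
have [sf _ _] := hB f fD; have [sg _ _] := hB g gD.
have [intf _] := potential_integrable rad0 M0 nN sf Dx.
have [intg _] := potential_integrable rad0 M0 nN sg Dx.
have [icf ecf] := CintegralZ c intf; have [_ e] := CintegralD icf intg.
rewrite /potential mulrCA -ecf -mulrDr -e; congr (_ * Cintegral _ _).
by apply/funext => y; ring.
Qed.

(** Combining the numerators before estimating lets the cancellation in a difference quotient take
    place inside the kernel. *)
Lemma potential_sum (I : Type) (r : seq I) (a : I -> R[i]) (M : I -> R)
    (N : I -> nat -> R -> R[i]) f x :
  (forall i, 0 <= M i) -> (forall i, numeratorC rad (M i) (N i)) -> inL2 D f -> D x ->
  \sum_(i <- r) a i * potential (N i 0%N) (fun y => rho y * f y) x =
  potential (fun s => \sum_(i <- r) a i * N i 0%N s) (fun y => rho y * f y) x.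
Proof.
move=> M0 nN fD Dx; have [B _ hB] := source_cut; have [sf _ _] := hB f fD.
pose k P y : R[i] := P (enorm (x - y)) * ((enorm (x - y))^-1)%:C * (rho y * f y).
suff [_ e] : integrableC (k (fun s => \sum_(i <- r) a i * N i 0%N s)) /\
    Cintegral setT (k (fun s => \sum_(i <- r) a i * N i 0%N s)) =
    \sum_(i <- r) a i * Cintegral setT (k (N i 0%N)).
  exact: (esym e).
elim: r => [|i r [ih1 ih2]].
  have -> : k (fun s => \sum_(i <- [::]) a i * N i 0%N s) = fun=> 0.
    by apply/funext => y; rewrite /k big_nil !mul0r.
  rewrite big_nil /integrableC /=; split.
    by split; exact: integrable0.
  by apply: complex_ext; rewrite /= /Rintegral integral0.
have [ii _] := potential_integrable rad0 (M0 i) (nN i) sf Dx.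
have [ia ea] := CintegralZ (a i) ii; have [is' es] := CintegralD ia ih1.
rewrite big_cons -ih2 -[X in X + _]ea -es.
by have -> : k (fun s => \sum_(j <- i :: r) a j * N j 0%N s) = fun y =>
    a i * (N i 0%N (enorm (x - y)) * ((enorm (x - y))^-1)%:C * (rho y * f y)) +
    k (fun s => \sum_(j <- r) a j * N j 0%N s) y
  by apply/funext => y; rewrite /k big_cons; ring.
Qed.

End CutOperator.

(** * Expansions in the spectral parameter *)

Section ComplexExponential.
Variable R : realType.
Implicit Types (z w a b : R[i]) (s t : R) (f g : R -> R[i]).
Local Notation normc := (@Normc.normc R).

Lemma normc_addM a b (A B : R) : normc a <= A -> normc b <= B -> normc (a + b) <= A + B.
Proof. by move=> h1 h2; rewrite (le_trans (le_normcD _ _))// lerD. Qed.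

Lemma normc_mulM a b (A B : R) : normc a <= A -> normc b <= B -> normc (a * b) <= A * B.
Proof. by move=> h1 h2; rewrite Normc.normcM ler_pM// normc_ge0. Qed.

Lemma normc_oppM a (A : R) : normc a <= A -> normc (- a) <= A.
Proof. by rewrite normcN. Qed.

Lemma normcX a n : normc (a ^+ n) = normc a ^+ n.
Proof. by elim: n => [|n ih]; rewrite ?expr0 ?Normc.normc1// !exprS Normc.normcM ih. Qed.

Lemma normc_real s : normc s%:C = `|s|.
Proof. by rewrite /= expr0n addr0 sqrtr_sqr. Qed.

Lemma normc_le_parts z : normc z <= `|complex.Re z| + `|complex.Im z|.
Proof.
rewrite -ler_sqr ?nnegrE ?normc_ge0 ?addr_ge0// normc_sqr sqrrD !real_normK ?num_real//.
by rewrite lerD2r lerDl mulrn_wge0// mulr_ge0.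
Qed.

Definition cder s f a : Prop :=
  is_derive s (1 : R) (fun t => complex.Re (f t)) (complex.Re a) /\
  is_derive s (1 : R) (fun t => complex.Im (f t)) (complex.Im a).

Lemma cder_eq s f g a b : (forall t, f t = g t) -> a = b -> cder s f a -> cder s g b.
Proof. by move=> /funext -> ->. Qed.

Lemma cderC s a : cder s (fun=> a) 0.
Proof. by split; exact: derC. Qed.

Lemma cderD s f g a b : cder s f a -> cder s g b -> cder s (fun t => f t + g t) (a + b).
Proof.
move=> [f1 f2] [g1 g2]; split.
  by rewrite cReD; under eq_fun do rewrite cReD; exact: derD.
by rewrite cImD; under eq_fun do rewrite cImD; exact: derD.
Qed.

Lemma cderM s f g a b : cder s f a -> cder s g b ->
  cder s (fun t => f t * g t) (a * g s + f s * b).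
Proof.
move=> [f1 f2] [g1 g2]; split.
  under eq_fun do rewrite cReM.
  by apply: der_eq (derB (derM f1 g1) (derM f2 g2)) _; rewrite cReD !cReM; ring.
under eq_fun do rewrite cImM.
by apply: der_eq (derD (derM f1 g2) (derM f2 g1)) _; rewrite cImD !cImM; ring.
Qed.

Lemma cderZ s c f a : cder s f a -> cder s (fun t => c * f t) (c * a).
Proof. by move=> h; apply: cder_eq (cderM (cderC s c) h) => //; rewrite mul0r add0r. Qed.

Lemma cder_real s : cder s (fun t => t%:C) 1.
Proof. by split; [exact: der_id|exact: derC]. Qed.

Lemma cexp_line z s : cder s (fun t => cexp (z * t%:C)) (z * cexp (z * s%:C)).
Proof.
have lin c : is_derive s (1 : R) (fun t => c * t) c.
  by apply: der_eq (derZ c (der_id s)) _; rewrite mulr1.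
have de : is_derive s (1 : R) (fun t => expR (complex.Re z * t))
    (expR (complex.Re z * s) * complex.Re z).
  exact: (@der1_comp R expR _ s _ _ (is_derive_expR _) (lin _)).
have dc : is_derive s (1 : R) (fun t => cos (complex.Im z * t))
    (- sin (complex.Im z * s) * complex.Im z).
  exact: (@der1_comp R cos _ s _ _ (is_derive_cos _) (lin _)).
have ds : is_derive s (1 : R) (fun t => sin (complex.Im z * t))
    (cos (complex.Im z * s) * complex.Im z).
  exact: (@der1_comp R sin _ s _ _ (is_derive_sin _) (lin _)).
have cE t : cexp (z * t%:C) = (expR (complex.Re z * t) * cos (complex.Im z * t)) +i*
    (expR (complex.Re z * t) * sin (complex.Im z * t)).
  rewrite /cexp cReZ cImZ; apply: complex_ext; rewrite ?cReM ?cImM /=; ring.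
split; under eq_fun do rewrite cE; rewrite cE ?cReM ?cImM /=.
  by apply: der_eq (derM de dc) _; ring.
by apply: der_eq (derM de ds) _; ring.
Qed.

Lemma cexpD z w : cexp (z + w) = cexp z * cexp w.
Proof.
rewrite /cexp cReD cImD expRD cosD sinD.
by apply: complex_ext; rewrite !(cReM, cImM) /=; ring.
Qed.

Lemma cexp0 : cexp 0 = 1 :> R[i].
Proof. by apply: complex_ext; rewrite /cexp /= expR0 cos0 sin0; ring. Qed.

Lemma normc_cexp z : normc (cexp z) = expR (complex.Re z).
Proof.
rewrite /cexp Normc.normcM normc_real ger0_norm ?expR_ge0//.
by rewrite /= cos2Dsin2 sqrtr1 mulr1.
Qed.

(** The mean value theorem is applied to the real and the imaginary part separately, whence the
    factor 2. *)
Lemma normc_mvt f (f' : R -> R[i]) (B : R) : (forall t, cder t f (f' t)) ->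
  (forall t, 0 <= t -> t <= 1 -> normc (f' t) <= B) -> normc (f 1 - f 0) <= 2 * B.
Proof.
move=> df fB.
have part (p p' : R -> R) : (forall t, is_derive t (1 : R) p (p' t)) ->
    (forall t, 0 <= t -> t <= 1 -> `|p' t| <= B) -> `|p 1 - p 0| <= B.
  move=> dp pB; have c : {within `[0, 1], continuous p}.
    by apply: derivable_within_continuous => t _; case: (dp t).
  have [t] := MVT_segment ler01 (fun t _ => dp t) c.
  by rewrite in_itv/= => /andP[t0 t1] ->; rewrite subr0 mulr1 pB.
apply: (le_trans (normc_le_parts _)); rewrite cReD cImD cReN cImN.
rewrite mulr_natl mulr2n lerD//.
  apply: (part (fun t => complex.Re (f t)) (fun t => complex.Re (f' t)))
    => [t|t t0 t1]; first by case: (df t).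
  exact: le_trans (Re_le_normc _) (fB t t0 t1).
apply: (part (fun t => complex.Im (f t)) (fun t => complex.Im (f' t)))
  => [t|t t0 t1]; first by case: (df t).
exact: le_trans (Im_le_normc _) (fB t t0 t1).
Qed.

(** The mean value inequality is used twice: for [cexp (w t) - 1], and then for [cexp (w t) - w t],
    whose derivative is [w] times the former. *)
Lemma cexp_expand w : normc w <= 1 -> normc (cexp w - 1 - w) <= 4 * expR 1 * normc w ^+ 2.
Proof.
move=> w1; have n0 := normc_ge0 w.
have first t : 0 <= t -> t <= 1 -> normc (cexp (w * t%:C) - 1) <= 2 * (normc w * expR 1).
  move=> t0 t1; have := @normc_mvt (fun u => cexp (w * t%:C * u%:C))
    (fun u => w * t%:C * cexp (w * t%:C * u%:C)) (normc w * expR 1)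
    (fun u => cexp_line _ _).
  rewrite (_ : w * t%:C * 1%:C = w * t%:C); last by rewrite mulr1.
  rewrite (_ : w * t%:C * 0%:C = 0); last by rewrite mulr0.
  rewrite cexp0; apply=> u u0 u1; apply: normc_mulM.
    by rewrite Normc.normcM normc_real ger0_norm// ler_piMr.
  rewrite normc_cexp ler_expR !cReZ -mulrA.
  have tu1 : t * u <= 1 by rewrite mulr_ile1.
  apply: (le_trans (ler_norm _)); rewrite normrM [`|t * u|]ger0_norm ?mulr_ge0//.
  by rewrite mulr_ile1// ?mulr_ge0// (le_trans (Re_le_normc _)).
have d t : cder t (fun u => cexp (w * u%:C) + (- w) * u%:C)
    (w * cexp (w * t%:C) + (- w) * 1).
  by apply: cderD; [exact: cexp_line|apply: cderZ; exact: cder_real].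
have := normc_mvt d (B := normc w * (2 * (normc w * expR 1))).
have -> : cexp (w * 1%:C) + - w * 1%:C - (cexp (w * 0%:C) + - w * 0%:C) = cexp w - 1 - w.
  by rewrite rmorph1 rmorph0 !mulr1 !mulr0 cexp0; ring.
move=> h; apply: (le_trans (h _)) => [t t0 t1|].
  rewrite mulr1 (_ : _ + - w = w * (cexp (w * t%:C) - 1)); last by ring.
  by apply: normc_mulM => //; exact: first.
by rewrite le_eqVlt; apply/orP; left; apply/eqP; ring.
Qed.

(** The q-th derivative of [e^(zs)] in [s]. *)
Definition expz z q s : R[i] := z ^+ q * cexp (z * s%:C).
(** The derivative of [expz z q s] in [z]; for [q = 0] the truncated predecessor is harmless because
    of the factor [q]. *)
Definition dexpz z q s : R[i] :=
  z ^+ q * s%:C * cexp (z * s%:C) + q%:R * z ^+ q.-1 * cexp (z * s%:C).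

Lemma cder_expz z q s : cder s (expz z q) (expz z q.+1 s).
Proof. by apply: cder_eq (cderZ (z ^+ q) (cexp_line z s)) => //; rewrite /expz exprS; ring. Qed.

Lemma cder_dexpz z q s : cder s (dexpz z q) (dexpz z q.+1 s).
Proof.
apply: cder_eq (cderD (cderM (cderZ (z ^+ q) (cder_real s)) (cexp_line z s))
  (cderZ (q%:R * z ^+ q.-1) (cexp_line z s))) => //.
by case: q => [|q]; rewrite /dexpz /= ?expr0 ?exprS -?natr1; ring.
Qed.

End ComplexExponential.

Section Expansions.
Variables (R : realType) (S0 : R).
Hypothesis S01 : 1 <= S0.
Implicit Types (g : R[i] -> R -> R[i]) (dg : R -> R[i]) (k h : R[i]) (s : R).
Local Notation normc := (@Normc.normc R).

(** Complex differentiability at [k] with a quadratic remainder, uniformly in the distance [s].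
    Boundedness of the value and of the derivative is included so that the notion passes through
    products; the quadratic rate survives the division by [h] as a factor [|h|]. *)
Definition expands g dg k := exists C eta : R, [/\ 0 <= C, 0 < eta & forall s h,
  0 <= s -> s <= S0 -> normc h < eta ->
  [/\ normc (g k s) <= C, normc (dg s) <= C &
      normc (g (k + h) s - g k s - h * dg s) <= C * normc h ^+ 2]].

Lemma expands_small g dg k : expands g dg k -> exists C eta : R,
  [/\ 0 <= C, 0 < eta, eta <= 1 & forall s h,
  0 <= s -> s <= S0 -> normc h < eta ->
  [/\ normc (g k s) <= C, normc (dg s) <= C,
      normc (g (k + h) s - g k s - h * dg s) <= C * normc h ^+ 2,
      normc (g (k + h) s) <= 3 * C & normc (g (k + h) s - g k s) <= 2 * C * normc h]].
Proof.
move=> [C [eta [C0 e0 hC]]]; exists C, (Num.min eta 1); split => //.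
- by rewrite lt_min e0 ltr01.
- by rewrite ge_min lexx orbT.
move=> s h s0 sS; rewrite lt_min => /andP[he h1].
have [b1 b2 b3] := hC s h s0 sS he; have n0 := normc_ge0 h.
have h2 : normc h ^+ 2 <= normc h by rewrite expr2 ler_piMr// ltW.
have b4 : normc (g (k + h) s - g k s) <= 2 * C * normc h.
  have -> : g (k + h) s - g k s = (g (k + h) s - g k s - h * dg s) + h * dg s by ring.
  apply: (le_trans (normc_addM b3 (normc_mulM (lexx _) b2))).
  have : C * normc h ^+ 2 <= C * normc h by rewrite ler_wpM2l.
  rewrite (mulrC (normc h)); lra.
split => //.
have -> : g (k + h) s = (g (k + h) s - g k s) + g k s by ring.
apply: (le_trans (normc_addM b4 b1)).
have : C * normc h <= C * 1 by rewrite ler_wpM2l// ltW.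
lra.
Qed.

Lemma expands_eq g dg g' dg' k : (forall k s, g k s = g' k s) -> (forall s, dg s = dg' s) ->
  expands g dg k -> expands g' dg' k.
Proof.
move=> gg dd [C [eta [C0 e0 hC]]]; exists C, eta; split => // s h s0 sS he.
by rewrite -!gg -dd; exact: hC.
Qed.

Lemma expands_cst (c : R -> R[i]) (B : R) k : (forall s, 0 <= s -> s <= S0 -> normc (c s) <= B) ->
  expands (fun=> c) (fun=> 0) k.
Proof.
move=> cB; have B0 : 0 <= B.
  by apply: le_trans (cB 0 (lexx _) _); [exact: normc_ge0|exact: le_trans S01].
exists B, 1; split => // s h s0 sS _; split; first exact: cB.
  by rewrite Normc.normc0.
by rewrite mulr0 subr0 subrr Normc.normc0 mulr_ge0// sqr_ge0.
Qed.

Lemma expandsD g1 g2 d1 d2 k : expands g1 d1 k -> expands g2 d2 k ->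
  expands (fun k s => g1 k s + g2 k s) (fun s => d1 s + d2 s) k.
Proof.
move=> [C1 [e1 [C10 e10 h1]]] [C2 [e2 [C20 e20 h2]]].
exists (C1 + C2), (Num.min e1 e2); split; [exact: addr_ge0|by rewrite lt_min e10|].
move=> s h s0 sS; rewrite lt_min => /andP[he1 he2].
have [a1 a2 a3] := h1 s h s0 sS he1; have [b1 b2 b3] := h2 s h s0 sS he2.
split; [exact: normc_addM|exact: normc_addM|].
have -> : g1 (k + h) s + g2 (k + h) s - (g1 k s + g2 k s) - h * (d1 s + d2 s) =
  (g1 (k + h) s - g1 k s - h * d1 s) + (g2 (k + h) s - g2 k s - h * d2 s) by ring.
by rewrite mulrDl; exact: normc_addM.
Qed.

Lemma expandsM g1 g2 d1 d2 k : expands g1 d1 k -> expands g2 d2 k ->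
  expands (fun k s => g1 k s * g2 k s) (fun s => d1 s * g2 k s + g1 k s * d2 s) k.
Proof.
move=> /expands_small[C1 [e1 [C10 e10 _ h1]]] /expands_small[C2 [e2 [C20 e20 _ h2]]].
have C12 : 0 <= C1 * C2 by exact: mulr_ge0.
exists (6 * (C1 * C2)), (Num.min e1 e2); split; [by rewrite mulr_ge0|by rewrite lt_min e10|].
move=> s h s0 sS; rewrite lt_min => /andP[he1 he2].
have [a1 a2 a3 a4 _] := h1 s h s0 sS he1; have [b1 b2 b3 b4 _] := h2 s h s0 sS he2.
split.
- apply: (le_trans (normc_mulM a1 b1)); lra.
- apply: (le_trans (normc_addM (normc_mulM a2 b1) (normc_mulM a1 b2))); lra.
have -> : g1 (k + h) s * g2 (k + h) s - g1 k s * g2 k s - h * (d1 s * g2 k s + g1 k s * d2 s) =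
  ((g1 (k + h) s - g1 k s - h * d1 s) * g2 (k + h) s + h * (h * (d1 s * d2 s))) +
  (g1 k s + h * d1 s) * (g2 (k + h) s - g2 k s - h * d2 s) + (- (h * d1 s)) *
  (g2 (k + h) s - g2 k s - h * d2 s) + h * d1 s * (g2 (k + h) s - g2 k s - h * d2 s) by ring.
have -> : ((g1 (k + h) s - g1 k s - h * d1 s) * g2 (k + h) s + h * (h * (d1 s * d2 s))) +
  (g1 k s + h * d1 s) * (g2 (k + h) s - g2 k s - h * d2 s) + (- (h * d1 s)) *
  (g2 (k + h) s - g2 k s - h * d2 s) + h * d1 s * (g2 (k + h) s - g2 k s - h * d2 s) =
  (g1 (k + h) s - g1 k s - h * d1 s) * g2 (k + h) s +
  (g1 k s * (g2 (k + h) s - g2 k s - h * d2 s) + h * d1 s * (g2 (k + h) s - g2 k s)) by ring.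
have [_ _ _ _ b5] := h2 s h s0 sS he2.
have n0 := lexx (normc h).
apply: (le_trans (normc_addM (normc_mulM a3 b4) (normc_addM (normc_mulM a1 b3)
  (normc_mulM (normc_mulM n0 a2) b5)))).
by rewrite le_eqVlt; apply/orP; left; apply/eqP; ring.
Qed.

Lemma expandsX g dg n k : expands g dg k ->
  expands (fun k s => g k s ^+ n) (fun s => n%:R * g k s ^+ n.-1 * dg s) k.
Proof.
move=> eg; elim: n => [|n ih].
  apply: (expands_eq (g := fun=> fun=> 1) (dg := fun=> 0)) => [k' s|s|].
  - by rewrite expr0.
  - by rewrite !mul0r.
  by apply: (@expands_cst _ 1) => s _ _; rewrite Normc.normc1.
apply: expands_eq (expandsM eg ih) => [k' s|s] /=; first by rewrite exprS.
by case: n {ih} => [|n] /=; rewrite ?expr0 ?exprS -?natr1; ring.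
Qed.

Lemma expands_inv (g : R[i] -> R[i]) (dg : R[i]) k : g k != 0 ->
  expands (fun k _ => g k) (fun=> dg) k ->
  expands (fun k _ => (g k)^-1) (fun=> - dg / g k ^+ 2) k.
Proof.
move=> gk /expands_small[C [e [C0 e0 _ hC]]].
pose m := normc (g k).
have m0 : 0 < m.
  rewrite lt_neqAle normc_ge0 andbT eq_sym; apply: contra_neq gk; exact: Normc.eq0_normc.
have S00 : (0 : R) <= S0 by exact: le_trans S01.
(* This radius keeps [|g (k+h) - g k|] below [m/2], hence [|g (k+h)|] above [m/2]. *)
pose eta := Num.min e (m / (4 * (C + 1))).
pose B := m^-1 + C / m ^+ 2 + (2 * (C * m + 2 * C ^+ 2)) / m ^+ 3.
have Ci : 0 <= C * m + 2 * C ^+ 2 by rewrite addr_ge0// mulr_ge0// ?sqr_ge0// ltW.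
have t1 : 0 <= m^-1 by rewrite invr_ge0 ltW.
have t2 : 0 <= C / m ^+ 2 by rewrite divr_ge0// sqr_ge0.
have t3 : 0 <= (2 * (C * m + 2 * C ^+ 2)) / m ^+ 3.
  by rewrite divr_ge0 ?(exprn_ge0 3 (ltW m0))// mulr_ge0.
exists B, eta; split.
- by rewrite /B !addr_ge0.
- by rewrite lt_min e0 divr_gt0// mulr_gt0// ltr_wpDl.
move=> s h s0 sS; rewrite lt_min => /andP[he1 he2].
have [_ a2 a3 a4 a5] := hC s h s0 sS he1.
have n0 := normc_ge0 h.
have small : 2 * C * normc h <= m / 2.
  have h4 : normc h * (4 * (C + 1)) < m by rewrite -ltr_pdivlMr// mulr_gt0// ltr_wpDl.
  have : 0 <= normc h by []. lra.
have u0 : m / 2 <= normc (g (k + h)).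
  have := le_normcD (g (k + h)) (- (g (k + h) - g k)).
  have -> : g (k + h) - (g (k + h) - g k) = g k by ring.
  rewrite normcN -/m => h5; lra.
have up : 0 < normc (g (k + h)) by apply: lt_le_trans u0; rewrite divr_gt0.
have un : g (k + h) != 0.
  by apply: contraTneq up => ->; rewrite Normc.normc0 ltxx.
split.
- by rewrite Normc.normcV -/m /B -addrA lerDl addr_ge0.
- rewrite Normc.normcM Normc.normcV normcN normcX -/m.
  apply: (@le_trans _ _ (C / m ^+ 2)); last by rewrite /B; lra.
  by rewrite ler_wpM2r// invr_ge0 sqr_ge0.
have -> : (g (k + h))^-1 - (g k)^-1 - h * (- dg / g k ^+ 2) =
  (- (g (k + h) - g k - h * dg) * g k + h * dg * (g (k + h) - g k)) * (g (k + h) * g k ^+ 2)^-1.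
  by field; rewrite gk un.
rewrite Normc.normcM Normc.normcV Normc.normcM normcX -/m.
rewrite ler_pdivrMr; last by rewrite mulr_gt0// exprn_gt0.
apply: (le_trans (normc_addM (normc_mulM (normc_oppM a3) (lexx _))
  (normc_mulM (normc_mulM (lexx _) a2) a5))); rewrite -/m.
apply: (@le_trans _ _ ((2 * (C * m + 2 * C ^+ 2)) / m ^+ 3 * normc h ^+ 2 * (m / 2 * m ^+ 2))).
  rewrite le_eqVlt; apply/orP; left; apply/eqP; field; exact: lt0r_neq0.
have m2 : 0 <= m ^+ 2 := sqr_ge0 m.
apply: ler_pM.
- by rewrite mulr_ge0// sqr_ge0.
- by rewrite mulr_ge0// divr_ge0// ltW.
- by rewrite ler_wpM2r ?sqr_ge0// /B lerDr addr_ge0.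
- by rewrite ler_wpM2r.
Qed.

(** The sign condition at [k] gives [|cexp (g k s)| <= 1]. At [k + h] the exponential is this factor
    times [cexp w] with a small increment [w], to which [cexp_expand] applies. *)
Lemma expands_exp (g : R[i] -> R[i]) (dg : R[i]) k : complex.Re (g k) <= 0 ->
  expands (fun k _ => g k) (fun=> dg) k ->
  expands (fun k s => cexp (g k * s%:C)) (fun s => s%:C * dg * cexp (g k * s%:C)) k.
Proof.
move=> gk /expands_small[C [e [C0 e0 _ hC]]].
have S00 : (0 : R) <= S0 by exact: le_trans S01.
pose a : R := expR 1; have a0 : 0 <= a by exact: expR_ge0.
pose B := 1 + S0 * C + 4 * a * (S0 * (2 * C)) ^+ 2.
have t1 : 0 <= S0 * C by exact: mulr_ge0.
have t2 : 0 <= 4 * a * (S0 * (2 * C)) ^+ 2 by rewrite mulr_ge0 ?sqr_ge0 ?mulr_ge0.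
exists B, (Num.min e (1 / (S0 * (2 * C) + 1))); split.
- by rewrite /B; lra.
- by rewrite lt_min e0 divr_gt0// ltr_wpDl// mulr_ge0// mulr_ge0.
move=> s h s0 sS; rewrite lt_min => /andP[he1 he2].
have [_ a2 a3 a4 a5] := hC s h s0 sS he1.
have n0 := normc_ge0 h.
have ns : normc s%:C <= S0 by rewrite normc_real ger0_norm.
have e1 : normc (cexp (g k * s%:C)) <= 1.
  by rewrite normc_cexp -expR0 ler_expR cReZ mulr_le0_ge0.
pose w := (g (k + h) - g k) * s%:C.
have wb : normc w <= S0 * (2 * C) * normc h.
  by have := normc_mulM a5 ns; rewrite -/w => hw; apply: (le_trans hw); lra.
have w1 : normc w <= 1.
  apply: (le_trans wb); have : normc h * (S0 * (2 * C) + 1) < 1.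
    by rewrite -ltr_pdivlMr// ltr_wpDl// mulr_ge0// mulr_ge0.
  by move: n0; lra.
split.
- by apply: (le_trans e1); rewrite /B; lra.
- by apply: (le_trans (normc_mulM (normc_mulM ns a2) e1)); rewrite /B; lra.
have -> : g (k + h) * s%:C = g k * s%:C + w by rewrite /w; ring.
rewrite cexpD.
have -> : cexp (g k * s%:C) * cexp w - cexp (g k * s%:C) - h * (s%:C * dg * cexp (g k * s%:C)) =
  cexp (g k * s%:C) * ((cexp w - 1 - w) + (g (k + h) - g k - h * dg) * s%:C).
  by rewrite /w; ring.
have w2 : normc w ^+ 2 <= (S0 * (2 * C) * normc h) ^+ 2.
  by rewrite ler_sqr ?nnegrE ?normc_ge0// !mulr_ge0.
have a40 : 0 <= 4 * a by rewrite mulr_ge0.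
have := cexp_expand w1; rewrite -/a => h1.
have h2 : normc (cexp w - 1 - w) <= 4 * a * (S0 * (2 * C) * normc h) ^+ 2.
  by apply: (le_trans h1); rewrite ler_wpM2l.
apply: (le_trans (normc_mulM e1 (normc_addM h2 (normc_mulM a3 ns)))).
have nn : 0 <= normc h ^+ 2 := sqr_ge0 _.
have -> : B * normc h ^+ 2 = 1 * (4 * a * (S0 * (2 * C) * normc h) ^+ 2 +
  C * normc h ^+ 2 * S0) + normc h ^+ 2 by rewrite /B; ring.
by rewrite lerDl.
Qed.

Lemma expands_expz (g : R[i] -> R[i]) (dg : R[i]) k q : complex.Re (g k) <= 0 ->
  expands (fun k _ => g k) (fun=> dg) k ->
  expands (fun k s => expz (g k) q s) (fun s => dg * dexpz (g k) q s) k.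
Proof.
move=> gk eg; apply: expands_eq (expandsM (expandsX q eg) (expands_exp gk eg)) => // s.
by rewrite /dexpz; ring.
Qed.

End Expansions.

(** * The fourth root *)

Section Kappa.
Variable R : realType.
Implicit Types (z k h : R[i]) (sigma delta d : R).
Local Notation normc := (@Normc.normc R).
Local Notation Re := (@complex.Re R).
Local Notation Im := (@complex.Im R).

(** The real and imaginary parts of a square root of [z] have a positive product, so one of the two
    roots lies in the open first quadrant. *)
Lemma sqrt_quadrant z : 0 < Im z -> exists r, [/\ r ^+ 2 = z, 0 < Re r & 0 < Im r].
Proof.
move=> z0; pose r := sqrtc z; have rz : r ^+ 2 = z := sqr_sqrtc z.
have prod : 0 < Re r * Im r.
  by move: z0; rewrite -rz expr2 cImM; lra.
have [r0|r0] := leP (Re r) 0; last first.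
  by exists r; split => //; move: prod; rewrite pmulr_rgt0.
have rn : Re r < 0.
  by rewrite lt_neqAle r0 andbT; apply: contraTneq prod => ->; rewrite mul0r ltxx.
exists (- r); split; first by rewrite sqrrN.
  by rewrite cReN oppr_gt0.
by move: prod; rewrite nmulr_rgt0// cImN oppr_gt0.
Qed.

Definition symbol sigma k : R[i] := k ^+ 2 + 'i%C * k * sigma%:C.

(** The imaginary part is [Re k (2 Im k + sigma)]; the smallness of [d] keeps the second factor
    positive. *)
Lemma Im_symbol sigma delta d k : 0 < delta -> d < sigma / 2 -> half_strip delta d k ->
  0 < Im (symbol sigma k).
Proof.
move=> d0 ds [k1 k2 _]; rewrite /symbol expr2 cImD cImZ !cImM /=.
have a0 : 0 < Re k by exact: lt_trans k1.
have b0 : 0 < 2 * Im k + sigma by lra.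
have := mulr_gt0 a0 b0; lra.
Qed.

(** Two successive square roots give a root for [xget] to choose. The square of [kappa] is recorded
    to lie in the first quadrant too: [Im kappa^4 = 2 Re kappa^2 Im kappa^2] and its positivity fix
    the sign of [Re kappa^2]. This is used to bound differences of roots. *)
Lemma kappaP sigma k : 0 < Im (symbol sigma k) ->
  [/\ kappa sigma k ^+ 4 = symbol sigma k, 0 < Re (kappa sigma k), 0 < Im (kappa sigma k),
   0 < Re (kappa sigma k ^+ 2) & 0 < Im (kappa sigma k ^+ 2)].
Proof.
move=> s0; have [k4 kr ki] : [/\ kappa sigma k ^+ 4 = symbol sigma k,
    0 < Re (kappa sigma k) & 0 < Im (kappa sigma k)].
  have [u [u2 ur ui]] := sqrt_quadrant s0; have [v [v2 vr vi]] := sqrt_quadrant ui.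
  apply: (@xgetPex _ 0 [set z | [/\ z ^+ 4 = symbol sigma k, 0 < Re z & 0 < Im z]]).
  by exists v; split => //; rewrite (exprM v 2 2) v2.
split => //; last by rewrite expr2 cImM addr_gt0// mulr_gt0.
have i2 : 0 < Im (kappa sigma k ^+ 2) by rewrite expr2 cImM addr_gt0// mulr_gt0.
move: s0; rewrite -k4 (exprM _ 2 2) [X in Im X]expr2 cImM => s0.
have : 0 < Im (kappa sigma k ^+ 2) * (2 * Re (kappa sigma k ^+ 2)) by lra.
by rewrite pmulr_rgt0// pmulr_rgt0.
Qed.

(** No cancellation occurs in a sum of two numbers of the first quadrant. *)
Lemma normc_quadrant z w : 0 < Re z -> 0 < Im z -> 0 < Re w -> 0 < Im w ->
  normc z <= normc (w + z).
Proof.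
move=> zr zi wr wi; rewrite -ler_sqr ?nnegrE ?normc_ge0// !normc_sqr cReD cImD.
have := mulr_gt0 zr wr; have := mulr_gt0 zi wi.
have := sqr_ge0 (Re w); have := sqr_ge0 (Im w); nra.
Qed.

Lemma half_strip_open delta d k : half_strip delta d k ->
  exists2 e : R, 0 < e & forall h, normc h < e -> half_strip delta d (k + h).
Proof.
move=> [k1 k2 k3].
exists (Num.min (Re k - delta) (Num.min (Im k + d) (d - Im k))).
  by rewrite !lt_min; apply/and3P; split; lra.
move=> h; rewrite !lt_min => /and3P[h1 h2 h3].
have := Re_le_normc h; have := Im_le_normc h; rewrite !ler_norml => /andP[i1 i2] /andP[r1 r2].
by split; rewrite ?cReD ?cImD; lra.
Qed.

(** [|kappa|^4 = |k| |k + i sigma|], and both factors lie between [delta] and [|k| + sigma]. *)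
Lemma normc_kappa sigma delta d k : 0 < sigma -> 0 < delta -> d < sigma / 2 ->
  half_strip delta d k ->
  [/\ delta <= normc k, delta <= normc (kappa sigma k) ^+ 2 &
      normc (kappa sigma k) ^+ 2 <= normc k + sigma].
Proof.
move=> s0 d0 ds sk; have [k4 _ _ _ _] := kappaP (Im_symbol d0 ds sk).
have [k1 k2 k3] := sk.
have nk : delta <= normc k.
  by apply: (le_trans (ltW k1)); apply: (le_trans (ler_norm _)); exact: Re_le_normc.
have nks : delta <= normc (k + 'i%C * sigma%:C).
  apply: (le_trans (ltW k1)); apply: (le_trans (ler_norm _)).
  by have := Re_le_normc (k + 'i%C * sigma%:C); rewrite cReD cReZ /= mul0r addr0.
have n4 : (normc (kappa sigma k) ^+ 2) ^+ 2 = normc k * normc (k + 'i%C * sigma%:C).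
  rewrite -exprM -normcX k4 /symbol -Normc.normcM; congr normc; ring.
have up : normc (k + 'i%C * sigma%:C) <= normc k + sigma.
  apply: (le_trans (le_normcD _ _)); rewrite lerD2l Normc.normcM normc_real gtr0_norm//.
  by rewrite /= expr0n expr1n add0r sqrtr1 mul1r.
split => //.
  rewrite -ler_sqr ?nnegrE ?sqr_ge0 ?(ltW d0)// n4 expr2.
  by apply: ler_pM => //; exact: ltW.
rewrite -ler_sqr ?nnegrE ?sqr_ge0//; last by rewrite addr_ge0 ?normc_ge0// ltW.
rewrite n4 [leRHS]expr2; apply: ler_pM; rewrite ?normc_ge0// lerDl; exact: ltW.
Qed.

(** With [D] the increment of [kappa], the difference of the fourth powers is [D S = h w + h^2],
    where [S] is a product of two sums. By [normc_quadrant] each sum is bounded below, so [D = O(h)]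
    follows at once, with no continuity of the branch known beforehand. *)
Lemma expands_kappa (S0 : R) sigma delta d k : 0 < delta -> d < sigma / 2 ->
  half_strip delta d k ->
  expands S0 (fun k _ => kappa sigma k)
    (fun=> (2 * k + 'i%C * sigma%:C) / (4 * kappa sigma k ^+ 3)) k.
Proof.
move=> d0 ds sk; have [e e0 he] := half_strip_open sk.
have [k4 kr ki kr2 ki2] := kappaP (Im_symbol d0 ds sk).
set kap := kappa sigma k in k4 kr ki kr2 ki2 *.
pose m := normc kap.
have m0 : 0 < m by rewrite /m (lt_le_trans kr)// (le_trans (ler_norm _))// Re_le_normc.
have kn : kap != 0 by apply: contraTneq m0 => k0; rewrite /m k0 Normc.normc0 ltxx.
pose w := 2 * k + 'i%C * sigma%:C.
pose L := normc w + 1.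
have L0 : 0 < L by rewrite ltr_wpDl ?normc_ge0.
pose A := L / m ^+ 3.
have A0 : 0 <= A by rewrite divr_ge0 ?(ltW L0)// (exprn_ge0 3 (ltW m0)).
pose P := 6 * m ^+ 2 + 4 * m * A + A ^+ 2.
have P0 : 0 <= P.
  rewrite /P; have := sqr_ge0 m; have := sqr_ge0 A; have := mulr_ge0 (ltW m0) A0; lra.
have m3 : 0 < m ^+ 3 by rewrite exprn_gt0.
pose C := (4 * m ^+ 3 + L * (A * P)) / (m ^+ 3 * (4 * m ^+ 3)).
have t1 : 0 <= 4 * m ^+ 3 + L * (A * P).
  by have := mulr_ge0 (ltW L0) (mulr_ge0 A0 P0); have := ltW m3; lra.
have t2 : 0 < m ^+ 3 * (4 * m ^+ 3) by rewrite mulr_gt0// mulr_gt0.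
have C0 : 0 <= C by rewrite divr_ge0// ltW.
have n4 : normc (4 : R[i]) = 4.
  by rewrite -[4 in LHS](rmorph_nat (real_complex R) 4) normc_real ger0_norm.
have dk0 : 0 <= normc (w / (4 * kap ^+ 3)) := normc_ge0 _.
exists (C + m + normc (w / (4 * kap ^+ 3))), (Num.min e 1); split.
- by rewrite !addr_ge0// ltW.
- by rewrite lt_min e0 ltr01.
move=> s h _ _; rewrite lt_min => /andP[h1 h2]; have n0 := normc_ge0 h.
split; [rewrite -/m; lra|rewrite -/w; have := ltW m0; lra|].
have [q4 qr qi qr2 qi2] := kappaP (Im_symbol d0 ds (he h h1)).
set ka2 := kappa sigma (k + h) in q4 qr qi qr2 qi2 *.
pose S := (ka2 + kap) * (ka2 ^+ 2 + kap ^+ 2).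
have Sm : m ^+ 3 <= normc S.
  rewrite /S Normc.normcM exprS; apply: ler_pM; rewrite ?sqr_ge0 ?(ltW m0)//.
    exact: normc_quadrant.
  by rewrite -normcX; exact: normc_quadrant.
have S0' : 0 < normc S by exact: lt_le_trans Sm.
have Sn : S != 0 by apply: contraTneq S0' => ->; rewrite Normc.normc0 ltxx.
have DS : (ka2 - kap) * S = h * w + h ^+ 2.
  have -> : (ka2 - kap) * S = ka2 ^+ 4 - kap ^+ 4 by rewrite /S; ring.
  by rewrite q4 k4 /symbol /w; ring.
have hw : normc (h * w + h ^+ 2) <= normc h * L.
  rewrite (_ : h * w + h ^+ 2 = h * (w + h)); last by ring.
  apply: normc_mulM => //; apply: normc_addM => //; exact: ltW.
have Db : normc (ka2 - kap) <= A * normc h.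
  have := hw; rewrite -DS Normc.normcM => h3.
  have h4 : normc (ka2 - kap) * m ^+ 3 <= normc h * L.
    by apply: le_trans h3; rewrite ler_wpM2l ?normc_ge0.
  by rewrite /A mulrAC ler_pdivlMr// (mulrC L).
have DA : normc (ka2 - kap) <= A.
  by apply: (le_trans Db); rewrite ler_piMr// ltW.
set D := ka2 - kap in DS Db DA *.
have -> : D - h * (w / (4 * kap ^+ 3)) =
   (h ^+ 2 * (4 * kap ^+ 3) + h * w * (- (D * (6 * kap ^+ 2 + 4 * kap * D + D ^+ 2)))) *
   (S * (4 * kap ^+ 3))^-1.
  (* [S] equals [4 kappa^3] up to a term of the order of [D]; replacing one by the other in
     [D S = h w + h^2] therefore costs [O(h^2)]. *)
  have -> : D * (6 * kap ^+ 2 + 4 * kap * D + D ^+ 2) = S - 4 * kap ^+ 3.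
    by rewrite /S /D; ring.
  have -> : h ^+ 2 * (4 * kap ^+ 3) + h * w * (- (S - 4 * kap ^+ 3)) =
    (h * w + h ^+ 2) * (4 * kap ^+ 3) - h * w * S by ring.
  by rewrite -DS; field; rewrite kn Sn.
have b1 : normc (4 * kap ^+ 3) = 4 * m ^+ 3 by rewrite Normc.normcM n4 normcX.
have nD := lexx (normc D).
have b2 : normc (6 * kap ^+ 2 + 4 * kap * D + D ^+ 2) <= P.
  have n6 : normc (6 : R[i]) <= 6.
    by rewrite -[6 in leLHS](rmorph_nat (real_complex R) 6) normc_real ger0_norm.
  have n4' : normc (4 : R[i]) <= 4 by rewrite n4.
  have nk2 : normc (kap ^+ 2) <= m ^+ 2 by rewrite normcX.
  have nD2 : normc (D ^+ 2) <= A ^+ 2 by rewrite normcX ler_sqr ?nnegrE ?normc_ge0.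
  exact: (normc_addM (normc_addM (normc_mulM n6 nk2)
    (normc_mulM (normc_mulM n4' (lexx m)) DA)) nD2).
rewrite Normc.normcM Normc.normcV Normc.normcM b1.
have wL : normc w <= L by rewrite /L lerDl.
have hh : normc (h ^+ 2) <= normc h ^+ 2 by rewrite normcX.
have b3 : normc (4 * kap ^+ 3) <= 4 * m ^+ 3 by rewrite b1.
apply: (@le_trans _ _ (C * normc h ^+ 2)); last first.
  by rewrite ler_wpM2r ?sqr_ge0//; have := ltW m0; lra.
rewrite ler_pdivrMr; last by rewrite mulr_gt0// mulr_gt0.
apply: (le_trans (normc_addM (normc_mulM hh b3) (normc_mulM (normc_mulM (lexx _) wL)
  (normc_oppM (normc_mulM Db b2))))).
apply: (@le_trans _ _ (C * normc h ^+ 2 * (m ^+ 3 * (4 * m ^+ 3)))).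
  by rewrite le_eqVlt; apply/orP; left; apply/eqP; rewrite /C; field; exact: lt0r_neq0.
apply: ler_wpM2l; first by rewrite mulr_ge0// sqr_ge0.
apply: ler_wpM2r => //.
by rewrite mulr_ge0// ltW.
Qed.

End Kappa.

(** * The resolvent *)

Section Numerators.
Variable R : realType.
Variable rad : R.
Hypothesis rad0 : 0 < rad.
Let S0 : R := 2 * rad + 1.
Implicit Types (z k h c : R[i]) (s : R) (N : nat -> R -> R[i]).
Local Notation normc := (@Normc.normc R).

Lemma numeratorC_intro (M : R) N : (forall q s, cder s (N q) (N q.+1 s)) ->
  (forall s, 0 <= s -> s <= S0 -> normc (N 6%N s) <= M) ->
  (forall j, (j < 6)%N -> normc (N j 0) <= M) -> N 0%N 0 = 0 -> N 4%N 0 = 0 ->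
  numeratorC rad M N.
Proof.
move=> dN N6 Nz N0 N4; split; split.
- by move=> q s _; case: (dN q s).
- by move=> s s0 sS; exact: le_trans (Re_le_normc _) (N6 s s0 sS).
- by move=> j j6; exact: le_trans (Re_le_normc _) (Nz j j6).
- by rewrite N0.
- by rewrite N4.
- by move=> q s _; case: (dN q s).
- by move=> s s0 sS; exact: le_trans (Im_le_normc _) (N6 s s0 sS).
- by move=> j j6; exact: le_trans (Im_le_normc _) (Nz j j6).
- by rewrite N0.
- by rewrite N4.
Qed.

(** The q-th derivative in [s] of the numerator [c (e^(izs) - e^(-zs))]. *)
Definition expdiff c z q s : R[i] := c * (expz ('i%C * z) q s - expz (- z) q s).

(* The formal derivative of [expdiff c z] in a parameter on which [c] and [z] depend,
   with derivatives [dc] and [dz]. *)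
Definition dexpdiff c z dc dz q s : R[i] :=
  dc * (expz ('i%C * z) q s - expz (- z) q s) +
  c * ('i%C * dz * dexpz ('i%C * z) q s + dz * dexpz (- z) q s).

Lemma cder_expdiff c z q s : cder s (expdiff c z q) (expdiff c z q.+1 s).
Proof.
apply: cder_eq (cderZ c (cderD (cder_expz ('i%C * z) q s)
  (cderZ (-1) (cder_expz (- z) q s)))) => [t|]; rewrite /expdiff; ring.
Qed.

Lemma cder_dexpdiff c z dc dz q s : cder s (dexpdiff c z dc dz q) (dexpdiff c z dc dz q.+1 s).
Proof.
apply: cder_eq (cderD (cder_expdiff dc z q s) (cderZ c (cderD
  (cderZ ('i%C * dz) (cder_dexpz ('i%C * z) q s)) (cderZ dz (cder_dexpz (- z) q s))))) => [t|];
  by rewrite /dexpdiff /expdiff.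
Qed.

Let expz0 z q : expz z q 0 = z ^+ q.
Proof. by rewrite /expz rmorph0 mulr0 cexp0 mulr1. Qed.

Let i4 : ('i%C : R[i]) ^+ 4 = 1.
Proof. by rewrite (exprM _ 2 2) sqr_i sqrrN expr1n. Qed.

(** [iz] and [-z] have the same fourth power, so at [s = 0] the fourth derivatives of the two
    exponentials cancel just as their values do. *)
Lemma expdiff_zero c z : expdiff c z 0 0 = 0 /\ expdiff c z 4 0 = 0.
Proof.
rewrite /expdiff !expz0 !expr0 subrr mulr0; split => //.
by rewrite exprMn i4 mul1r (_ : (- z) ^+ 4 = z ^+ 4) ?subrr ?mulr0//; ring.
Qed.

Let dexpz0 z q : dexpz z q 0 = q%:R * z ^+ q.-1.
Proof. by rewrite /dexpz rmorph0 !mulr0 cexp0 mul0r add0r mulr1. Qed.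

Lemma dexpdiff_zero c z dc dz : dexpdiff c z dc dz 0 0 = 0 /\ dexpdiff c z dc dz 4 0 = 0.
Proof.
have e q : dexpdiff c z dc dz q 0 = expdiff dc z q 0 +
   c * ('i%C * dz * (q%:R * ('i%C * z) ^+ q.-1) + dz * (q%:R * (- z) ^+ q.-1)).
  by rewrite -!dexpz0.
have [z1 z2] := expdiff_zero dc z.
rewrite !e z1 z2; split; first by ring.
rewrite /= exprMn.
have -> : 0 + c * ('i%C * dz * (4%:R * ('i%C ^+ 3 * z ^+ 3)) + dz * (4%:R * (- z) ^+ 3)) =
  c * dz * 4%:R * z ^+ 3 * ('i%C ^+ 4 - 1) by ring.
by rewrite i4 subrr mulr0.
Qed.

Lemma expdiff_bound c z q s : 0 <= s -> 0 < complex.Re z -> 0 < complex.Im z ->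
  normc (expdiff c z q s) <= normc c * (2 * normc z ^+ q).
Proof.
move=> s0 zr zi; rewrite /expdiff; apply: normc_mulM => //.
have ni : normc ('i%C : R[i]) = 1 by rewrite /= expr0n expr1n add0r sqrtr1.
have b w : complex.Re w <= 0 -> normc w = normc z -> normc (expz w q s) <= normc z ^+ q.
  move=> w0 wz; rewrite /expz Normc.normcM normcX wz normc_cexp ler_piMr ?exprn_ge0 ?normc_ge0//.
  by rewrite -expR0 ler_expR cReZ mulr_le0_ge0.
rewrite mulr_natl mulr2n; apply: normc_addM; [|apply: normc_oppM]; apply: b.
- by rewrite cReM /=; lra.
- by rewrite Normc.normcM ni mul1r.
- by rewrite cReN; lra.
- exact: normcN.
Qed.

Lemma numeratorC_expdiff c z : 0 < complex.Re z -> 0 < complex.Im z ->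
  numeratorC rad (2 * normc c * (1 + normc z ^+ 6)) (expdiff c z).
Proof.
move=> zr zi; have [z0 z4] := expdiff_zero c z; have n0 := normc_ge0 z.
have c0 : 0 <= 2 * normc c by rewrite mulr_ge0// normc_ge0.
have pw q : (q <= 6)%N -> normc z ^+ q <= 1 + normc z ^+ 6.
  move=> q6; have [z1|z1] := leP (normc z) 1.
    apply: (@le_trans _ _ 1); first exact: exprn_ile1.
    by rewrite lerDl exprn_ge0.
  apply: (@le_trans _ _ (normc z ^+ 6)); last by rewrite lerDr.
  by rewrite ler_weXn2l// ltW.
have b q s : (q <= 6)%N -> 0 <= s -> normc (expdiff c z q s) <= 2 * normc c * (1 + normc z ^+ 6).
  move=> q6 s0; apply: (le_trans (expdiff_bound c q s0 zr zi)).
  by rewrite mulrCA mulrA ler_wpM2l// pw.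
apply: numeratorC_intro => //.
- by move=> q s; exact: cder_expdiff.
- by move=> s s0 _; exact: b.
- by move=> j j6; apply: b => //; exact: ltnW.
Qed.

Let S01 : 1 <= S0. Proof. by rewrite /S0 lerDr mulr_ge0 ?(ltW rad0). Qed.

Lemma expands_expdiff (c z : R[i] -> R[i]) dc dz k q : 0 < complex.Re (z k) ->
  0 < complex.Im (z k) -> expands S0 (fun k _ => c k) (fun=> dc) k ->
  expands S0 (fun k _ => z k) (fun=> dz) k ->
  expands S0 (fun k s => expdiff (c k) (z k) q s) (dexpdiff (c k) (z k) dc dz q) k.
Proof.
move=> zr zi ec ez.
have cst a : expands S0 (fun _ _ => a) (fun=> 0) k.
  by apply: (expands_cst S01 (c := fun=> a) (B := normc a)).
have eiz : expands S0 (fun k _ => 'i%C * z k) (fun=> 'i%C * dz) k.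
  apply: expands_eq (expandsM (cst 'i%C) ez) => // s; ring.
have enz : expands S0 (fun k _ => - z k) (fun=> - dz) k.
  by apply: expands_eq (expandsM (cst (-1)) ez) => [k' s|s]; ring.
have e1 := expands_expz S01 q (g := fun k => 'i%C * z k) (k := k) _ eiz.
have e2 := expands_expz S01 q (g := fun k => - z k) (k := k) _ enz.
have r1 : complex.Re ('i%C * z k) <= 0 by rewrite cReM /=; lra.
have r2 : complex.Re (- z k) <= 0 by rewrite cReN; lra.
apply: expands_eq (expandsM ec (expandsD (e1 r1) (expandsM (cst (-1)) (e2 r2)))) => [k' s|s].
  by rewrite /expdiff; ring.
by rewrite /dexpdiff; ring.
Qed.

Lemma expands_uniform (g : nat -> R[i] -> R -> R[i]) (dg : nat -> R -> R[i]) k n :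
  (forall q, expands S0 (g q) (dg q) k) -> exists C eta : R, [/\ 0 <= C, 0 < eta &
  forall q s h, (q < n)%N -> 0 <= s -> s <= S0 -> normc h < eta ->
  normc (dg q s) <= C /\ normc (g q (k + h) s - g q k s - h * dg q s) <= C * normc h ^+ 2].
Proof.
move=> eg; elim: n => [|n [C [eta [C0 e0 hC]]]]; first by exists 0, 1.
have [C' [eta' [C0' e0' hC']]] := eg n.
exists (C + C'), (Num.min eta eta'); split; [exact: addr_ge0|by rewrite lt_min e0|].
move=> q s h; rewrite ltnS leq_eqVlt lt_min => /orP[/eqP ->|qn] s0 sS /andP[h1 h2].
  have [_ b1 b2] := hC' s h s0 sS h2; split.
    by apply: (le_trans b1); rewrite lerDr.
  by apply: (le_trans b2); rewrite ler_wpM2r ?sqr_ge0// lerDr.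
have [b1 b2] := hC q s h qn s0 sS h1; split.
  by apply: (le_trans b1); rewrite lerDl.
by apply: (le_trans b2); rewrite ler_wpM2r ?sqr_ge0// lerDl.
Qed.

End Numerators.

(** * Powers are dominated by the exponential *)

Section Domination.
Variable R : realType.
Implicit Types (t x sigma delta rad : R).

Lemma expR_ge_pow6 x : 0 <= x -> (x / 6) ^+ 6 <= expR x.
Proof.
move=> x0; have -> : expR x = expR (x / 6) ^+ 6.
  by rewrite -expRM_natr; congr expR; field.
have x6 : 0 <= x / 6 by rewrite divr_ge0.
apply: lerXn2r; rewrite ?nnegrE ?expR_ge0//.
by apply: le_trans (expR_ge1Dx _); rewrite lerDr.
Qed.

(** Since [x >= delta], the sum [x + sigma] is at most [(1 + 1/delta) ((sigma + 1) x^(1/2))^2]. Its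
    cube is then a sixth power of the exponent, up to a constant free of [sigma], and
    [e^X >= (X/6)^6] absorbs it. *)
Lemma domination rad delta : 0 < rad -> 0 < delta -> exists2 C : R, 0 < C &
  forall sigma x j, 0 < sigma -> delta <= x -> (j <= 4)%N ->
  1 + (x + sigma) ^+ 3 <= C * x `^ (j%:R / 2) * expR (2 * rad * (sigma + 1) * x `^ 2^-1).
Proof.
move=> r0 d0.
(* As [tau] is at most 1 and at most [x^(1/2)], its fourth power bounds [x^(j/2)] from below for
   every [j <= 4]. *)
pose B := 1 + delta^-1; pose tau := Num.min 1 (Num.sqrt delta).
have B0 : 0 < B by rewrite addr_gt0// invr_gt0.
have tau0 : 0 < tau by rewrite lt_min ltr01 sqrtr_gt0.
have tau1 : tau <= 1 by rewrite ge_min lexx.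
(* For the exponent [X] below, [X/6 = (rad/3) (sigma + 1) t], so [K (X/6)^6] is exactly
   [(B ((sigma + 1) t)^2)^3]. *)
pose K := B ^+ 3 * (3 / rad) ^+ 6.
have K0 : 0 <= K by rewrite mulr_ge0// exprn_ge0// ?divr_ge0// ltW.
have t40 : 0 < tau ^+ 4 by rewrite exprn_gt0.
exists ((1 + K) / tau ^+ 4); first by rewrite divr_gt0// ltr_wpDr.
move=> sigma x j s0 dx j4.
have x0 : 0 < x by exact: lt_le_trans dx.
pose t := x `^ 2^-1.
have tE : t = Num.sqrt x by rewrite /t powR12_sqrt// ltW.
have t0 : 0 < t by rewrite tE sqrtr_gt0.
have t2 : t ^+ 2 = x by rewrite tE sqr_sqrtr// ltW.
have -> : x `^ (j%:R / 2) = t ^+ j.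
  by rewrite mulrC powRrM -/t powR_mulrn// ltW.
rewrite -/t.
have tj : tau ^+ 4 <= t ^+ j.
  apply: (@le_trans _ _ (tau ^+ j)); first by rewrite ler_wiXn2l// ltW.
  apply: lerXn2r; rewrite ?nnegrE ?(ltW t0) ?(ltW tau0)//.
  by rewrite tE ge_min ler_sqrt ?dx ?orbT// ltW.
set X := 2 * rad * (sigma + 1) * t.
have s1 : 0 < sigma + 1 by rewrite addr_gt0.
have X0 : 0 <= X by rewrite /X !mulr_ge0// ltW.
have eX := expR_ge_pow6 X0; have eX1 : 1 <= expR X by rewrite -expR0 ler_expR.
have base : x + sigma <= B * ((sigma + 1) * t) ^+ 2.
  rewrite exprMn t2.
  have h1 : 1 <= delta^-1 * x by rewrite mulrC ler_pdivlMr// mul1r.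
  have h2 : sigma * 1 <= sigma * (delta^-1 * x) by rewrite ler_wpM2l// ltW.
  have p1 : 0 <= sigma ^+ 2 * x by rewrite mulr_ge0 ?sqr_ge0// ltW.
  have p2 : 0 <= sigma * x by rewrite mulr_ge0// ltW.
  have di : 0 <= delta^-1 by rewrite invr_ge0 ltW.
  have p3 := mulr_ge0 di p1; have p4 := mulr_ge0 di p2; have p5 := mulr_ge0 di (ltW x0).
  rewrite /B; lra.
have cube : (x + sigma) ^+ 3 <= K * expR X.
  apply: (@le_trans _ _ ((B * ((sigma + 1) * t) ^+ 2) ^+ 3)).
    apply: lerXn2r => //; rewrite nnegrE; first by rewrite addr_ge0// ltW.
    by rewrite mulr_ge0 ?sqr_ge0// ltW.
  apply: (@le_trans _ _ (K * (X / 6) ^+ 6)); last by rewrite ler_wpM2l.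
  rewrite le_eqVlt; apply/orP; left; apply/eqP; rewrite /K /X; field; exact: lt0r_neq0.
apply: (@le_trans _ _ ((1 + K) * expR X)); first lra.
by rewrite ler_wpM2r ?expR_ge0// mulrAC ler_pdivlMr// ler_wpM2l// addr_ge0.
Qed.

End Domination.

Section Resolvent.
Variable R : realType.
Variables (rad : R) (rho : R3 R -> R[i]).
Hypothesis rad0 : 0 < rad.
Hypothesis crho : Cc_inftyC (eball rad) rho.
Let D : set (R3 R) := eball rad.
Let mD : measurable D := measurable_eball rad.
Let S0 : R := 2 * rad + 1.
Let S01 : 1 <= S0. Proof. by rewrite /S0 lerDr mulr_ge0 ?(ltW rad0). Qed.
Implicit Types (f g : R3 R -> R[i]) (k h : R[i]) (sigma delta d : R).
Local Notation normc := (@Normc.normc R).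

Lemma inL2_combination (c : R[i]) f g : inL2 D f -> inL2 D g ->
  inL2 D (fun y => c * f y + g y).
Proof.
move=> /inL2P[fr fi] /inL2P[gr gi]; apply/inL2P; split.
  have -> : (fun x => complex.Re (c * f x + g x)) = fun x =>
      (complex.Re c * complex.Re (f x) - complex.Im c * complex.Im (f x)) + complex.Re (g x).
    by apply/funext => x; rewrite cReD cReM.
  by apply: l2D => //; apply: l2B => //; exact: l2Z.
have -> : (fun x => complex.Im (c * f x + g x)) = fun x =>
    (complex.Re c * complex.Im (f x) + complex.Im c * complex.Re (f x)) + complex.Im (g x).
  by apply/funext => x; rewrite cImD cImM.
by apply: l2D => //; apply: l2D => //; exact: l2Z.
Qed.

Lemma bounded_linear_potential (M : R) (N : nat -> R -> R[i])
    (A : (R3 R -> R[i]) -> R3 R -> R[i]) j :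
  0 <= M -> numeratorC rad M N -> (j <= 4)%N ->
  (forall f x, inL2 D f -> D x -> A f x = rho x * potential (N 0%N) (fun y => rho y * f y) x) ->
  bounded_linear_op D j A.
Proof.
move=> M0 nN j4 AE; have [C C0 hC] := cut_estimate rad0 crho; split; last first.
  exists (C * M) => f fD; apply: (hC M N f (A f) j M0 nN fD j4).
  by move=> x Dx; exact: AE.
move=> c f g fD gD; apply: aeW => x Dx; rewrite !AE//; last exact: inL2_combination.
exact: (cut_linear rad0 crho c M0 nN fD gD Dx).
Qed.

Definition coef sigma k : R[i] := (2%:R * kappa sigma k ^+ 2)^-1 * ((4 * pi)^-1)%:C.

Lemma cut_resolventE sigma k f x : 0 < complex.Re (kappa sigma k) ->
  0 < complex.Im (kappa sigma k) -> inL2 D f -> D x ->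
  cut_resolvent rho sigma k f x =
  rho x * potential (expdiff (coef sigma k) (kappa sigma k) 0) (fun y => rho y * f y) x.
Proof.
move=> kr ki fD Dx; set kap := kappa sigma k in kr ki *.
pose a := (2%:R * kap ^+ 2)^-1; pose c : R[i] := ((4 * pi)^-1)%:C.
pose b := 2 * normc c * (1 + normc kap ^+ 6).
have b0 : 0 <= b.
  by rewrite /b !mulr_ge0 ?normc_ge0// addr_ge0// exprn_ge0 ?normc_ge0.
(* A sum with a single term, used to move the constant prefactor under the integral. *)
have := potential_sum rad0 crho [:: tt] (fun=> a) (M := fun=> b) (N := fun=> expdiff c kap)
  (fun=> b0) (fun=> numeratorC_expdiff rad c kr ki) fD Dx.
rewrite big_seq1 => e; rewrite /cut_resolvent /resolvent -/kap; congr (_ * _).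
have -> : expdiff (coef sigma k) kap 0 = fun s => \sum_(i <- [:: tt]) a * expdiff c kap 0 s.
  by apply/funext => s; rewrite big_seq1 /expdiff /coef -/kap -/a -/c; ring.
rewrite -e; congr (_ * Cintegral _ _); apply/funext => y.
rewrite /expdiff /expz !expr0 !mul1r /c.
rewrite (rmorphM (real_complex R) (4 * pi) (enorm (x - y))) /= invfM !fmorphV.
by rewrite -/(real_complex R (4 * pi)) ; ring.
Qed.

Lemma expands_coef sigma delta d k : 0 < delta -> d < sigma / 2 ->
  half_strip delta d k -> exists dc, expands S0 (fun k _ => coef sigma k) (fun=> dc) k.
Proof.
move=> d0 ds sk; have ek := expands_kappa S0 d0 ds sk.
have [_ kr _ _ _] := kappaP (Im_symbol d0 ds sk).
have cst a : expands S0 (fun _ _ => a) (fun=> 0) k.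
  by apply: (expands_cst S01 (c := fun=> a) (B := normc a)).
have kn : kappa sigma k != 0 by apply: contraTneq kr => ->; rewrite ltxx.
have e1 := expandsM (cst 2%:R) (expandsX S01 2 ek).
have k2n : 2%:R * kappa sigma k ^+ 2 != 0 by rewrite mulf_neq0 ?expf_neq0// pnatr_eq0.
have e2 := expands_inv S01 (g := fun k => 2%:R * kappa sigma k ^+ 2) k2n e1.
have e3 := expandsM e2 (cst ((4 * pi)^-1)%:C).
by eexists; exact: e3.
Qed.

(** The candidate derivative is the potential of the derivative [dN] of the numerator, and the error
    of the difference quotient is the potential of a numerator of size [O(|h|)]. Both are then
    covered by [cut_estimate]. *)
Lemma analytic_cut_resolvent sigma delta d j : 0 < delta -> d < sigma / 2 -> (j <= 4)%N ->
  analytic_op D j (cut_resolvent rho sigma) (half_strip delta d).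
Proof.
move=> d0 ds j4 k sk; have [e e0 he] := half_strip_open sk.
have sector h : normc h < e -> 0 < complex.Re (kappa sigma (k + h)) /\
    0 < complex.Im (kappa sigma (k + h)).
  by move=> /he/(Im_symbol d0 ds)/kappaP[].
have [kr ki] : 0 < complex.Re (kappa sigma k) /\ 0 < complex.Im (kappa sigma k).
  by have := sector 0; rewrite addr0 Normc.normc0 => /(_ e0).
have bpos z c : 0 <= 2 * normc c * (1 + normc z ^+ 6).
  by rewrite !mulr_ge0 ?normc_ge0// addr_ge0// exprn_ge0 ?normc_ge0.
split.
  apply: (bounded_linear_potential (bpos _ _) (numeratorC_expdiff rad (coef sigma k) kr ki) j4).
  by move=> f x fD Dx; exact: cut_resolventE.
have [dc ec] := expands_coef d0 ds sk; have ek := expands_kappa S0 d0 ds sk.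
set dz := (_ / _) in ek.
pose dN := dexpdiff (coef sigma k) (kappa sigma k) dc dz.
(* The orders 0 to 6 are those on which the bounds of a numerator bear. *)
have [C [eta [C0 eta0 hC]]] := expands_uniform (rad := rad) 7
  (fun q => expands_expdiff rad0 q kr ki ec ek).
have [dz0 dz4] := dexpdiff_zero (coef sigma k) (kappa sigma k) dc dz.
have S00 : 0 <= S0 by exact: le_trans S01.
have n0e : normc (0 : R[i]) < eta by rewrite Normc.normc0.
have ndN : numeratorC rad C dN.
  apply: numeratorC_intro => //.
  - by move=> q s; exact: cder_dexpdiff.
  - by move=> s s0 sS; exact: (hC 6%N s 0 isT s0 sS n0e).1.
  - by move=> q q6; exact: (hC q 0 0 (ltnW q6) (lexx _) S00 n0e).1.
exists (fun f x => rho x * potential (dN 0%N) (fun y => rho y * f y) x).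
  exact: (bounded_linear_potential C0 ndN j4).
have [C1 C10 hC1] := cut_estimate rad0 crho.
move=> eps eps0.
exists (Num.min e (Num.min eta (eps / (C1 * C + 1)))).
  by rewrite !lt_min e0 eta0 divr_gt0// ltr_wpDl// mulr_ge0.
move=> h hn; rewrite !lt_min => /and3P[h1 h2 h3] f fD.
have nh0 : 0 < normc h.
  rewrite lt_neqAle normc_ge0 andbT eq_sym; apply: contra_neq hn; exact: Normc.eq0_normc.
have [kr' ki'] := sector h h1.
pose N (i : 'I_3) : nat -> R -> R[i] :=
  if (i : nat) == 0%N then expdiff (coef sigma (k + h)) (kappa sigma (k + h))
  else if (i : nat) == 1%N then expdiff (coef sigma k) (kappa sigma k) else dN.
pose M (i : 'I_3) : R :=
  if (i : nat) == 0%N then 2 * normc (coef sigma (k + h)) * (1 + normc (kappa sigma (k + h)) ^+ 6)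
  else if (i : nat) == 1%N then 2 * normc (coef sigma k) * (1 + normc (kappa sigma k) ^+ 6) else C.
pose a (i : 'I_3) : R[i] :=
  if (i : nat) == 0%N then h^-1 else if (i : nat) == 1%N then - h^-1 else -1.
have M0 i : 0 <= M i by rewrite /M; do 2?[case: ifP => _].
have nN i : numeratorC rad (M i) (N i).
  by rewrite /M /N; do 2?[case: ifP => _] => //; exact: numeratorC_expdiff.
(* The quadratic remainder divided by [h]: again a numerator, with the bound [C |h|]. *)
pose Q q s := h^-1 * (expdiff (coef sigma (k + h)) (kappa sigma (k + h)) q s -
  expdiff (coef sigma k) (kappa sigma k) q s - h * dN q s).
have hnb : 0 <= C * normc h by rewrite mulr_ge0// ltW.
have Qb q s : (q < 7)%N -> 0 <= s -> s <= S0 -> normc (Q q s) <= C * normc h.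
  move=> q7 s0 sS; have [_ b] := hC q s h q7 s0 sS h2.
  rewrite /Q Normc.normcM Normc.normcV mulrC ler_pdivrMr//.
  by apply: (le_trans b); rewrite expr2 mulrA.
have [z1 z1'] := expdiff_zero (coef sigma (k + h)) (kappa sigma (k + h)).
have [z2 z2'] := expdiff_zero (coef sigma k) (kappa sigma k).
have nQ : numeratorC rad (C * normc h) Q.
  apply: numeratorC_intro => //.
  - move=> q s; apply: cder_eq (cderZ h^-1 (cderD (cderD (cder_expdiff _ _ q s)
      (cderZ (-1) (cder_expdiff (coef sigma k) (kappa sigma k) q s)))
      (cderZ (- h) (cder_dexpdiff (coef sigma k) (kappa sigma k) dc dz q s)))) => [t|];
      by rewrite /Q /dN mulN1r mulNr.
  - by move=> s s0 sS; exact: Qb.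
  - by move=> q q6; apply: Qb => //; exact: ltnW.
  - by rewrite /Q /dN z1 z2 dz0; ring.
  - by rewrite /Q /dN z1' z2' dz4; ring.
have QE : (fun s => \sum_(i <- enum 'I_3) a i * N i 0%N s) = Q 0%N.
  apply/funext => s; rewrite big_enum /= !big_ord_recr big_ord0 /= /a /N /=.
  by rewrite /Q; field.
apply: le_trans (hC1 (C * normc h) Q f _ j hnb nQ fD j4 _) _.
  move=> x Dx; rewrite -QE -(potential_sum rad0 crho _ a M0 nN fD Dx).
  rewrite big_enum /= !big_ord_recr big_ord0 /= /a /N /= add0r.
  by rewrite !cut_resolventE//; ring.
apply: lee_wpmul2r; first exact: sqrte_ge0.
rewrite lee_fin; move: h3; rewrite ltr_pdivlMr; last by rewrite ltr_wpDl// mulr_ge0.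
by have := ltW nh0; lra.
Qed.

(** Because [|kappa|^2 >= delta], the prefactor contributes at most [1/delta]; the remaining growth
    [1 + |kappa|^6 <= 1 + (|k| + sigma)^3] is left to [domination]. The constant is chosen before
    [sigma], [k] and [j]. *)
Lemma cut_resolvent_estimate delta d : 0 < delta -> exists2 C : R, 0 < C &
  forall sigma k j f, 0 < sigma -> d < sigma / 2 -> half_strip delta d k -> (j <= 4)%N ->
  inL2 D f -> (Hnorm D j (cut_resolvent rho sigma k f)
    <= (C * normc k `^ (j%:R / 2) * expR (2 * rad * (sigma + 1) * normc k `^ 2^-1))%:E
       * L2norm D f)%E.
Proof.
move=> d0; have [C1 C10 hC1] := cut_estimate rad0 crho.
have [C2 C20 hC2] := domination rad0 d0.
exists ((C1 + 1) / delta * C2).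
  by rewrite mulr_gt0// divr_gt0// ltr_wpDl.
move=> sigma k j f s0 ds sk j4 fD.
have [_ kr ki _ _] := kappaP (Im_symbol d0 ds sk).
have [nk nk1 nk2] := normc_kappa s0 d0 ds sk.
set kap := kappa sigma k in kr ki nk1 nk2.
set m := 2 * normc (coef sigma k) * (1 + normc kap ^+ 6).
have m0 : 0 <= m by rewrite !mulr_ge0 ?normc_ge0// addr_ge0// exprn_ge0 ?normc_ge0.
have := hC1 m (expdiff (coef sigma k) kap) f (cut_resolvent rho sigma k f) j m0
  (numeratorC_expdiff rad (coef sigma k) kr ki) fD j4 (fun x Dx => cut_resolventE kr ki fD Dx).
move=> h; apply: (le_trans h); apply: lee_wpmul2r; first exact: sqrte_ge0.
rewrite lee_fin.
have kp : 0 < normc kap ^+ 2 by exact: lt_le_trans nk1.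
have cb : 2 * normc (coef sigma k) <= delta^-1.
  rewrite /coef -/kap Normc.normcM Normc.normcV Normc.normcM normc_real normcX.
  have -> : normc (2%:R : R[i]) = 2.
    by rewrite -(rmorph_nat (real_complex R) 2) normc_real ger0_norm.
  have p2 : 2 <= pi :> R by exact: pi_ge2.
  rewrite ger0_norm; last by rewrite invr_ge0 mulr_ge0// (le_trans _ p2).
  have ki1 : (normc kap ^+ 2)^-1 <= delta^-1 by rewrite lef_pV2 ?posrE.
  have pi1 : (4 * pi)^-1 <= 1 :> R.
    by rewrite invf_le1; lra.
  rewrite invfM.
  have -> : 2 * (2^-1 * (normc kap ^+ 2)^-1 / (4 * pi)) = (normc kap ^+ 2)^-1 / (4 * pi).
    by rewrite !mulrA divff ?mul1r// pnatr_eq0.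
  apply: (le_trans _ ki1); rewrite ler_piMr// invr_ge0 ltW//.
have k6 : normc kap ^+ 6 <= (normc k + sigma) ^+ 3.
  rewrite (exprM _ 2 3); apply: lerXn2r; rewrite ?nnegrE ?sqr_ge0//.
  by rewrite addr_ge0 ?normc_ge0// ltW.
have dom := hC2 sigma (normc k) j s0 nk j4.
have k60 : 0 <= normc kap ^+ 6 by rewrite exprn_ge0 ?normc_ge0.
have di : 0 < delta^-1 by rewrite invr_gt0.
have mb : m <= delta^-1 * (C2 * normc k `^ (j%:R / 2) *
    expR (2 * rad * (sigma + 1) * normc k `^ 2^-1)).
  apply: ler_pM => //; rewrite ?mulr_ge0 ?normc_ge0 ?addr_ge0//.
  by apply: le_trans dom; rewrite lerD2l.
set W := C2 * _ * _ in dom mb.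
have -> : (C1 + 1) / delta * C2 * normc k `^ (j%:R / 2) *
    expR (2 * rad * (sigma + 1) * normc k `^ 2^-1) = (C1 + 1) * (delta^-1 * W).
  by rewrite /W; ring.
by apply: ler_pM => //; rewrite lerDl.
Qed.

End Resolvent.

(** The order of the quantifiers renders the generic constant: the threshold for [d] may depend on
    [sigma] and [delta], whereas [C] is fixed before [sigma], [k] and [j]. *)
Theorem lemma2p2 (R : realType) :
  exists2 d0 : R -> R -> R,
    forall sigma delta : R, 0 < sigma -> 0 < delta -> 0 < d0 sigma delta &
  forall (rad delta d : R) (rho : R3 R -> R[i]),
    0 < rad -> 0 < delta -> 0 < d -> Cc_inftyC (eball rad) rho ->
  exists2 C : R, 0 < C &
  forall sigma : R, 0 < sigma -> d < d0 sigma delta ->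
    (forall j : nat, (j <= 4)%N ->
       analytic_op (eball rad) j (cut_resolvent rho sigma) (half_strip delta d)) /\
    (forall (k : R[i]) (j : nat), half_strip delta d k -> (j <= 4)%N ->
     forall f : R3 R -> R[i], inL2 (eball rad) f ->
       (Hnorm (eball rad) j (cut_resolvent rho sigma k f)
          <= (C * Normc.normc k `^ (j%:R / 2)
              * expR (2 * rad * (sigma + 1) * Normc.normc k `^ 2^-1))%:E
             * L2norm (eball rad) f)%E).
Proof.
exists (fun sigma _ => sigma / 2) => [sigma delta s0 _|rad delta d rho r0 d0 _ crho].
  by rewrite divr_gt0.
have [C C0 hC] := cut_resolvent_estimate r0 crho d d0.
exists C => // sigma s0 ds; split; first by move=> j j4; exact: analytic_cut_resolvent.
by move=> k j sk j4 f fD; exact: hC.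
Qed.
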